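(* Let $p$ be an odd prime and $A\subseteq \mathbb{F}_p$ a set with $|A| \le p^{2846/4991}$. Then for any $c<\frac{1}{434}$ one has $\mathsf{D}^\times (A) \ll |A|^{13/2 -c}$. Further, if $|A| \le p^{48/97}$, then for any $c_1< \frac{1}{192}$ one has $\mathsf{D}^\times (A) \ll |A|^{13/2 -c_1}$. (Implied constants may depend on $c$, resp. $c_1$.)
   Context: $\mathsf{D}^\times(A)$ is the number of $(a_1,a_2,a_3,a_4,a'_1,a'_2,a'_3,a'_4)\in A^8$ with $(a_1-a_2)(a_3-a_4)=(a'_1-a'_2)(a'_3-a'_4)$. *)

(* Defs.v *)
From mathcomp Require Import all_boot all_order all_algebra.
Set Implicit Arguments.
Unset Strict Implicit.
Unset Printing Implicit Defensive.
Import GRing.Theory.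
Local Open Scope ring_scope.

Definition Dtimes (p : nat) (A : {set 'F_p}) : nat :=
  #|[set t : ('F_p * 'F_p * 'F_p * 'F_p) * ('F_p * 'F_p * 'F_p * 'F_p) |
      let: ((a1, a2, a3, a4), (b1, b2, b3, b4)) := t in
      [&& a1 \in A, a2 \in A, a3 \in A, a4 \in A,
          b1 \in A, b2 \in A, b3 \in A, b4 \in A &
          (a1 - a2) * (a3 - a4) == (b1 - b2) * (b3 - b4)]]|.

(* Main.v *)
Require Import Defs.
From mathcomp Require Import all_boot all_order all_algebra.
From mathcomp Require Import all_classical all_reals all_analysis.
From mathcomp Require Import ring lra zify.
Set Implicit Arguments.
Unset Strict Implicit.
Unset Printing Implicit Defensive.
Import Order.TTheory GRing.Theory Num.Theory.
Local Open Scope ring_scope.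

(* Write n = |A|, let r (s) be the number of representations of s <> 0 as a difference of elements of A, and
   e (x) = sum_s r (s) r (x s).  Up to O(n ^ 6) the quantity to bound is D = sum_x e (x) ^ 2, and up to powers
   of log n we obtain D <= n ^ (13/2 - 1/40) when n <= p ^ (2846/4991), which is more than both claims need.

   The only input from F_p is a Rudnev-type incidence bound.  Points and lines of the plane are encoded as
   two families of lines of F_p(t)^3 with directions on the conic (u ^ 2, u, 1); the transcendental t makes
   each family pairwise disjoint, and two lines of different families meet iff there is a collision
   l (x) = k (y).  With too many collisions, one passes to a subgraph of large minimal degree, interpolates a
   surface of low degree through a small greedily chosen subfamily, and deduces that it contains all the lines.  A
   line of one family then has so many points where the surface is doubly ruled that a flecnode polynomial
   vanishes on it; differentiating this identity along a transversal line of the other family shows that two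
   polynomials P, Q of low degree satisfy (P / Q)'' = 0, whence the parameters of the lines meeting that
   transversal are collinear, against the hypothesis on the point and line sets.

   Consequently there are O(n ^ 5 log n / k ^ 4) lines containing k points of A x A, and
   |{e >= h}| <= n ^ 9 log ^ 2 n / h ^ 3.  These two bounds only yield the exponent 13/2.  To gain, restrict to
   the range X of values of x with e (x) about n ^ (5/2), which carries half of D.  Since e (s / s') is a Gram
   kernel, there are many triangles with two edges in X and the third one popular; on the other hand the
   incidence bound applied to the lines t |-> x (t - a) with x in X and a in A bounds the sum of e (x / y) over
   x, y in X, hence the number of these triangles. *)

(** * Null lines and the surfaces containing them *)

(** Where 13/2 and 1/40 come from, up to logarithms. Since e sums to at most n ^ 4, its values below
    n ^ (5/2) contribute at most n ^ (13/2) to D, and the level bound n ^ 9 / h ^ 3 gives the same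
    for the values above. Both can be sharp only near n ^ (5/2), on a set X of about n ^ (3/2)
    elements. If D were n ^ (13/2), the trace inequality, with sum r <= n ^ 2 and sum e ^ 3 <= n ^
    9, would force the sum of e (y / x) ^ 2 over the popular ratios of X to reach n ^ 8. The
    incidence bound leaves it at most n ^ (5/2) * n ^ 3 * |X| ^ (3/2) = n ^ (31/4). The discrepancy
    n ^ (1/4) turns up in an inequality for D ^ 10, hence 1/40.

    The prime limits the degree of the surfaces: (P / Q)'' = 0 can be integrated twice only for
    degrees below p / 2. The degree is about the square root of N log n for N pairs of an element of
    A and a line, so N log n must be at most a small multiple of p ^ 2; this is the source of the
    conditions with the constant 144. *)

Section TernaryPolynomials.
Variable K : fieldType.

(* A polynomial in three variables is the array of its coefficients; it is only ever evaluated at triples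
   of univariate polynomials. *)
Definition coef3 := nat -> nat -> nat -> K.
Implicit Types (c : coef3) (X Y Z : {poly K}) (q : K * K * K).

Definition deg3_le d c := forall i j k, (d < i + j + k)%N -> c i j k = 0.
(** The cut-off [n] bounds each exponent separately and is not tied to the degree, so that a
    polynomial and its derivatives are evaluated over one index box; beyond the exponents present,
    the value does not depend on it ([res_box]). *)
Definition ev3 n c X Y Z : {poly K} :=
  \sum_(i < n.+1) \sum_(j < n.+1) \sum_(k < n.+1) c i j k *: (X ^+ i * Y ^+ j * Z ^+ k).

Definition dx c : coef3 := fun i j k => c i.+1 j k *+ i.+1.
Definition dy c : coef3 := fun i j k => c i j.+1 k *+ j.+1.
Definition dz c : coef3 := fun i j k => c i j k.+1 *+ k.+1.

Lemma dyx c : dy (dx c) = dx (dy c).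
Proof. by apply/funext=> i; apply/funext=> j; apply/funext=> k; rewrite /dy /dx mulrnAC. Qed.
Lemma dzx c : dz (dx c) = dx (dz c).
Proof. by apply/funext=> i; apply/funext=> j; apply/funext=> k; rewrite /dz /dx mulrnAC. Qed.
Lemma dzy c : dz (dy c) = dy (dz c).
Proof. by apply/funext=> i; apply/funext=> j; apply/funext=> k; rewrite /dz /dy mulrnAC. Qed.

Lemma deg3_dx d c : deg3_le d.+1 c -> deg3_le d (dx c).
Proof. by move=> h i j k l; rewrite /dx h ?mul0rn // !addSn ltnS. Qed.
Lemma deg3_dy d c : deg3_le d.+1 c -> deg3_le d (dy c).
Proof. by move=> h i j k l; rewrite /dy h ?mul0rn // addnS addSn ltnS. Qed.
Lemma deg3_dz d c : deg3_le d.+1 c -> deg3_le d (dz c).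
Proof. by move=> h i j k l; rewrite /dz h ?mul0rn // addnS ltnS. Qed.
Lemma deg3_leW d e c : (d <= e)%N -> deg3_le d c -> deg3_le e c.
Proof. by move=> le h i j k l; apply: h; apply: leq_ltn_trans l. Qed.

(** The index shift of termwise differentiation: the bottom term dies because a constant has
    derivative 0, the top one by the degree bound. *)
Lemma sum_shift (V : nmodType) n (g : nat -> V) :
  g 0%N = 0 -> g n.+1 = 0 -> \sum_(i < n.+1) g i = \sum_(i < n.+1) g i.+1.
Proof.
by move=> g0 gn; rewrite big_ord_recl big_ord_recr /= g0 gn add0r addr0.
Qed.

Lemma deriv_ev3 n c X Y Z : deg3_le n c ->
  (ev3 n c X Y Z)^`() = ev3 n (dx c) X Y Z * X^`() + ev3 n (dy c) X Y Z * Y^`()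
     + ev3 n (dz c) X Y Z * Z^`().
Proof.
move=> hd; rewrite /ev3 raddf_sum /=.
have dX : ev3 n (dx c) X Y Z * X^`() = \sum_(i < n.+1) \sum_(j < n.+1) \sum_(k < n.+1)
    c i j k *: ((X ^+ i)^`() * Y ^+ j * Z ^+ k).
  rewrite /ev3 mulr_suml [RHS](@sum_shift _ n (fun i => \sum_(j < n.+1) \sum_(k < n.+1)
    c i j k *: ((X ^+ i)^`() * Y ^+ j * Z ^+ k))).
  - apply: eq_bigr => i _; rewrite mulr_suml; apply: eq_bigr => j _; rewrite mulr_suml.
    apply: eq_bigr => k _; rewrite deriv_exp /= /dx -!mul_polyC -[c i.+1 j k *+ _]mulr_natr polyCM polyC_natr.
    by rewrite -[_ * _ *+ _]mulr_natr; ring.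
  - by rewrite big1 // => j _; rewrite big1 // => k _; rewrite expr0 derivC !mul0r scaler0.
  - by rewrite big1 // => j _; rewrite big1 // => k _; rewrite hd ?scale0r //; lia.
have dY : ev3 n (dy c) X Y Z * Y^`() = \sum_(i < n.+1) \sum_(j < n.+1) \sum_(k < n.+1)
    c i j k *: (X ^+ i * (Y ^+ j)^`() * Z ^+ k).
  rewrite /ev3 mulr_suml; apply: eq_bigr => i _; rewrite mulr_suml.
  rewrite [RHS](@sum_shift _ n (fun j => \sum_(k < n.+1)
    c i j k *: (X ^+ i * (Y ^+ j)^`() * Z ^+ k))).
  - apply: eq_bigr => j _; rewrite mulr_suml.
    apply: eq_bigr => k _; rewrite deriv_exp /= /dy -!mul_polyC -[c i j.+1 k *+ _]mulr_natr polyCM polyC_natr.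
    by rewrite -[_ * _ *+ _]mulr_natr; ring.
  - by rewrite big1 // => k _; rewrite expr0 derivC mulr0 !mul0r scaler0.
  - by rewrite big1 // => k _; rewrite hd ?scale0r //; lia.
have dZ : ev3 n (dz c) X Y Z * Z^`() = \sum_(i < n.+1) \sum_(j < n.+1) \sum_(k < n.+1)
    c i j k *: (X ^+ i * Y ^+ j * (Z ^+ k)^`()).
  rewrite /ev3 mulr_suml; apply: eq_bigr => i _; rewrite mulr_suml.
  apply: eq_bigr => j _; rewrite mulr_suml.
  rewrite [RHS](@sum_shift _ n (fun k => c i j k *: (X ^+ i * Y ^+ j * (Z ^+ k)^`()))).
  - apply: eq_bigr => k _; rewrite deriv_exp /= /dz -!mul_polyC -[c i j k.+1 *+ _]mulr_natr polyCM polyC_natr.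
    by rewrite -[_ * _ *+ _]mulr_natr; ring.
  - by rewrite expr0 derivC mulr0 scaler0.
  - by rewrite hd ?scale0r //; lia.
rewrite -/(ev3 n (dx c) X Y Z) -/(ev3 n (dy c) X Y Z) -/(ev3 n (dz c) X Y Z) dX dY dZ -!big_split /=.
apply: eq_bigr => i _; rewrite raddf_sum -!big_split /=.
apply: eq_bigr => j _; rewrite raddf_sum -!big_split /=.
apply: eq_bigr => k _; rewrite -!scalerDr /= derivZ !derivM; congr (_ *: _); ring.
Qed.

Lemma horner_ev3 n c X Y Z (X' Y' Z' : {poly K}) z : X.[z] = X'.[z] -> Y.[z] = Y'.[z] -> Z.[z] = Z'.[z] ->
  (ev3 n c X Y Z).[z] = (ev3 n c X' Y' Z').[z].
Proof.
move=> hX hY hZ; rewrite /ev3 !horner_sum; apply: eq_bigr => i _.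
rewrite !horner_sum; apply: eq_bigr => j _; rewrite !horner_sum; apply: eq_bigr => k _.
by rewrite !hornerE hX hY hZ.
Qed.

Definition lnY q : {poly K} := q.1.2%:P + q.1.1 *: 'X.
Definition lnX q : {poly K} := q.2%:P + q.1.1 *: lnY q.
(* The triple (u, v, w) stands for the line (w + u y, y = v + u z, z), of direction (u^2, u, 1). *)
Definition res n c q := ev3 n c (lnX q) (lnY q) 'X.

Lemma size_lnY q : (size (lnY q) <= 2)%N.
Proof.
apply: leq_trans (size_polyD _ _) _; rewrite geq_max (leq_trans (size_polyC_leq1 _)) //=.
by rewrite (leq_trans (size_scale_leq _ _)) // size_polyX.
Qed.
Lemma size_lnX q : (size (lnX q) <= 2)%N.
Proof.
apply: leq_trans (size_polyD _ _) _; rewrite geq_max (leq_trans (size_polyC_leq1 _)) //=.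
by rewrite (leq_trans (size_scale_leq _ _)) // size_lnY.
Qed.

Lemma size_exp2 (P : {poly K}) i : (size P <= 2)%N -> (size (P ^+ i) <= i.+1)%N.
Proof.
move=> h; apply: leq_trans (size_poly_exp_leq _ _) _; rewrite ltnS.
by case: (size P) h => [|[|[|m]]] //= _; rewrite ?mul0n ?mul1n.
Qed.

Lemma size_res n d c q : deg3_le d c -> (size (res n c q) <= d.+1)%N.
Proof.
move=> hd; rewrite /res /ev3.
do 3![apply: (big_ind (fun P : {poly K} => (size P <= d.+1)%N)); rewrite ?size_poly0 //;
  [by move=> P Q hP hQ; apply: leq_trans (size_polyD _ _) _; rewrite geq_max hP | move=> ? _]].
set i := (X in c X _ _); set j := (X in c _ X _); set k := (X in c _ _ X).
case: (ltnP d (i + j + k)) => hl; first by rewrite hd // scale0r size_poly0.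
apply: leq_trans (size_scale_leq _ _) _.
have hX := size_exp2 i (size_lnX q); have hY := size_exp2 j (size_lnY q).
have hZ : (size (('X : {poly K}) ^+ k) <= k.+1)%N by rewrite size_polyXn.
have h1 := size_polyMleq (lnX q ^+ i) (lnY q ^+ j).
have h2 := size_polyMleq (lnX q ^+ i * lnY q ^+ j) ('X ^+ k).
rewrite -/i -/j -/k; lia.
Qed.

Lemma deriv_res n c q : deg3_le n c ->
  (res n c q)^`() = q.1.1 ^+ 2 *: res n (dx c) q + q.1.1 *: res n (dy c) q + res n (dz c) q.
Proof.
move=> h; rewrite /res deriv_ev3 // derivX.
have -> : (lnY q)^`() = q.1.1%:P by rewrite /lnY derivD derivC derivZ derivX add0r alg_polyC.
have -> : (lnX q)^`() = (q.1.1 ^+ 2)%:P.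
  by rewrite /lnX /lnY derivD derivC derivZ derivD derivC derivZ derivX !add0r alg_polyC -mul_polyC -polyCM expr2.
by rewrite mulr1 ![_ * _%:P]mulrC !mul_polyC.
Qed.

Lemma many_roots (I : finType) (S : {set I}) (z : I -> K) (P : {poly K}) :
  {in S &, injective z} -> (forall i, i \in S -> root P (z i)) -> (size P <= #|S|)%N -> P = 0.
Proof.
move=> zi hr hs; apply/eqP; apply/negPn/negP => P0.
have := @max_poly_roots _ P [seq z i | i <- enum S] P0.
rewrite map_inj_in_uniq ?enum_uniq; last by move=> i j; rewrite !mem_enum; apply: zi.
rewrite size_map -cardE => h; have := h _ isT.
rewrite ltnNge hs /= => H; suff: false by []; apply: H.
by apply/allP => _ /mapP[i + ->]; rewrite mem_enum; apply: hr.
Qed.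

Lemma coefM_max (P Q : {poly K}) a b : (size P <= a.+1)%N -> (size Q <= b.+1)%N ->
  (P * Q)`_(a + b) = P`_a * Q`_b.
Proof.
move=> hP hQ; rewrite coefM.
have ha : (a < (a + b).+1)%N by rewrite ltnS leq_addr.
rewrite (bigD1 (Ordinal ha)) //= addKn big1 ?addr0 // => i ne.
case: (ssrnat.ltngtP i a) => hi.
- by rewrite [Q`__]nth_default ?mulr0 //; apply: leq_trans hQ _; lia.
- by rewrite nth_default ?mul0r //; apply: leq_trans hP _; lia.
- by case/eqP: ne; apply: val_inj.
Qed.

(** A quotient with zero derivative is constant as long as the degrees stay below the
    characteristic. If the degrees differ, the top coefficients give (deg P - deg T) lead P lead T =
    0; in general, first subtract the multiple of T that cancels the leading term of P. *)
Lemma wronskian0 m (P T : {poly K}) : (forall k, (0 < k < m)%N -> k%:R != 0 :> K) ->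
  (size P <= m)%N -> (size T <= m)%N -> T != 0 -> P^`() * T = P * T^`() -> exists a, P = a *: T.
Proof.
move=> ch hP hT T0 W.
have main (Q : {poly K}) : (size Q <= m)%N -> Q^`() * T = Q * T^`() -> size Q != size T -> Q = 0.
  move=> hQ WQ ne; apply/eqP; apply/negPn/negP => Q0.
  have sQ : (0 < size Q)%N by rewrite size_poly_gt0.
  have sT : (0 < size T)%N by rewrite size_poly_gt0.
  (* The factor ['X] restores the degree lost by differentiation, so both top coefficients are read
     at the same index. *)
  have /(congr1 (fun R : {poly K} => R`_((size Q).-1 + (size T).-1))) : ('X * Q^`()) * T = Q * ('X * T^`()).
    by rewrite -mulrA WQ; ring.
  have sXd (R : {poly K}) : (0 < size R)%N -> (size ('X * R^`())%R <= (size R).-1.+1)%N.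
    move=> sR; apply: leq_trans (size_polyMleq _ _) _; rewrite size_polyX /= prednK //.
    by rewrite lt_size_deriv // -size_poly_gt0.
  rewrite !coefM_max ?prednK ?sXd //; last 2 first.
  - by rewrite -[X in (_ <= X)%N]prednK // sXd.
  - by rewrite -[X in (_ <= X)%N]prednK // sXd.
  have cX (R : {poly K}) k : ('X * R^`())`_k = R`_k *+ k.
    by rewrite mulrC coefMX coef_deriv; case: k => [|k]; rewrite ?mulr0n.
  rewrite !cX -!lead_coefE -mulr_natl -[_ *+ (size T).-1]mulr_natl => E.
  have : (((size Q).-1)%:R - ((size T).-1)%:R) * (lead_coef Q * lead_coef T) = 0 :> K.
    have -> (x y a b : K) : (x - y) * (a * b) = x * a * b - a * (y * b) by ring.
    by rewrite E subrr.
  have cl a b : (a < b < m)%N -> a%:R != b%:R :> K.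
    by move=> /andP[ab bm]; rewrite eq_sym -subr_eq0 -natrB ?(ltnW ab) // ch //; lia.
  move/eqP; rewrite !mulf_eq0 !lead_coef_eq0 (negPf Q0) (negPf T0) !orbF subr_eq0.
  apply/negP; case: (ssrnat.ltngtP (size Q).-1 (size T).-1) => hl; last by move: ne; lia.
  - by apply: cl; lia.
  - by rewrite eq_sym; apply: cl; lia.
case: (eqVneq (size P) (size T)) => [eqs | ne]; last by exists 0; rewrite scale0r; apply: main.
have l0 : lead_coef T != 0 by rewrite lead_coef_eq0.
pose a := lead_coef P / lead_coef T; exists a; apply/eqP; rewrite -subr_eq0; apply/eqP.
have sT : (0 < size T)%N by rewrite size_poly_gt0.
have lt : (size (P - a *: T)%R < size T)%N.
  rewrite -[X in (_ < X)%N]prednK // ltnS; apply/leq_sizeP => j; rewrite leq_eqVlt => /orP[/eqP <-|hj].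
    by rewrite coefB coefZ -lead_coefE -eqs -lead_coefE /a divfK ?subrr.
  have hj' : (size T <= j)%N by rewrite -(prednK sT).
  by rewrite coefB coefZ !nth_default ?mulr0 ?subrr ?eqs.
apply: main; first by apply: leq_trans (ltnW lt) hT.
- by rewrite derivB derivZ !mulrBl W -!scalerAl -!mul_polyC; ring.
- by rewrite neq_ltn lt.
Qed.

End TernaryPolynomials.

(* Two lines through a point of the surface, of slopes u and w, with P = f_x and Q = f_y + 2 u f_x on the
   first one: the right-hand bracket is Q ^ 3 times the second derivative of P / Q along it, and the
   left-hand side is the derivative of [flec] (below) along the other line. *)
Lemma flec_derivative_identity (K : fieldType) (u w fx fy fz fxx fxy fxz fyy fyz fzz
   fxxx fxxy fxxz fxyy fxyz fxzz fyyy fyyz fyzz fzzz : K) :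
  2%:R != 0 :> K -> u != w ->
  let g := fy + w * fx in
  let fx' := w ^+ 2 * fxx + w * fxy + fxz in
  let g' := w ^+ 2 * fxy + w * fyy + fyz + w * fx' in
  let fxx' := w ^+ 2 * fxxx + w * fxxy + fxxz in
  let fxy' := w ^+ 2 * fxxy + w * fxyy + fxyz in
  let fxz' := w ^+ 2 * fxxz + w * fxyz + fxzz in
  let fyy' := w ^+ 2 * fxyy + w * fyyy + fyyz in
  let fyz' := w ^+ 2 * fxyz + w * fyyz + fyzz in
  let fzz' := w ^+ 2 * fxzz + w * fyzz + fzzz in
  let h := fyy + 2%:R * fxz in
  let h' := fyy' + 2%:R * fxz' in
  let P := fx in
  let P1 := u ^+ 2 * fxx + u * fxy + fxz in
  let P2 := u ^+ 2 * (u ^+ 2 * fxxx + u * fxxy + fxxz) + u * (u ^+ 2 * fxxy + u * fxyy + fxyz)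
       + (u ^+ 2 * fxxz + u * fxyz + fxzz) in
  let Q := fy + 2%:R * u * fx in
  let Q1 := (u ^+ 2 * fxy + u * fyy + fyz) + 2%:R * u * P1 in
  let Q2 := u ^+ 2 * (u ^+ 2 * fxxy + u * fxyy + fxyz) + u * (u ^+ 2 * fxyy + u * fyyy + fyyz)
       + (u ^+ 2 * fxyz + u * fyyz + fyzz) + 2%:R * u * P2 in
  u ^+ 2 * fx + u * fy + fz = 0 ->
  w ^+ 2 * fx + w * fy + fz = 0 ->
  u ^+ 2 * (u ^+ 2 * fxx + u * fxy + fxz) + u * (u ^+ 2 * fxy + u * fyy + fyz)
    + (u ^+ 2 * fxz + u * fyz + fzz) = 0 ->
  w ^+ 2 * (w ^+ 2 * fxx + w * fxy + fxz) + w * (w ^+ 2 * fxy + w * fyy + fyz)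
    + (w ^+ 2 * fxz + w * fyz + fzz) = 0 ->
  u ^+ 2 * P2 + u * (u ^+ 2 * (u ^+ 2 * fxxy + u * fxyy + fxyz) + u * (u ^+ 2 * fxyy + u * fyyy + fyyz)
       + (u ^+ 2 * fxyz + u * fyyz + fyzz)) +
    (u ^+ 2 * (u ^+ 2 * fxxz + u * fxyz + fxzz) + u * (u ^+ 2 * fxyz + u * fyyz + fyzz)
       + (u ^+ 2 * fxzz + u * fyzz + fzzz)) = 0 ->
  (4%:R * fx ^+ 3 * fx' * fzz + fx ^+ 4 * fzz')
   - 2%:R * (3%:R * fx ^+ 2 * fx' * g * fyz + fx ^+ 3 * g' * fyz + fx ^+ 3 * g * fyz')
   + (2%:R * fx * fx' * g ^+ 2 * h + fx ^+ 2 * (2%:R * g * g') * h + fx ^+ 2 * g ^+ 2 * h')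
   - 2%:R * (fx' * g ^+ 3 * fxy + fx * (3%:R * g ^+ 2 * g') * fxy + fx * g ^+ 3 * fxy')
   + (4%:R * g ^+ 3 * g' * fxx + g ^+ 4 * fxx')
  = fx ^+ 2 * (P2 * Q ^+ 2 - 2%:R * P1 * Q1 * Q - P * Q2 * Q + 2%:R * P * Q1 ^+ 2).
Proof.
move=> n2 nuw /= D1 E1 D2 E2 D3.
have n0 : u - w != 0 by rewrite subr_eq0.
have Hy : fy = - (u + w) * fx.
  apply: (mulfI n0); move: D1 E1 => D1 E1.
  have -> : (u - w) * (- (u + w) * fx) = (u-w)*fy - ((u ^+ 2 * fx + u * fy + fz) - (w ^+ 2 * fx + w * fy + fz)) by ring.
  by rewrite D1 E1 !subr0.
have Hz : fz = u * w * fx.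
  have -> : fz = (u ^+ 2 * fx + u * fy + fz) - (u ^+ 2 * fx + u * fy) by ring.
  rewrite D1 Hy; ring.
have Hyz : fyz = - 2%:R^-1 * ((u+w)*(u^+2+w^+2) * fxx + 2%:R * (u^+2+u*w+w^+2) * fxy + (u+w) * (fyy + 2%:R * fxz)).
  apply: (mulfI n0); apply: (mulfI n2).
  transitivity (2%:R * ((u - w) * fyz) - ((u ^+ 2 * (u ^+ 2 * fxx + u * fxy + fxz) + u * (u ^+ 2 * fxy + u * fyy + fyz)
    + (u ^+ 2 * fxz + u * fyz + fzz)) - (w ^+ 2 * (w ^+ 2 * fxx + w * fxy + fxz) + w * (w ^+ 2 * fxy + w * fyy + fyz)
    + (w ^+ 2 * fxz + w * fyz + fzz)))).
    by rewrite D2 E2 !subr0.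
  by field.
have Hzz : fzz = - (u ^+ 2 * (u ^+ 2 * fxx + u * fxy + fxz) + u * (u ^+ 2 * fxy + u * fyy + fyz)
    + (u ^+ 2 * fxz + u * fyz)).
  apply/eqP; rewrite -addr_eq0; apply/eqP; rewrite -D2; ring.
have Hzzz : fzzz = - (u ^+ 2 * (u ^+ 2 * (u ^+ 2 * fxxx + u * fxxy + fxxz) + u * (u ^+ 2 * fxxy + u * fxyy + fxyz)
       + (u ^+ 2 * fxxz + u * fxyz + fxzz)) + u * (u ^+ 2 * (u ^+ 2 * fxxy + u * fxyy + fxyz) + u * (u ^+ 2 * fxyy + u * fyyy + fyyz)
       + (u ^+ 2 * fxyz + u * fyyz + fyzz)) +
    (u ^+ 2 * (u ^+ 2 * fxxz + u * fxyz + fxzz) + u * (u ^+ 2 * fxyz + u * fyyz + fyzz)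
       + (u ^+ 2 * fxzz + u * fyzz))).
  apply/eqP; rewrite -addr_eq0; apply/eqP; rewrite -D3; ring.
rewrite Hzzz Hzz Hyz Hy. field. exact: n2.
Qed.

Section NullLines.
Variable K : fieldType.
Implicit Types (q r b : K * K * K) (c : coef3 K).

(** For lines of different slopes u, [lncross] vanishes exactly when they meet, and [lnz] is then
    the height z of the common point. *)
Definition lncross q r := q.2 - r.2 - (q.1.2 * r.1.1 - r.1.2 * q.1.1).
Definition lnz q r := (r.1.2 - q.1.2) / (q.1.1 - r.1.1).

Lemma ln_meet q r : q.1.1 != r.1.1 -> lncross q r = 0 ->
  (lnY q).[lnz q r] = (lnY r).[lnz q r] /\ (lnX q).[lnz q r] = (lnX r).[lnz q r].
Proof.
case: q => [[u v] w]; case: r => [[u' v'] w']; rewrite /lncross /lnz /lnX /lnY /= => ne /eqP.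
have n0 : u - u' != 0 by rewrite subr_eq0.
rewrite !subr_eq0 subr_eq => /eqP e.
rewrite !hornerE /= e; split; field; exact: n0.
Qed.

Lemma lnzC q r : lnz q r = lnz r q.
Proof. by rewrite /lnz -[X in _ / X]opprB invrN mulrN -mulNr opprB. Qed.

Lemma lncrossC q r : lncross q r = - lncross r q.
Proof. by rewrite /lncross; ring. Qed.

Lemma res_meet n c q r : q.1.1 != r.1.1 -> lncross q r = 0 ->
  (res n c q).[lnz q r] = (res n c r).[lnz q r].
Proof.
move=> ne cr; have [hY hX] := ln_meet ne cr.
exact: horner_ev3.
Qed.

(** Along [q], differentiation acts as u^2 dx + u dy + dz: these are the first three derivatives of
    an identically zero restriction. *)
Lemma res_jets d c q z : deg3_le d c -> res d c q = 0 ->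
  let u := q.1.1 in
  let fx := (res d (dx c) q).[z] in let fy := (res d (dy c) q).[z] in
  let fz := (res d (dz c) q).[z] in
  let fxx := (res d (dx (dx c)) q).[z] in let fxy := (res d (dx (dy c)) q).[z] in
  let fxz := (res d (dx (dz c)) q).[z] in let fyy := (res d (dy (dy c)) q).[z] in
  let fyz := (res d (dy (dz c)) q).[z] in let fzz := (res d (dz (dz c)) q).[z] in
  let fxxx := (res d (dx (dx (dx c))) q).[z] in let fxxy := (res d (dx (dx (dy c))) q).[z] in
  let fxxz := (res d (dx (dx (dz c))) q).[z] in let fxyy := (res d (dx (dy (dy c))) q).[z] in
  let fxyz := (res d (dx (dy (dz c))) q).[z] in let fxzz := (res d (dx (dz (dz c))) q).[z] in
  let fyyy := (res d (dy (dy (dy c))) q).[z] in let fyyz := (res d (dy (dy (dz c))) q).[z] in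
  let fyzz := (res d (dy (dz (dz c))) q).[z] in let fzzz := (res d (dz (dz (dz c))) q).[z] in
  [/\ u ^+ 2 * fx + u * fy + fz = 0,
   u ^+ 2 * (u ^+ 2 * fxx + u * fxy + fxz) + u * (u ^+ 2 * fxy + u * fyy + fyz)
    + (u ^+ 2 * fxz + u * fyz + fzz) = 0 &
   u ^+ 2 * (u ^+ 2 * (u ^+ 2 * fxxx + u * fxxy + fxxz) + u * (u ^+ 2 * fxxy + u * fxyy + fxyz)
       + (u ^+ 2 * fxxz + u * fxyz + fxzz))
   + u * (u ^+ 2 * (u ^+ 2 * fxxy + u * fxyy + fxyz) + u * (u ^+ 2 * fxyy + u * fyyy + fyyz)
       + (u ^+ 2 * fxyz + u * fyyz + fyzz)) +
    (u ^+ 2 * (u ^+ 2 * fxxz + u * fxyz + fxzz) + u * (u ^+ 2 * fxyz + u * fyyz + fyzz)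
       + (u ^+ 2 * fxzz + u * fyzz + fzzz)) = 0].
Proof.
move=> hd h0 /=.
have hx c' : deg3_le d c' -> deg3_le d (dx c') by move=> h; apply/deg3_dx/(deg3_leW (leqnSn d)).
have hy c' : deg3_le d c' -> deg3_le d (dy c') by move=> h; apply/deg3_dy/(deg3_leW (leqnSn d)).
have hz c' : deg3_le d c' -> deg3_le d (dz c') by move=> h; apply/deg3_dz/(deg3_leW (leqnSn d)).
have e0 : (res d c q)^`() = 0 by rewrite h0 derivC.
have e1 := congr1 (@deriv K) e0; have e2 := congr1 (@deriv K) e1.
have := congr1 (fun p => p.[z]) e2; have := congr1 (fun p => p.[z]) e1; have := congr1 (fun p => p.[z]) e0.
do 3![rewrite ?derivD ?derivZ ?deriv_res; try (by auto)].
rewrite ?derivC !(dyx, dzx, dzy) !hornerE /= => E0 E1 E2; split.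
- by rewrite -[RHS]E0.
- by rewrite -[RHS]E1; ring.
- by rewrite -[RHS]E2; ring.
Qed.

(* Along r the tangent plane of the surface contains a second null direction, of slope -g / f_x; flec is
   f_x ^ 4 times the second derivative of the equation in that direction. *)
Definition flec d c r : {poly K} :=
  let g := res d (dy c) r + r.1.1 *: res d (dx c) r in
  res d (dx c) r ^+ 4 * res d (dz (dz c)) r
  - 2%:R *: (res d (dx c) r ^+ 3 * g * res d (dy (dz c)) r)
  + res d (dx c) r ^+ 2 * g ^+ 2 * (res d (dy (dy c)) r + 2%:R *: res d (dx (dz c)) r)
  - 2%:R *: (res d (dx c) r * g ^+ 3 * res d (dx (dy c)) r)
  + g ^+ 4 * res d (dx (dx c)) r.

(** Both slopes u, w solve s^2 fx + s fy + fz = 0 at the common point, so fy = -(u + w) fx and g = -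
    w fx. There [flec] equals fx^4 times the second derivative along [b], which is 0. Nothing is
    divided by fx, so fx = 0 is allowed. *)
Lemma flec_root d c r b : deg3_le d c -> res d c r = 0 -> res d c b = 0 ->
  r.1.1 != b.1.1 -> lncross r b = 0 -> root (flec d c r) (lnz r b).
Proof.
move=> hd hr hb ne cr; rewrite /root; apply/eqP.
have [R1 _ _] := res_jets (lnz r b) hd hr; have [B1 B2 _] := res_jets (lnz r b) hd hb.
move: R1 B1 B2; rewrite /flec /= !hornerE /= -!(res_meet _ _ ne cr).
move: (_.[_]) => fx; move: (_.[_]) => fy; move: (_.[_]) => fz.
move: (_.[_]) => fxx; move: (_.[_]) => fxy; move: (_.[_]) => fxz.
move: (_.[_]) => fyy; move: (_.[_]) => fyz; move: (_.[_]) => fzz R1 B1 B2.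
have n0 : r.1.1 - b.1.1 != 0 by rewrite subr_eq0.
have -> : fy = - (r.1.1 + b.1.1) * fx.
  apply: (mulfI n0).
  transitivity ((r.1.1 - b.1.1) * fy - ((r.1.1 ^+ 2 * fx + r.1.1 * fy + fz) - (b.1.1 ^+ 2 * fx + b.1.1 * fy + fz))).
    by rewrite R1 B1 !subr0.
  by ring.
rewrite -[RHS](mulr0 (fx ^+ 4)) -[X in _ = _ * X]B2; ring.
Qed.

Lemma size_mulD m k (P Q : {poly K}) : (size P <= m.+1)%N -> (size Q <= k.+1)%N -> (size (P * Q)%R <= (m + k).+1)%N.
Proof.
move=> hP hQ; apply: leq_trans (size_polyMleq _ _) _.
by move: (size P) (size Q) hP hQ => x y; lia.
Qed.

Lemma size_addD m (P Q : {poly K}) : (size P <= m)%N -> (size Q <= m)%N -> (size (P + Q)%R <= m)%N.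
Proof. by move=> hP hQ; apply: leq_trans (size_polyD _ _) _; rewrite geq_max hP. Qed.

Lemma size_subD m (P Q : {poly K}) : (size P <= m)%N -> (size Q <= m)%N -> (size (P - Q)%R <= m)%N.
Proof. by move=> hP hQ; apply: size_addD; rewrite ?size_polyN. Qed.

Lemma size_scaleD m a (P : {poly K}) : (size P <= m)%N -> (size (a *: P)%R <= m)%N.
Proof. by apply: leq_trans; apply: size_scale_leq. Qed.

Lemma size_expD m k (P : {poly K}) : (size P <= m.+1)%N -> (size (P ^+ k)%R <= (k * m).+1)%N.
Proof.
move=> hP; elim: k => [|k ih]; first by rewrite expr0 size_poly1.
by rewrite exprS mulSn; apply: size_mulD.
Qed.

Lemma size_flec d c r : deg3_le d c -> (size (flec d c r) <= (5 * d).+1)%N.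
Proof.
move=> hd; rewrite /flec.
have hx c' : deg3_le d c' -> deg3_le d (dx c') by move=> h; apply/deg3_dx/(deg3_leW (leqnSn d)).
have hy c' : deg3_le d c' -> deg3_le d (dy c') by move=> h; apply/deg3_dy/(deg3_leW (leqnSn d)).
have hz c' : deg3_le d c' -> deg3_le d (dz c') by move=> h; apply/deg3_dz/(deg3_leW (leqnSn d)).
set fx := res d (dx c) r; set g := _ + _ *: fx.
have sx : (size fx <= d.+1)%N by apply/size_res/hx.
have sg : (size g <= d.+1)%N by apply: size_addD; [apply/size_res/hy | apply: size_scaleD].
have e5 : (5 * d = 4 * d + d)%N by lia.
have e5' : (5 * d = 3 * d + d + d)%N by lia.
have e5'' : (5 * d = 2 * d + 2 * d + d)%N by lia.
have e5''' : (5 * d = d + 3 * d + d)%N by lia.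
apply: size_addD; last by rewrite e5; apply: size_mulD; [apply: size_expD | apply/size_res/hx/hx].
apply: size_subD; last first.
  apply: size_scaleD; rewrite e5'''; apply: size_mulD; last by apply/size_res/hx/hy.
  by apply: size_mulD => //; apply: size_expD.
apply: size_addD; last first.
  rewrite e5''; apply: size_mulD; first by apply: size_mulD; apply: size_expD.
  by apply: size_addD; [apply/size_res/hy/hy | apply/size_scaleD/size_res/hx/hz].
apply: size_subD; first by rewrite e5; apply: size_mulD; [apply: size_expD | apply/size_res/hz/hz].
apply: size_scaleD; rewrite e5'; apply: size_mulD; last by apply/size_res/hy/hz.
by apply: size_mulD => //; apply: size_expD.
Qed.

End NullLines.

(** * Lines of a surface that cross a fixed line of it *)

Section Collinear.
Variable K : fieldType.
Implicit Types (q r b : K * K * K) (c : coef3 K).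

Definition collinear3 (I : finType) (S : {set I}) (f : I -> K * K * K) :=
  exists q0 e : K * K * K, forall i, i \in S ->
    exists t, f i = (q0.1.1 + t * e.1.1, q0.1.2 + t * e.1.2, q0.2 + t * e.2).

(** With e the difference of slopes and z the height of the crossing, a line meeting [b] has
    parameters affine in the pair (e, e z). The hypothesis reads c1 (e z) + c0 e = -1, an affine
    relation that confines the pair to a line. For c1 = 0 it fixes e; otherwise it expresses e z
    through e. *)
Lemma collinear_affine b (I : finType) (S : {set I}) (f : I -> K * K * K) (c0 c1 : K) :
  (forall i, i \in S -> lncross (f i) b = 0 /\ (f i).1.1 != b.1.1) ->
  (forall i, i \in S -> 1 = - ((f i).1.1 - b.1.1) * (c1 * lnz b (f i) + c0)) ->
  collinear3 S f.
Proof.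
case: b => [[u v] w] hm hz.
have hc i : i \in S -> let e := (f i).1.1 - u in let z := lnz (u, v, w) (f i) in
    f i = (u + e, v - e * z, w - e * v - u * (e * z)).
  move=> iS; case: (hm i iS); rewrite /lncross /lnz; case: (f i) => [[u' v'] w'] /= + ne.
  have n0 : u - u' != 0 by rewrite subr_eq0 eq_sym.
  move/eqP; rewrite !subr_eq0 subr_eq => /eqP ->.
  by congr (_, _, _); field.
case: (eqVneq c1 0) => [c10 | c1n].
  have c0n i : i \in S -> c0 != 0.
    move=> iS; apply/eqP => c00; have := hz i iS; rewrite c10 c00 mul0r addr0 mulr0 => /eqP.
    by rewrite oner_eq0.
  exists (u - c0^-1, v, w + v / c0), (0, c0^-1, u / c0) => i iS.
  exists (lnz (u, v, w) (f i)); rewrite [LHS]hc //=.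
  have c00 := c0n i iS.
  have -> : (f i).1.1 - u = - c0^-1.
    have := hz i iS; rewrite c10 mul0r add0r /= => e.
    by rewrite -[c0^-1]mul1r e mulfK // opprK.
  by congr (_, _, _); ring.
exists (u, v + c1^-1, w + u / c1), (1, c0 / c1, - v + u * c0 / c1) => i iS.
exists ((f i).1.1 - u); rewrite [LHS]hc //=.
have -> : ((f i).1.1 - u) * lnz (u, v, w) (f i) = (- 1 - c0 * ((f i).1.1 - u)) / c1.
  apply: (mulIf c1n); rewrite divfK //.
  by have := hz i iS => /= ->; ring.
by congr (_, _, _); field.
Qed.

Lemma horner_deriv_flec (X Y XX XY XZ YY YZ ZZ : {poly K}) (w z : K) :
  let g := Y + w *: X in
  ((X ^+ 4 * ZZ - 2%:R *: (X ^+ 3 * g * YZ) + X ^+ 2 * g ^+ 2 * (YY + 2%:R *: XZ)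
    - 2%:R *: (X * g ^+ 3 * XY) + g ^+ 4 * XX)^`()).[z] =
  let fx := X.[z] in let fx' := X^`().[z] in let fy' := Y^`().[z] in let gz := Y.[z] + w * fx in
  let g' := fy' + w * fx' in let fzz := ZZ.[z] in let fyz := YZ.[z] in
  let h := YY.[z] + 2%:R * XZ.[z] in let h' := YY^`().[z] + 2%:R * XZ^`().[z] in
  let fxy := XY.[z] in let fxx := XX.[z] in
  (4%:R * fx ^+ 3 * fx' * fzz + fx ^+ 4 * ZZ^`().[z])
   - 2%:R * (3%:R * fx ^+ 2 * fx' * gz * fyz + fx ^+ 3 * g' * fyz + fx ^+ 3 * gz * YZ^`().[z])
   + (2%:R * fx * fx' * gz ^+ 2 * h + fx ^+ 2 * (2%:R * gz * g') * h + fx ^+ 2 * gz ^+ 2 * h')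
   - 2%:R * (fx' * gz ^+ 3 * fxy + fx * (3%:R * gz ^+ 2 * g') * fxy + fx * gz ^+ 3 * XY^`().[z])
   + (4%:R * gz ^+ 3 * g' * fxx + gz ^+ 4 * XX^`().[z]).
Proof.
move=> g /=; rewrite -[Y.[z] + w * X.[z]]/_.
have gz : g.[z] = Y.[z] + w * X.[z] by rewrite /g !hornerE.
have g'z : g^`().[z] = Y^`().[z] + w * X^`().[z] by rewrite /g derivD derivZ !hornerE.
rewrite -gz -g'z; move: g {gz g'z} => g.
rewrite !(derivD, derivN, derivZ, derivM) /= !hornerE /=; ring.
Qed.

Lemma horner_deriv_res d c q z : deg3_le d c ->
  (res d c q)^`().[z] = q.1.1 ^+ 2 * (res d (dx c) q).[z] + q.1.1 * (res d (dy c) q).[z] + (res d (dz c) q).[z].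
Proof. by move=> hd; rewrite deriv_res // !hornerE. Qed.

(** With Q = fy + 2 u fx and P = fx on [b], a crossing with a line of slope w gives Q = (u - w) P.
    So if P / Q is affine in z, [collinear_affine] applies. The numerator of (P / Q)'' has degree at
    most 3d and vanishes at each crossing where P does not: 4d + 1 crossings less the at most d
    zeros of P are enough. *)
Lemma collinear_reds d c b (I : finType) (S : {set I}) (f : I -> K * K * K) :
  (2%:R != 0 :> K) -> (forall k, (0 < k < 2 * d + 2)%N -> k%:R != 0 :> K) ->
  deg3_le d c -> res d c b = 0 -> res d (dx c) b != 0 ->
  (forall i, i \in S -> [/\ lncross (f i) b = 0, (f i).1.1 != b.1.1, res d c (f i) = 0 & flec d c (f i) = 0]) ->
  {in S &, injective (fun i => lnz b (f i))} -> (4 * d + 1 <= #|S|)%N ->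
  exists2 S' : {set I}, (S' \subset S) && (#|S| <= #|S'| + d)%N & collinear3 S' f.
Proof.
move=> n2 ch hd hb P0 hS zi card.
have hx c' : deg3_le d c' -> deg3_le d (dx c') by move=> h; apply/deg3_dx/(deg3_leW (leqnSn d)).
have hy c' : deg3_le d c' -> deg3_le d (dy c') by move=> h; apply/deg3_dy/(deg3_leW (leqnSn d)).
have hz c' : deg3_le d c' -> deg3_le d (dz c') by move=> h; apply/deg3_dz/(deg3_leW (leqnSn d)).
set P := res d (dx c) b in P0 *.
pose Q := res d (dy c) b + (2%:R * b.1.1) *: P.
pose z i := lnz b (f i).
have sP : (size P <= d.+1)%N by apply/size_res/hx.
have sQ : (size Q <= d.+1)%N by apply: size_addD; [apply/size_res/hy | apply: size_scaleD].
pose S' := [set i in S | P.[z i] != 0].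
have sub : S' \subset S by apply/fintype.subsetP => i; rewrite inE => /andP[].
have cS : (#|S| <= #|S'| + d)%N.
  rewrite -(cardsID S' S) (finset.setIidPr sub) leq_add2l leqNgt; apply/negP => lt.
  move/eqP: P0; apply; apply: (@many_roots _ _ (S :\: S') z).
  - by move=> i j; rewrite !inE => /andP[_ iS] /andP[_ jS]; apply: zi.
  - by move=> i; rewrite !inE => /andP[+ iS]; rewrite iS /= negbK.
  - exact: leq_trans sP lt.
exists S'; first by rewrite sub cS.
have jet i : i \in S' -> Q.[z i] = - ((f i).1.1 - b.1.1) * P.[z i] /\
    (P^`()^`() * Q ^+ 2 - 2%:R *: (P^`() * Q^`() * Q) - P * Q^`()^`() * Q + 2%:R *: (P * Q^`() ^+ 2)).[z i] = 0.
  rewrite inE => /andP[iS]; case: (hS i iS) => cr ne hr hf; rewrite /z lnzC => Pz.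
  have [R1 R2 _] := res_jets (lnz (f i) b) hd hr; have [B1 B2 B3] := res_jets (lnz (f i) b) hd hb.
  (* [flec] vanishes all along [f i], hence so does its derivative; at the crossing both lines see
     the same jet of the surface, so this becomes a condition on P and Q along [b]. *)
  have := congr1 (fun p => (p^`()).[lnz (f i) b]) hf; rewrite /= deriv0 horner0 /flec horner_deriv_flec /=.
  have QE : Q.[lnz (f i) b] = (res d (dy c) b).[lnz (f i) b] + 2%:R * b.1.1 * (res d (dx c) b).[lnz (f i) b].
    by rewrite /Q !hornerE.
  have Q1E : Q^`().[lnz (f i) b] = (res d (dy c) b)^`().[lnz (f i) b] + 2%:R * b.1.1 * (res d (dx c) b)^`().[lnz (f i) b].
    by rewrite /Q derivD derivZ !hornerE.
  have Q2E : Q^`()^`().[lnz (f i) b] = (res d (dy c) b)^`()^`().[lnz (f i) b] + 2%:R * b.1.1 * (res d (dx c) b)^`()^`().[lnz (f i) b].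
    by rewrite /Q !derivD !derivZ !hornerE.
  have der2 c' : deg3_le d c' -> (res d c' b)^`()^`().[lnz (f i) b] =
      b.1.1 ^+ 2 * (res d (dx c') b)^`().[lnz (f i) b] + b.1.1 * (res d (dy c') b)^`().[lnz (f i) b]
      + (res d (dz c') b)^`().[lnz (f i) b].
    by move=> hc'; rewrite deriv_res // !derivD !derivZ !hornerE.
  have NE : (P^`()^`() * Q ^+ 2 - 2%:R *: (P^`() * Q^`() * Q) - P * Q^`()^`() * Q + 2%:R *: (P * Q^`() ^+ 2)).[lnz (f i) b]
    = P^`()^`().[lnz (f i) b] * Q.[lnz (f i) b] ^+ 2 - 2%:R * P^`().[lnz (f i) b] * Q^`().[lnz (f i) b] * Q.[lnz (f i) b]
      - P.[lnz (f i) b] * Q^`()^`().[lnz (f i) b] * Q.[lnz (f i) b] + 2%:R * P.[lnz (f i) b] * Q^`().[lnz (f i) b] ^+ 2.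
    by rewrite !hornerE /=; ring.
  rewrite NE QE Q1E Q2E.
  rewrite /P !der2; try by auto.
  clear NE Q1E Q2E.
  move: R1 R2 B1 B2 B3 Pz QE; rewrite /P /=.
  rewrite !horner_deriv_res; try by auto.
  rewrite !(dyx, dzx, dzy) !(res_meet _ _ ne cr).
  move: (res d (dx c) b).[_] => fx; move: (res d (dy c) b).[_] => fy; move: (res d (dz c) b).[_] => fz.
  move: (res d (dx (dx c)) b).[_] => fxx; move: (res d (dx (dy c)) b).[_] => fxy.
  move: (res d (dx (dz c)) b).[_] => fxz; move: (res d (dy (dy c)) b).[_] => fyy.
  move: (res d (dy (dz c)) b).[_] => fyz; move: (res d (dz (dz c)) b).[_] => fzz.
  move: (res d (dx (dx (dx c))) b).[_] => fxxx; move: (res d (dx (dx (dy c))) b).[_] => fxxy.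
  move: (res d (dx (dx (dz c))) b).[_] => fxxz; move: (res d (dx (dy (dy c))) b).[_] => fxyy.
  move: (res d (dx (dy (dz c))) b).[_] => fxyz; move: (res d (dx (dz (dz c))) b).[_] => fxzz.
  move: (res d (dy (dy (dy c))) b).[_] => fyyy; move: (res d (dy (dy (dz c))) b).[_] => fyyz.
  move: (res d (dy (dz (dz c))) b).[_] => fyzz; move: (res d (dz (dz (dz c))) b).[_] => fzzz.
  set u := b.1.1 in ne *; set w := (f i).1.1 in ne *.
  move=> R1 R2 B1 B2 B3 Pz _ H; split.
    have n0 : u - w != 0 by rewrite subr_eq0 eq_sym.
    apply: (mulfI n0); apply/eqP; rewrite -subr_eq0; apply/eqP.
    transitivity ((u ^+ 2 * fx + u * fy + fz) - (w ^+ 2 * fx + w * fy + fz)); last by rewrite B1 R1 subr0.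
    by ring.
  have ne' : u != w by rewrite eq_sym.
  have k := flec_derivative_identity n2 ne' B1 R1 B2 R2 B3.
  have fx2 : fx ^+ 2 != 0 by rewrite expf_eq0 /= (negPf Pz).
  apply: (mulfI fx2); rewrite mulr0 -[RHS]H.
  transitivity (fx ^+ 2 * ((u ^+ 2 * (u ^+ 2 * fxxx + u * fxxy + fxxz) + u * (u ^+ 2 * fxxy + u * fxyy + fxyz)
       + (u ^+ 2 * fxxz + u * fxyz + fxzz)) * (fy + 2%:R * u * fx) ^+ 2
     - 2%:R * (u ^+ 2 * fxx + u * fxy + fxz) * ((u ^+ 2 * fxy + u * fyy + fyz) + 2%:R * u * (u ^+ 2 * fxx + u * fxy + fxz)) * (fy + 2%:R * u * fx)
     - fx * (u ^+ 2 * (u ^+ 2 * fxxy + u * fxyy + fxyz) + u * (u ^+ 2 * fxyy + u * fyyy + fyyz)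
       + (u ^+ 2 * fxyz + u * fyyz + fyzz) + 2%:R * u * (u ^+ 2 * (u ^+ 2 * fxxx + u * fxxy + fxxz) + u * (u ^+ 2 * fxxy + u * fxyy + fxyz)
       + (u ^+ 2 * fxxz + u * fxyz + fxzz))) * (fy + 2%:R * u * fx)
     + 2%:R * fx * ((u ^+ 2 * fxy + u * fyy + fyz) + 2%:R * u * (u ^+ 2 * fxx + u * fxy + fxz)) ^+ 2)).
    by ring.
  by rewrite -k; ring.
have S'0 : exists i, i \in S' by apply/finset.set0Pn; rewrite -card_gt0; lia.
have Q0 : Q != 0.
  case: S'0 => i iS'; apply/eqP => Q0; have [+ _] := jet i iS'.
  rewrite Q0 horner0 => /eqP; rewrite eq_sym mulf_eq0 oppr_eq0 subr_eq0.
  by move: iS'; rewrite inE => /andP[iS /negPf ->]; case: (hS i iS) => _ /negPf ->.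
have sd (R : {poly K}) m : (size R <= m.+1)%N -> (size R^`() <= m.+1)%N.
  move=> h; apply: leq_trans h; case: (eqVneq R 0) => [-> | R0]; first by rewrite deriv0.
  exact: ltnW (lt_size_deriv R0).
have e3 : (3 * d = d + 2 * d)%N by lia.
have e3' : (3 * d = d + d + d)%N by lia.
have e2 : (2 * d = d + d)%N by lia.
have N0 : P^`()^`() * Q ^+ 2 - 2%:R *: (P^`() * Q^`() * Q) - P * Q^`()^`() * Q + 2%:R *: (P * Q^`() ^+ 2) = 0.
  apply: (@many_roots _ _ S' z).
  - by move=> i j /(fintype.subsetP sub) iS /(fintype.subsetP sub) jS; apply: zi.
  - by move=> i iS'; rewrite /root; case: (jet i iS') => _ ->.
  apply: (@leq_trans (3 * d).+1); last by lia.
  have szP1 := sd _ _ sP; have szQ1 := sd _ _ sQ.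
  apply: size_addD; last by apply: size_scaleD; rewrite e3; apply: size_mulD => //; apply: size_expD.
  apply: size_subD; last by rewrite e3'; apply: size_mulD => //; apply: size_mulD => //; apply: sd.
  apply: size_subD; first by rewrite e3; apply: size_mulD; [apply: sd | apply: size_expD].
  by apply: size_scaleD; rewrite e3'; apply: size_mulD => //; apply: size_mulD.
(* First integration of (P / Q)'' = 0: the Wronskian of P and Q is a constant multiple of Q^2. *)
have [||||a Ra] := @wronskian0 K (2 * d + 2) (P^`() * Q - P * Q^`()) (Q ^+ 2) ch.
- apply: leq_trans (_ : (2 * d).+1 <= _)%N; last by lia.
  by rewrite e2; apply: size_subD; apply: size_mulD => //; apply: sd.
- apply: leq_trans (_ : (2 * d).+1 <= _)%N; last by lia.
  exact: size_expD.
- by rewrite expf_eq0.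
- apply/eqP; rewrite -subr_eq0; apply/eqP.
  transitivity (Q * (P^`()^`() * Q ^+ 2 - 2%:R *: (P^`() * Q^`() * Q) - P * Q^`()^`() * Q + 2%:R *: (P * Q^`() ^+ 2))); last by rewrite N0 mulr0.
  by rewrite expr2 derivB !derivM -!mul_polyC; ring.
(* Second integration: P / Q - a z has derivative 0, so it is a constant [e]. *)
have [||||e Ee] := @wronskian0 K (2 * d + 2) (P - a *: ('X * Q)) Q ch.
- apply: size_subD; first by apply: leq_trans sP _; lia.
  apply: size_scaleD; apply: leq_trans (_ : (1 + d).+1 <= _)%N; last by lia.
  by apply: size_mulD => //; rewrite size_polyX.
- by apply: leq_trans sQ _; lia.
- exact: Q0.
- apply/eqP; rewrite -subr_eq0; apply/eqP.
  transitivity ((P^`() * Q - P * Q^`()) - a *: Q ^+ 2); last by rewrite Ra subrr.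
  by rewrite derivB derivZ derivM derivX -!mul_polyC; ring.
apply: (@collinear_affine b _ _ _ e a) => i iS'.
  by have iS := fintype.subsetP sub _ iS'; case: (hS i iS).
have Pz : P.[z i] != 0 by move: iS'; rewrite inE => /andP[].
have [Qz _] := jet i iS'.
apply: (mulIf Pz); rewrite mul1r -[in LHS](subrK (a *: ('X * Q)) P) Ee.
by rewrite hornerD !hornerZ hornerM hornerX Qz /z; ring.
Qed.
End Collinear.

(** * Two families of pairwise disjoint lines on a common surface *)

Section Structure.
Variable K : fieldType.
Implicit Types (q r b : K * K * K) (c : coef3 K).

Lemma sum_narrow (V : nmodType) e n (F : nat -> V) : (e <= n)%N ->
  (forall i, (e < i)%N -> F i = 0) -> \sum_(i < n.+1) F i = \sum_(i < e.+1) F i.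
Proof.
move=> le F0; rewrite [RHS](big_ord_widen n.+1 F) // [RHS]big_mkcond /=.
by apply: eq_bigr => i _; case: ifPn => //; rewrite -leqNgt => /F0.
Qed.

Lemma res_box e n c q : (e <= n)%N ->
  (forall i j k, [|| e < i, e < j | e < k]%N -> c i j k = 0) -> res n c q = res e c q.
Proof.
move=> le c0; rewrite /res /ev3 (@sum_narrow _ e n (fun i => \sum_(j < n.+1) \sum_(k < n.+1)
  c i j k *: (lnX q ^+ i * lnY q ^+ j * 'X ^+ k))) //; last first.
  by move=> i lt; do 2![rewrite big1 // => ? _]; rewrite c0 ?scale0r // lt.
apply: eq_bigr => i _; rewrite (@sum_narrow _ e n (fun j => \sum_(k < n.+1)
  c i j k *: (lnX q ^+ i * lnY q ^+ j * 'X ^+ k))) //; last first.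
  by move=> j lt; rewrite big1 // => ? _; rewrite c0 ?scale0r // lt orbT.
apply: eq_bigr => j _; rewrite (@sum_narrow _ e n (fun k =>
  c i j k *: (lnX q ^+ i * lnY q ^+ j * 'X ^+ k))) // => k lt.
by rewrite c0 ?scale0r // lt !orbT.
Qed.

Lemma res_widen d n c q : (d <= n)%N -> deg3_le d c -> res n c q = res d c q.
Proof. by move=> le hd; apply: res_box => // i j k h; apply: hd; lia. Qed.

(** Two lines through the same point of [q] meet each other. In a family of disjoint lines the
    crossings with [q] are therefore at distinct heights and can be counted as roots. *)
Lemma lnz_inj q r r' : q.1.1 != r.1.1 -> q.1.1 != r'.1.1 ->
  lncross q r = 0 -> lncross q r' = 0 -> lnz q r = lnz q r' -> lncross r r' = 0.
Proof.
move=> n1 n2 c1 c2 ez; have [Y1 X1] := ln_meet n1 c1; have [Y2 X2] := ln_meet n2 c2.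
move: Y1 X1 Y2 X2; rewrite -ez; move: (lnz q r) => z.
move: (lnY q).[z] (lnX q).[z] => Y X; rewrite /lnX /lnY !hornerE /= => -> -> Y2 X2.
rewrite /lncross.
have -> : r'.1.2 = r.1.2 + r.1.1 * z - r'.1.1 * z by rewrite Y2 addrK.
have -> : r'.2 = r.2 + r.1.1 * (r.1.2 + r.1.1 * z) - r'.1.1 * (r'.1.2 + r'.1.1 * z) by rewrite X2 addrK.
by rewrite -Y2; ring.
Qed.

Section Families.
Variables (V : finType) (f g : V -> K * K * K) (R B : {set V}) (M d : nat) (c : coef3 K).
Hypotheses (Hfg : forall i j, (f i).1.1 != (g j).1.1).
Hypotheses (Hf : forall i j, i != j -> lncross (f i) (f j) != 0).
Hypotheses (Hg : forall i j, i != j -> lncross (g i) (g j) != 0).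
Hypotheses (degR : forall i, i \in R -> (M <= #|[set j in B | lncross (f i) (g j) == 0%R]|)%N).
Hypotheses (degB : forall j, j \in B -> (M <= #|[set i in R | lncross (f i) (g j) == 0%R]|)%N).
Hypotheses (n2 : 2%:R != 0 :> K) (ch : forall k, (0 < k < 2 * d + 2)%N -> k%:R != 0 :> K).
Hypotheses (hd : deg3_le d c) (hR : forall i, i \in R -> res d c (f i) = 0)
  (hB : forall j, j \in B -> res d c (g j) = 0) (hM : (5 * d + 1 <= M)%N).

Lemma nbr_inj i : {in [set j in B | lncross (f i) (g j) == 0] &, injective (fun j => lnz (f i) (g j))}.
Proof.
move=> j j'; rewrite !inE => /andP[_ /eqP cj] /andP[_ /eqP cj'] ez.
apply/eqP/negPn/negP => /Hg /eqP; apply.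
exact: lnz_inj (Hfg i j) (Hfg i j') cj cj' ez.
Qed.

(** The degree is at most 5d, and the crossings with [B] supply at least 5d + 1 roots. *)
Lemma flec_red i : i \in R -> flec d c (f i) = 0.
Proof.
move=> iR; apply: (many_roots (@nbr_inj i)).
  move=> j; rewrite inE => /andP[jB /eqP cj]; apply: flec_root => //; [exact: hR | exact: hB].
apply: leq_trans (size_flec _ hd) _; apply: leq_trans (degR iR); lia.
Qed.

(** Where fx = 0, a crossing gives u fy + fz = 0 for two different slopes u, so fy vanishes at more
    than d points of the line. *)
Lemma dy_red i : i \in R -> res d (dx c) (f i) = 0 -> res d (dy c) (f i) = 0 /\ res d (dz c) (f i) = 0.
Proof.
move=> iR x0.
have hy : res d (dy c) (f i) = 0.
  apply: (many_roots (@nbr_inj i)); last first.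
    apply: leq_trans (size_res _ _ (deg3_dy (deg3_leW (leqnSn d) hd))) _.
    apply: leq_trans (degR iR); lia.
  move=> j; rewrite inE => /andP[jB /eqP cj]; rewrite /root.
  have [R1 _ _] := res_jets (lnz (f i) (g j)) hd (hR iR).
  have [B1 _ _] := res_jets (lnz (f i) (g j)) hd (hB jB).
  move: R1 B1; rewrite /= -!(res_meet _ _ (Hfg i j) cj) x0 horner0.
  set y := _.[_]; set z := _.[_]; set u := (f i).1.1; set v := (g j).1.1.
  rewrite !mulr0 !add0r => e1 e2.
  have : (u - v) * y = 0.
    transitivity ((u * y + z) - (v * y + z)); first by ring.
    by rewrite e1 e2 subrr.
  by move/eqP; rewrite mulf_eq0 subr_eq0 (negPf (Hfg i j)).
split => //.
by have := deriv_res (f i) hd; rewrite hR // deriv0 x0 hy !scaler0 !add0r => <-.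
Qed.

Lemma collinear_reds_of j0 : j0 \in B -> res d (dx c) (g j0) != 0 ->
  exists S : {set V}, [/\ S \subset R, (M <= #|S| + d)%N & collinear3 S f].
Proof.
move=> jB P0; pose S := [set i in R | lncross (f i) (g j0) == 0].
have [|||S' /andP[sub cS] col] := @collinear_reds K d c (g j0) V S f n2 ch hd (hB jB) P0.
- move=> i; rewrite inE => /andP[iR /eqP ci]; split => //; [exact: hR | exact: flec_red].
- move=> i i'; rewrite !inE => /andP[_ /eqP ci] /andP[_ /eqP ci'] ez.
  apply/eqP/negPn/negP => /Hf /eqP; apply.
  have ne k : (g j0).1.1 != (f k).1.1 by rewrite eq_sym.
  by apply: lnz_inj (ne i) (ne i') _ _ ez; rewrite lncrossC ?ci ?ci' oppr0.
- by apply: leq_trans (degB jB); lia.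
exists S'; split => //; last by apply: leq_trans (degB jB) cS.
by apply: fintype.subset_trans sub _; apply/fintype.subsetP => i; rewrite inE => /andP[].
Qed.
End Families.

(** Take a surface of least degree through all the lines. If fx is nonzero on one of them, that line
    serves as transversal in [collinear_reds]. Otherwise the whole gradient vanishes on all lines;
    by minimality the partial derivatives are zero polynomials, and the characteristic being large,
    the equation is a nonzero constant, which is absurd. *)
Lemma collinear_subfamily (V : finType) (f g : V -> K * K * K) (R B : {set V}) (M d : nat) (c : coef3 K) :
  (forall i j, (f i).1.1 != (g j).1.1) ->
  (forall i j, i != j -> lncross (f i) (f j) != 0) ->
  (forall i j, i != j -> lncross (g i) (g j) != 0) ->
  (forall i, i \in R -> (M <= #|[set j in B | lncross (f i) (g j) == 0%R]|)%N) ->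
  (forall j, j \in B -> (M <= #|[set i in R | lncross (f i) (g j) == 0%R]|)%N) ->
  (exists i, i \in R) -> 2%:R != 0 :> K -> (forall k, (0 < k < 2 * d + 2)%N -> k%:R != 0 :> K) ->
  deg3_le d c -> (exists i j k, c i j k != 0) ->
  (forall i, i \in R -> res d c (f i) = 0) -> (forall j, j \in B -> res d c (g j) = 0) ->
  (5 * d + 1 <= M)%N ->
  exists S : {set V}, (M <= #|S| + d)%N /\
    ((S \subset R /\ collinear3 S f) \/ (S \subset B /\ collinear3 S g)).
Proof.
move=> Hfg Hf Hg degR degB [i0 i0R] n2 ch hd nz hR hB hM.
pose P m := `[< exists c', [/\ deg3_le m c', (exists i j k, c' i j k != 0),
   (forall i, i \in R -> res m c' (f i) = 0) & (forall j, j \in B -> res m c' (g j) = 0)] >].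
have exP : exists m, P m by exists d; apply/asboolP; exists c.
case: (ex_minnP exP) => m /asboolP[c' [hm nz' hR' hB']] mmin.
have md : (m <= d)%N by apply: mmin; apply/asboolP; exists c.
have ch' k : (0 < k < 2 * m + 2)%N -> k%:R != 0 :> K by move=> h; apply: ch; lia.
have hM' : (5 * m + 1 <= M)%N by lia.
have rf i j : lncross (f i) (g j) == 0 = (lncross (g j) (f i) == 0) by rewrite lncrossC oppr_eq0.
have Hgf i j : (g i).1.1 != (f j).1.1 by rewrite eq_sym.
have degR' i : i \in R -> (M <= #|[set j in B | lncross (g j) (f i) == 0%R]|)%N.
  by move=> /degR h; apply: leq_trans h _; apply/subset_leq_card/fintype.subsetP => j; rewrite !inE rf.
have degB' j : j \in B -> (M <= #|[set i in R | lncross (g j) (f i) == 0%R]|)%N.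
  by move=> /degB h; apply: leq_trans h _; apply/subset_leq_card/fintype.subsetP => i; rewrite !inE rf.
have [j0 j0B] : exists j, j \in B.
  have /finset.set0Pn[j] : [set j in B | lncross (f i0) (g j) == 0] != finset.set0.
    by rewrite -card_gt0; apply: leq_trans (degR _ i0R); lia.
  by rewrite inE => /andP[jB _]; exists j.
case: (pselect (exists j, j \in B /\ res m (dx c') (g j) != 0)) => [[j [jB dj]] | nB].
  have [S [sub cS col]] := collinear_reds_of Hfg Hf Hg degR degB n2 ch' hm hR' hB' hM' jB dj.
  by exists S; split; [apply: leq_trans cS _; rewrite leq_add2l | left].
case: (pselect (exists i, i \in R /\ res m (dx c') (f i) != 0)) => [[i [iR di]] | nR].
  have [S [sub cS col]] := collinear_reds_of Hgf Hg Hf degB' degR' n2 ch' hm hB' hR' hM' iR di.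
  by exists S; split; [apply: leq_trans cS _; rewrite leq_add2l | right].
have xB j : j \in B -> res m (dx c') (g j) = 0.
  by move=> jB; apply/eqP/negPn/negP => h; apply: nB; exists j.
have xR i : i \in R -> res m (dx c') (f i) = 0.
  by move=> iR; apply/eqP/negPn/negP => h; apply: nR; exists i.
have yzR i : i \in R -> res m (dy c') (f i) = 0 /\ res m (dz c') (f i) = 0.
  by move=> iR; apply: (dy_red Hfg Hg degR n2 hm hR' hB' hM' iR (xR _ iR)).
have yzB j : j \in B -> res m (dy c') (g j) = 0 /\ res m (dz c') (g j) = 0.
  by move=> jB; apply: (dy_red Hgf Hf degB' n2 hm hB' hR' hM' jB (xB _ jB)).
have low : deg3_le 0 c'.
  case: m hm mmin md ch' hM' hR' hB' xB xR yzR yzB {nB nR} => [//|m] hm mmin md ch' hM' hR' hB' xB xR yzR yzB.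
  have small c1 : deg3_le m c1 -> (forall i, i \in R -> res m.+1 c1 (f i) = 0) ->
      (forall j, j \in B -> res m.+1 c1 (g j) = 0) -> forall i j k, c1 i j k = 0.
    move=> h1 hr hb i j k; apply/eqP/negPn/negP => n1.
    suff: (m.+1 <= m)%N by rewrite ltnn.
    apply: mmin; apply/asboolP; exists c1; split => //; first by exists i, j, k.
    - by move=> l lR; rewrite -(res_widen _ (leqnSn m)) // hr.
    - by move=> l lB; rewrite -(res_widen _ (leqnSn m)) // hb.
  have zx := small _ (deg3_dx hm) xR xB.
  have zy := small _ (deg3_dy hm) (fun i iR => (yzR i iR).1) (fun j jB => (yzB j jB).1).
  have zz := small _ (deg3_dz hm) (fun i iR => (yzR i iR).2) (fun j jB => (yzB j jB).2).
  have unit_le i (a : K) : a *+ i.+1 = 0 -> (i.+1 <= m.+1)%N -> a = 0.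
    move=> /eqP; rewrite -mulr_natr mulf_eq0 => /orP[/eqP // | h] le.
    by have /negP[] : i.+1%:R != 0 :> K by apply: ch'; lia.
  move=> i j k; case: (leqP (i + j + k) m.+1) => [le | gt _]; last exact: hm.
  case: i le => [|i] le lt; last by apply: unit_le (zx i j k) _; lia.
  case: j le lt => [|j] le lt; last by apply: unit_le (zy 0%N j k) _; lia.
  by case: k le lt => [|k] le lt //; apply: unit_le (zz 0%N 0%N k) _; lia.
case: nz' => i [j [k]]; case: (posnP (i + j + k)) => [e0 | /low ->]; last by rewrite eqxx.
have := hR' i0 i0R; rewrite (res_widen _ (leq0n m) low) /res /ev3 !big_ord1 !expr0 !mulr1 alg_polyC => /eqP.
rewrite polyC_eq0 => /eqP c0; have [-> -> ->] : [/\ i = 0%N, j = 0%N & k = 0%N] by split; lia.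
by rewrite c0 eqxx.
Qed.

(** There are (e + 1)^3 monomials with exponents at most e, and each line imposes 3e + 1 linear
    conditions, the restriction having degree at most 3e. *)
Lemma interpolation (V : finType) (S : {set V}) (f : V -> K * K * K) e :
  (#|S| * (3 * e).+1 < e.+1 ^ 3)%N ->
  exists c, [/\ deg3_le (3 * e) c, exists i j k, c i j k != 0 & forall i, i \in S -> res (3 * e) c (f i) = 0].
Proof.
move=> hc; pose T := ('I_e.+1 * 'I_e.+1 * 'I_e.+1)%type; pose W := ({i : V | i \in S} * 'I_(3 * e).+1)%type.
pose mon (t : T) q : {poly K} := lnX q ^+ t.1.1 * lnY q ^+ t.1.2 * 'X ^+ t.2.
pose A := \matrix_(t < #|{: T}|, w < #|{: W}|)
  (mon (enum_val t) (f (val (enum_val w).1)))`_(enum_val w).2.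
have kA : kermx A != 0.
  rewrite kermx_eq0 -row_leq_rank -ltnNge; apply: leq_ltn_trans (rank_leq_col _) _.
  by rewrite !card_prod !card_ord card_sig; move: hc; rewrite !expnS expn0 muln1 mulnA.
have [v [vA v0]] : exists v : 'rV[K]_#|{: T}|, v *m A = 0 /\ v != 0.
  have [i ri] : exists i, row i (kermx A) != 0.
    apply/existsP; apply: contraR kA => /existsPn h; apply/eqP/row_matrixP => i; rewrite row0.
    by have := h i; rewrite negbK => /eqP.
  exists (row i (kermx A)); split => //; apply: sub_kermxP; exact: row_sub.
pose c : coef3 K := fun i j k => if [&& i <= e, j <= e & k <= e]%N
   then v 0 (enum_rank (inord i : 'I_e.+1, inord j : 'I_e.+1, inord k : 'I_e.+1)) else 0.
have cE (t : T) : c t.1.1 t.1.2 t.2 = v 0 (enum_rank t).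
  by rewrite /c !leq_ord !inord_val; case: t => [[]].
exists c; split.
- by move=> i j k lt; rewrite /c; case: ifP => // /and3P[]; lia.
- have [t vt] : exists t, v 0 t != 0.
    apply/existsP; apply: contraR v0 => /existsPn h; apply/eqP/rowP => t; rewrite mxE.
    by have := h t; rewrite negbK => /eqP.
  exists (enum_val t).1.1, (enum_val t).1.2, (enum_val t).2.
  by rewrite cE enum_valK.
move=> i iS; have resE : res (3 * e) c (f i) = \sum_(t : T) v 0 (enum_rank t) *: mon t (f i).
  rewrite (@res_box e); last 2 first.
  - by lia.
  - by move=> i1 j k h; rewrite /c; case: ifP => // /and3P[]; case/or3P: h; lia.
  rewrite /res /ev3 pair_big /= pair_big /=; apply: eq_bigr => t _.
  by rewrite -cE.
apply/polyP => m; rewrite coef0; case: (ltnP m (3 * e).+1) => hm; last first.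
  rewrite nth_default // (leq_trans _ hm) // size_res // => i1 j k lt.
  by rewrite /c; case: ifP => // /and3P[]; lia.
have /matrixP/(_ 0 (enum_rank ((Sub i iS, Ordinal hm) : W))) := vA; rewrite !mxE => {2}<-.
rewrite resE coef_sum (reindex (@enum_val T predT)) /=; last first.
  by exists enum_rank => t _; rewrite ?enum_valK ?enum_rankK.
apply: eq_bigr => t _; rewrite coefZ !mxE enum_valK enum_rankK //=.
Qed.
End Structure.

(** * Subgraphs of large minimal degree and greedy covers *)

Section Graphs.
Variable V : finType.
Implicit Types (adj : rel V) (R B S A : {set V}).

Lemma card_pairs_fst adj R B :
  #|[set x : V * V | [&& x.1 \in R, x.2 \in B & adj x.1 x.2]]| = (\sum_(i in R) #|[set j in B | adj i j]|)%N.
Proof.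
rewrite -sum1_card (eq_bigl (fun x : V * V => (x.1 \in R) && ((x.2 \in B) && adj x.1 x.2))); last first.
  by move=> x; rewrite inE.
rewrite -(pair_big_dep (mem R) (fun i j => (j \in B) && adj i j) (fun _ _ => 1%N)) /=.
by apply: eq_bigr => i _; rewrite sum1_card; apply: eq_card => j; rewrite !inE.
Qed.

Lemma card_pairs_snd adj R B :
  #|[set x : V * V | [&& x.1 \in R, x.2 \in B & adj x.1 x.2]]| = (\sum_(j in B) #|[set i in R | adj i j]|)%N.
Proof.
pose sw (x : V * V) := (x.2, x.1); have swK : involutive sw by case.
rewrite -(card_pairs_fst (fun j i => adj i j)) -(card_imset _ (inv_inj swK)).
apply: eq_card => -[i j]; rewrite !inE /=; apply/imsetP/idP => [[[x y]]|].
  by rewrite inE /= => h [-> ->]; move: h; rewrite andbCA.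
by move=> h; exists (j, i) => //; rewrite inE /= andbCA.
Qed.

Definition edges adj R B := #|[set x : V * V | [&& x.1 \in R, x.2 \in B & adj x.1 x.2]]|.

Lemma edges_D1l adj R B i : i \in R -> edges adj R B = (#|[set j in B | adj i j]| + edges adj (R :\ i) B)%N.
Proof. by move=> iR; rewrite /edges !card_pairs_fst (big_setD1 i). Qed.
Lemma edges_D1r adj R B j : j \in B -> edges adj R B = (#|[set i in R | adj i j]| + edges adj R (B :\ j))%N.
Proof. by move=> iR; rewrite /edges !card_pairs_snd (big_setD1 j). Qed.

(* The pair maximising (number of edges) + K (number of deleted vertices) has minimal degree at least K. *)
Lemma min_degree_subgraph adj A K : (2 * K * #|A| < edges adj A A)%N ->
  exists R B, [/\ R \subset A, B \subset A, exists i, i \in R,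
    forall i, i \in R -> (K <= #|[set j in B | adj i j]|)%N &
    forall j, j \in B -> (K <= #|[set i in R | adj i j]|)%N].
Proof.
move=> hE; pose P (x : {set V} * {set V}) := (x.1 \subset A) && (x.2 \subset A).
pose F (x : {set V} * {set V}) := (edges adj x.1 x.2 + K * (#|A :\: x.1| + #|A :\: x.2|))%N.
have PA : P (A, A) by rewrite /P /= subxx.
case: (@arg_maxnP _ (A, A) P F PA) => -[R B] /andP[/= RA BA] hmax.
have step (C : {set V}) i : C \subset A -> i \in C -> #|A :\: (C :\ i)| = #|A :\: C|.+1.
  move=> CA iC; rewrite (cardsD1 i (A :\: (C :\ i))) !inE eqxx (fintype.subsetP CA) //=.
  rewrite add1n; congr _.+1; apply: eq_card => k; rewrite !inE.
  by case: (eqVneq k i) => [-> | _] //=; rewrite iC.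
exists R, B; split => //.
- apply/finset.set0Pn; apply: contraL hE => /eqP R0; rewrite -leqNgt.
  have := hmax (A, A) PA; rewrite /F /= R0 !finset.setDv cards0 finset.setD0 addn0 muln0 addn0 => h.
  apply: leq_trans h _; have -> : edges adj finset.set0 B = 0%N.
    by rewrite /edges card_pairs_fst big_set0.
  have := subset_leq_card (finset.subsetDl A B); nia.
- move=> i iR; have := hmax (R :\ i, B); rewrite /P /F /= BA (fintype.subset_trans (subD1set _ _) RA) => /(_ isT).
  rewrite step // (edges_D1l _ _ iR); nia.
- move=> j jB; have := hmax (R, B :\ j); rewrite /P /F /= RA (fintype.subset_trans (subD1set _ _) BA) => /(_ isT).
  rewrite step // (edges_D1r _ _ jB); nia.
Qed.

Definition deficit adj B S d := (\sum_(j in B) (d.+1 - #|[set i in S | adj i j]|))%N.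

(* A vertex of R chosen greedily decreases the deficit by at least its average over R. *)
Lemma deficit_step adj R B S d K m : (d < K)%N -> (#|R| * d.+1 <= m * (K - d))%N -> (0 < m)%N ->
  (forall j, j \in B -> (K <= #|[set i in R | adj i j]|)%N) ->
  exists S', (#|S'| <= #|S|.+1)%N /\ (m * deficit adj B S' d <= m.-1 * deficit adj B S d)%N /\ (S \subset R -> S' \subset R).
Proof.
move=> dK hm m0 hB; set D := deficit adj B S d.
pose U := [set j in B | (#|[set i in S | adj i j]| < d.+1)%N].
pose gain i := #|[set j in U | adj i j]|.
have DU : (D <= d.+1 * #|U|)%N.
  rewrite /D /deficit (bigID (mem U)) /= [X in (_ + X)%N]big1 => [|j /andP[jB]]; last first.
    by rewrite inE jB /= -leqNgt => h; apply/eqP; rewrite subn_eq0.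
  rewrite addn0 mulnC -sum_nat_const.
  rewrite [X in (_ <= X)%N](eq_bigl (fun j => (j \in B) && (j \in U))).
    by apply: leq_sum => j _; apply: leq_subr.
  by move=> j; rewrite inE; case: (j \in B).
(* An element of [U] has at least K neighbours in [R] and at most d in [S], hence at least K - d
   outside [S]. *)
have tot : ((K - d) * #|U| <= \sum_(i in R :\: S) gain i)%N.
  rewrite /gain -card_pairs_fst card_pairs_snd mulnC -sum_nat_const; apply: leq_sum => j.
  rewrite inE => /andP[jB lt].
  have := hB _ jB.
  rewrite -(cardsID S [set i in R | adj i j]) => h.
  have h1 : (#|[set i in R | adj i j] :&: S| <= #|[set i in S | adj i j]|)%N.
    by apply/subset_leq_card/fintype.subsetP => i; rewrite !inE => /andP[/andP[_ ->] ->].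
  have h2 : (#|[set i in R | adj i j] :\: S| <= #|[set i in R :\: S | adj i j]|)%N.
    by apply/subset_leq_card/fintype.subsetP => i; rewrite !inE => /andP[-> /andP[-> ->]].
  lia.
have gainS i : i \notin S -> (deficit adj B (i |: S) d + gain i <= D)%N.
  move=> iS; rewrite /gain -sum1_card /D /deficit big_mkcond /= [X in (_ + X)%N]big_mkcond -big_split /=.
  rewrite [X in (_ <= X)%N]big_mkcond /=; apply: leq_sum => j _; rewrite !inE.
  case: (boolP (j \in B)) => //= jB.
  have sub : (#|[set i0 in S | adj i0 j]| <= #|[set i0 in i |: S | adj i0 j]|)%N.
    by apply/subset_leq_card/fintype.subsetP => k; rewrite !inE => /andP[-> ->]; rewrite orbT.
  case: ifP => [/andP[lt aij] | _]; last by rewrite addn0 leq_sub2l.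
  have -> : #|[set i0 in i |: S | adj i0 j]| = #|[set i0 in S | adj i0 j]|.+1.
    rewrite (cardsD1 i) !inE eqxx aij add1n; congr _.+1; apply: eq_card => k; rewrite !inE.
    by case: (eqVneq k i) => [-> | _] //=; rewrite (negPf iS).
  lia.
case: (posnP D) => [D0 | Dpos].
  by exists S; split; [exact: leqnSn | split => //; rewrite -/D D0 !muln0].
have [i iRS hi] : exists2 i, i \in R :\: S & (D <= m * gain i)%N.
  apply/exists_inP; apply: contraT => /exists_inPn h.
  have lt : (\sum_(i in R :\: S) (m * gain i) < \sum_(i in R :\: S) D)%N.
    have [i0 i0RS] : exists i, i \in R :\: S.
      apply/finset.set0Pn/negP => /eqP e0; move: tot; rewrite e0 big_set0.
      have : (0 < #|U|)%N by case: (posnP #|U|) DU => // ->; rewrite muln0; lia.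
      have : (0 < K - d)%N by rewrite subn_gt0.
      by nia.
    rewrite (bigD1 i0) //= [X in (_ < X)%N](bigD1 i0) //= -addSn leq_add //.
      by have := h _ i0RS; rewrite -ltnNge.
    by apply: leq_sum => i /andP[iRS _]; have := h _ iRS; rewrite -ltnNge => /ltnW.
  move: lt; rewrite -big_distrr /= sum_nat_const.
  have : (#|R :\: S| <= #|R|)%N by apply/subset_leq_card/finset.subsetDl.
  nia.
exists (i |: S); split; first by rewrite cardsU1; case: (i \notin S).
split; last first.
  by move=> SR; rewrite finset.subUset SR andbT finset.sub1set; move: iRS; rewrite inE => /andP[].
have := gainS i; move: iRS; rewrite inE => /andP[iS _] /(_ iS).
case: m m0 {hm} hi => [//|m] _ hi /=; nia.
Qed.

(** The first two terms of the binomial expansion of ((m - 1) + 1)^m already give about twice (m -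
    1)^m. *)
Lemma pow_halve m : (0 < m)%N -> (2 * m.-1 ^ m <= m ^ m)%N.
Proof.
case: m => // m _; rewrite /= -{2}[m.+1]addn1 expnDn !big_ord_recl /= !bin0 bin1 /bump /=.
rewrite !exp1n subn0 subn1 /= !muln1 !mul1n mulSn.
have : (m ^ m.+1 <= m.+1 * m ^ m)%N by rewrite expnS leq_mul2r leqnSn orbT.
lia.
Qed.

(** After m L greedy steps the deficit, at most |B| (d + 1) at the start, has been multiplied by at
    most (1 - 1/m)^(m L) <= 2^(-L); an integer below 1 is 0. *)
Lemma greedy_cover adj R B d K m L : (d < K)%N -> (#|R| * d.+1 <= m * (K - d))%N -> (0 < m)%N ->
  (forall j, j \in B -> (K <= #|[set i in R | adj i j]|)%N) -> (#|B| * d.+1 < 2 ^ L)%N ->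
  exists S, [/\ S \subset R, (#|S| <= m * L)%N & forall j, j \in B -> (d < #|[set i in S | adj i j]|)%N].
Proof.
move=> dK hm m0 hB hL.
have it s : exists S, [/\ S \subset R, (#|S| <= s)%N & (m ^ s * deficit adj B S d <= m.-1 ^ s * (#|B| * d.+1))%N].
  elim: s => [|s [S [SR cS hS]]].
    exists finset.set0; rewrite finset.sub0set cards0 !expn0 !mul1n; split => //.
    rewrite /deficit -sum_nat_const; apply: leq_sum => j _; exact: leq_subr.
  have [S' [cS' [hS' SR']]] := deficit_step S dK hm m0 hB.
  exists S'; split; [exact: SR' | exact: leq_trans cS' _ | ].
  rewrite !expnS; move: hS hS'; move: (m ^ s)%N (m.-1 ^ s)%N (deficit _ _ S' _) (deficit _ _ S _) => a b y x.
  move=> h1 h2; apply: (@leq_trans (a * (m.-1 * x))%N).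
    by rewrite -mulnA mulnCA leq_mul2l h2 orbT.
  by rewrite mulnCA -mulnA leq_mul2l h1 orbT.
have [S [SR cS hS]] := it (m * L)%N; exists S; split => //.
have D0 : deficit adj B S d = 0%N.
  apply/eqP; rewrite -leqn0 leqNgt; apply/negP => Dp.
  have h1 : (2 ^ L * m.-1 ^ (m * L) <= m ^ (m * L))%N.
    rewrite !expnM -expnMn; case: (posnP L) => [-> | L0]; first by rewrite !expn0.
    by rewrite leq_exp2r ?pow_halve.
  have h2 : (m ^ (m * L) <= m.-1 ^ (m * L) * (#|B| * d.+1))%N.
    by apply: leq_trans hS; rewrite leq_pmulr.
  have mp : (0 < m ^ (m * L))%N by rewrite expn_gt0 m0.
  have : (0 < m.-1 ^ (m * L))%N by move: h2 mp; case: (m.-1 ^ (m * L))%N => // /[!mul0n]; rewrite leqn0 => /eqP ->.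
  by nia.
move=> j jB; move: D0; rewrite /deficit => /eqP; rewrite sum_nat_eq0 => /forall_inP/(_ j jB).
by rewrite subn_eq0.
Qed.
End Graphs.

(** * Incidences of a Cartesian product *)

Section PointLine.
Variables (F : finFieldType) (K : fieldType) (io : {rmorphism F -> K}) (t : K).
Hypothesis indep : forall a b c : F, io a + io b * t + io c * t ^+ 2 = 0 -> [/\ a = 0, b = 0 & c = 0].
Local Notation V := (F * (F * F))%type.
Implicit Types (A : {set F}) (L : {set F * F}) (i j : V).

(** With i = (x, l) and j = (y, k) this is k (x) = l (y): exchanging the lines between the two pairs
    makes every product mix a parameter of i with one of j, as in [lncross]. *)
Definition line_adj : rel V := fun i j => j.2.1 * i.1 + j.2.2 == i.2.1 * j.1 + i.2.2.
(** Lines are treated as points of the dual plane; collinear ones are concurrent or parallel as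
    lines. *)
Definition collinear_le L k := forall l0 l1, l0 \in L -> l1 \in L -> l0 != l1 ->
  (#|[set l in L | ((l.1 - l0.1) * (l1.2 - l0.2) == (l.2 - l0.2) * (l1.1 - l0.1))%R]| <= k)%N.

(* Over F itself two red (or two blue) lines may meet; the terms in t, transcendental over F, prevent this. *)
Definition red i : K * K * K := (io i.1, - io i.2.1, io i.2.2 + io i.1 * t + io i.2.1 * t ^+ 2).
Definition blue i : K * K * K := (io i.1 - t ^+ 2, - (io i.2.1 + t), io i.2.2).

Lemma red_blue_cross i j : (lncross (red i) (blue j) == 0) = line_adj i j.
Proof.
rewrite /line_adj /lncross /red /blue /=.
have -> : io i.2.2 + io i.1 * t + io i.2.1 * t ^+ 2 - io j.2.2 -
  (- io i.2.1 * (io j.1 - t ^+ 2) - - (io j.2.1 + t) * io i.1) = io (i.2.1 * j.1 + i.2.2 - (j.2.1 * i.1 + j.2.2)).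
  by rewrite rmorphB !rmorphD !rmorphM; ring.
by rewrite fmorph_eq0 subr_eq0 eq_sym.
Qed.

Lemma red_blue_dir i j : (red i).1.1 != (blue j).1.1.
Proof.
rewrite /= -subr_eq0; apply/eqP => h.
have [|_ _] := indep (a := i.1 - j.1) (b := 0) (c := 1).
  by rewrite -[RHS]h rmorphB rmorph0 rmorph1; ring.
by move/eqP; rewrite oner_eq0.
Qed.

Lemma red_red i j : i != j -> lncross (red i) (red j) != 0.
Proof.
apply: contra => /eqP h; move: h; case: i => [x [m c]]; case: j => [y [n b]].
rewrite /lncross /red /= => h.
have [|e0 e1 e2] := indep (a := c - b + m * y - n * x) (b := x - y) (c := m - n).
  by rewrite -[RHS]h !rmorphB !rmorphD !rmorphM rmorphN; ring.
move/eqP: e1; move/eqP: e2; rewrite !subr_eq0 => /eqP e2 /eqP e1; subst.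
by move/eqP: e0; rewrite addrK subr_eq0 => /eqP ->.
Qed.

Lemma blue_blue i j : i != j -> lncross (blue i) (blue j) != 0.
Proof.
apply: contra => /eqP h; move: h; case: i => [x [m c]]; case: j => [y [n b]].
rewrite /lncross /blue /= => h.
have [|e0 e1 e2] := indep (a := c - b + m * y - n * x) (b := y - x) (c := n - m).
  by rewrite -[RHS]h !rmorphB !rmorphD !rmorphM rmorphN; ring.
move/eqP: e1; move/eqP: e2; rewrite !subr_eq0 => /eqP e2 /eqP e1; subst.
by move/eqP: e0; rewrite addrK subr_eq0 => /eqP ->.
Qed.

(** Either all members share their line, and their abscissae in [A] tell them apart; or two of them
    have different lines, and then the projection to [L] is injective with image on the dual line
    through those two. *)
Lemma collinear_card A L k (S : {set V}) (x0 x1 m0 m1 c0 c1 : K) :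
  (#|A| <= k)%N -> collinear_le L k -> S \subset finset.setX A L ->
  (forall i, i \in S -> exists s, [/\ io i.1 = x0 + s * x1, io i.2.1 = m0 + s * m1 & io i.2.2 = c0 + s * c1]) ->
  (#|S| <= k)%N.
Proof.
move=> hA hL sub hS.
have SA i : i \in S -> i.1 \in A by move/(fintype.subsetP sub); case: i => ? ?; rewrite finset.in_setX => /andP[].
have SL i : i \in S -> i.2 \in L by move/(fintype.subsetP sub); case: i => ? ?; rewrite finset.in_setX => /andP[].
case: (pselect (exists i j, [/\ i \in S, j \in S & i.2 != j.2])) => [[i [j [iS jS ne]]] | same]; last first.
  have inj : {in S &, injective (fun i : V => i.1)}.
    move=> i j iS jS /= e1; case: (eqVneq i.2 j.2) => [e2 | ne]; last by case: same; exists i, j.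
    by case: i j e1 e2 {iS jS} => [? ?] [? ?] /= -> ->.
  rewrite -(card_in_imset inj); apply: leq_trans hA; apply/subset_leq_card/fintype.subsetP => _ /imsetP[i iS ->].
  exact: SA.
have [si [_ mi ci]] := hS i iS; have [sj [_ mj cj]] := hS j jS.
have mc0 : (m1 != 0) || (c1 != 0).
  rewrite -negb_and; apply: contra ne => /andP[/eqP z1 /eqP z2].
  apply/eqP; move: mi mj ci cj; rewrite z1 z2 !mulr0 !addr0 => mi mj ci cj.
  by case: (i.2) (j.2) mi mj ci cj => [a b] [a' b'] /= <- /fmorph_inj -> <- /fmorph_inj ->.
have inj : {in S &, injective (fun i : V => i.2)}.
  move=> a b aS bS /= e2; have [sa [xa ma ca]] := hS a aS; have [sb [xb mb cb]] := hS b bS.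
  suff e : sa = sb.
    have e1 : a.1 = b.1 by apply: (fmorph_inj io); rewrite xa xb e.
    by case: a b e1 e2 {aS bS xa ma ca xb mb cb} => [? ?] [? ?] /= -> ->.
  case/orP: mc0 => nz; apply: (mulIf nz).
  - by apply: (addrI m0); rewrite -ma -mb e2.
  - by apply: (addrI c0); rewrite -ca -cb e2.
rewrite -(card_in_imset inj); apply: leq_trans (hL _ _ (SL _ iS) (SL _ jS) ne).
apply/subset_leq_card/fintype.subsetP => _ /imsetP[a aS ->]; rewrite inE SL //=.
have [sa [xa ma ca]] := hS a aS; rewrite -(inj_eq (fmorph_inj io)) !rmorphM !rmorphB ma ca mi ci mj cj.
by apply/eqP; ring.
Qed.

(** If the bound failed, a subgraph of minimal degree M = 64 E0 + 2k would yield a collinear family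
    of at least M - d > k lines. The degree d = 3 (E0 - 1) comes from interpolation with E0^3
    coefficients, and [6 * E0 <= p] makes 2d + 2 at most p. *)
Lemma incidence_bound A L (p E0 La k : nat) :
  (forall n, (0 < n < p)%N -> n%:R != 0 :> K) -> (0 < E0)%N -> (6 * E0 <= p)%N ->
  (4 <= #|A| * #|L|)%N -> (#|A| * #|L| * La <= E0 ^ 2)%N -> (#|A| * #|L| * (3 * E0) <= 2 ^ La)%N ->
  (#|A| <= k)%N -> collinear_le L k ->
  (edges line_adj (finset.setX A L) (finset.setX A L) <= 2 * (64 * E0 + 2 * k) * (#|A| * #|L|))%N.
Proof.
move=> ch E0p E6 N4 NL N2 hA hL; rewrite leqNgt; apply/negP; rewrite -cardsX.
move/min_degree_subgraph=> [R [B [RA BA [i0 i0R] degR degB]]].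
set N := (#|A| * #|L|)%N in N4 NL N2.
pose e := E0.-1; pose d := (3 * e)%N; pose M := (64 * E0 + 2 * k)%N.
have eE : e.+1 = E0 by rewrite /e prednK.
have cR : (#|R| <= N)%N by rewrite /N -cardsX subset_leq_card.
have cB : (#|B| <= N)%N by rewrite /N -cardsX subset_leq_card.
(* Two demands on m. The cover needs N (d + 1) <= m (M - d), where d + 1 <= 3 E0 and M - d >= 61 E0,
   so m > N / 20 will do. Interpolation needs m La (3 E0 - 2) < E0^3, which follows from m <= 3 N /
   10 and N La <= E0^2. *)
pose m := (N %/ 20).+1.
have mN : (N < 20 * m)%N by rewrite mulnC; exact: ltn_ceil.
have mN' : (10 * m <= 3 * N)%N by have := leq_divM N 20; rewrite /m; lia.
have hd : (d < M)%N by rewrite /d /M; lia.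
have degR' i : i \in R -> (M <= #|[set j in B | lncross (red i) (blue j) == 0%R]|)%N.
  move=> /degR h; apply: leq_trans h _; apply/subset_leq_card/fintype.subsetP => j.
  by rewrite !inE red_blue_cross.
have degB' j : j \in B -> (M <= #|[set i in R | lncross (red i) (blue j) == 0%R]|)%N.
  move=> /degB h; apply: leq_trans h _; apply/subset_leq_card/fintype.subsetP => i.
  by rewrite !inE red_blue_cross.
have [|||S [SR cS hS]] := @greedy_cover _ line_adj R B d M m La hd _ _ degB.
- apply: (@leq_trans (N * (3 * E0))); first by apply: leq_mul => //; rewrite /d; lia.
  have : (61 * E0 <= M - d)%N by rewrite /M /d; lia.
  by move: (M - d)%N => w; nia.
- by [].
- apply: leq_trans (_ : N * (3 * E0) <= _)%N => //.
  apply: (@leq_ltn_trans (N * d.+1)); first by rewrite leq_mul2r cB orbT.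
  by rewrite ltn_mul2l /d; lia.
have [|c [cd nz cS0]] := @interpolation K V S red e.
  apply: (@leq_ltn_trans (m * La * (3 * E0 - 2))); first by apply: leq_mul => //; lia.
  rewrite eE; have h1 : (10 * (m * La) <= 3 * E0 ^ 2)%N by nia.
  rewrite expnS; nia.
have ne i j : (blue i).1.1 != (red j).1.1 by rewrite eq_sym red_blue_dir.
have cB0 j : j \in B -> res d c (blue j) = 0.
  move=> jB; apply: (@many_roots K V [set i in S | line_adj i j] (fun i => lnz (blue j) (red i))).
  - move=> i i'; rewrite !inE => /andP[_ +] /andP[_ +]; rewrite -!red_blue_cross => /eqP ci /eqP ci' ez.
    apply/eqP; apply: contraT => /red_red /eqP; case.
    by apply: lnz_inj (ne j i) (ne j i') _ _ ez; rewrite lncrossC ?ci ?ci' oppr0.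
  - move=> i; rewrite inE => /andP[iS]; rewrite -red_blue_cross => /eqP ci.
    by rewrite /root res_meet ?ne ?cS0 ?horner0 // lncrossC ci oppr0.
  - exact: leq_trans (size_res _ _ cd) (hS _ jB).
have cR0 i : i \in R -> res d c (red i) = 0.
  move=> iR; apply: (@many_roots K V [set j in B | line_adj i j] (fun j => lnz (red i) (blue j))).
  - move=> j j'; rewrite !inE => /andP[_ +] /andP[_ +]; rewrite -!red_blue_cross => /eqP ci /eqP ci' ez.
    apply/eqP; apply: contraT => /blue_blue /eqP; case.
    exact: lnz_inj (red_blue_dir i j) (red_blue_dir i j') ci ci' ez.
  - move=> j; rewrite inE => /andP[jB]; rewrite -red_blue_cross => /eqP ci.
    by rewrite /root res_meet ?red_blue_dir ?cB0 ?horner0.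
  - by apply: leq_trans (size_res _ _ cd) _; apply: leq_trans (degR _ iR).
have [|||T [cT hT]] := @collinear_subfamily K V red blue R B M d c red_blue_dir red_red blue_blue degR' degB'
   (ex_intro _ i0 i0R) _ _ cd nz cR0 cB0.
- by apply: ch; lia.
- by move=> n hn; apply: ch; rewrite /d in hn; lia.
- by rewrite /M /d; lia.
suff : (#|T| <= k)%N by move: cT; rewrite /M /d; lia.
case: hT => -[TS [[[q1 q2] q3] [[[e1 e2] e3] hq]]].
- apply: (@collinear_card A L k T q1 e1 (- q2) (- e2) (q3 - q1 * t + q2 * t ^+ 2) (e3 - e1 * t + e2 * t ^+ 2)) => //.
    exact: fintype.subset_trans TS RA.
  move=> i /hq[s]; rewrite /red /= => -[h1 h2 h3]; exists s; split => //.
    by rewrite -[LHS]opprK h2; ring.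
  transitivity ((q3 + s * e3) - io i.1 * t - io i.2.1 * t ^+ 2); first by rewrite -h3; ring.
  by rewrite h1 -[io i.2.1]opprK h2; ring.
- apply: (@collinear_card A L k T (q1 + t ^+ 2) e1 (- q2 - t) (- e2) q3 e3) => //.
    exact: fintype.subset_trans TS BA.
  move=> i /hq[s]; rewrite /blue /= => -[h1 h2 h3]; exists s; split => //.
    by rewrite -[LHS](subrK (t ^+ 2)) h1; ring.
  have -> : io i.2.1 = - (- (io i.2.1 + t)) - t by ring.
  by rewrite h2; ring.
Qed.
End PointLine.

Lemma incidence_Fp p (A : {set 'F_p}) (L : {set 'F_p * 'F_p}) (E0 La k : nat) : prime p ->
  (0 < E0)%N -> (6 * E0 <= p)%N ->
  (4 <= #|A| * #|L|)%N -> (#|A| * #|L| * La <= E0 ^ 2)%N -> (#|A| * #|L| * (3 * E0) <= 2 ^ La)%N ->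
  (#|A| <= k)%N -> collinear_le L k ->
  (edges (@line_adj _) (finset.setX A L) (finset.setX A L) <= 2 * (64 * E0 + 2 * k) * (#|A| * #|L|))%N.
Proof.
move=> pp; pose io : {rmorphism 'F_p -> {fraction {poly 'F_p}}} := @FracField.tofrac {poly 'F_p} \o polyC.
apply: (@incidence_bound _ _ io (FracField.tofrac 'X)).
- move=> a b c; rewrite /io /= -tofracXn -!tofracM -!tofracD => /eqP; rewrite tofrac_eq0 => /eqP h.
  have co k1 := congr1 (fun q : {poly 'F_p} => q`_k1) h.
  have := co 0%N; have := co 1%N; have := co 2%N.
  by rewrite !(coefD, coefMX, coefMXn, coefC, coef0) /= !(addr0, add0r) => -> -> ->.
- move=> n /andP[n0 np]; have -> : n%:R = io n%:R by rewrite rmorph_nat.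
  rewrite fmorph_eq0 -(dvdn_pcharf (pchar_Fp pp)); apply/negP => /dvdn_leq; rewrite n0 leqNgt np.
  by move/(_ isT).
Qed.

Section Incidences.
Variables (R : realType) (F : finFieldType).
Implicit Types (A : {set F}) (L : {set F * F}).

Lemma cauchy_schwarz (I : finType) (f g : I -> R) :
  (\sum_i f i * g i) ^+ 2 <= (\sum_i f i ^+ 2) * (\sum_i g i ^+ 2).
Proof.
set a := \sum_i f i ^+ 2; set b := \sum_i g i ^+ 2; set c := \sum_i f i * g i.
have b0 : 0 <= b by apply: sumr_ge0 => i _; apply: sqr_ge0.
have q : 0 <= \sum_i (b * f i - c * g i) ^+ 2 by apply: sumr_ge0 => i _; apply: sqr_ge0.
have e : \sum_i (b * f i - c * g i) ^+ 2 = b * (a * b - c ^+ 2).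
  transitivity (\sum_i (b ^+ 2 * f i ^+ 2 - (2 * b * c) * (f i * g i) + c ^+ 2 * g i ^+ 2)).
    by apply: eq_bigr => i _; ring.
  by rewrite big_split sumrB /= -!mulr_sumr -/a -/b -/c; ring.
rewrite e in q; move: b0; rewrite le_eqVlt => /predU1P[b0 | b0]; last first.
  by rewrite -subr_ge0 -(pmulr_rge0 _ b0).
have g0 i : g i = 0.
  have := b0 => /esym/eqP; rewrite psumr_eq0 => [|j _]; last exact: sqr_ge0.
  by move/allP/(_ i); rewrite mem_index_enum => /(_ isT); rewrite sqrf_eq0 => /eqP.
have -> : c = 0 by rewrite /c big1 // => i _; rewrite g0 mulr0.
by rewrite expr0n -b0 mulr0.
Qed.

Lemma sumr_setX (A : {set F}) L (G : F * (F * F) -> R) :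
  \sum_(i in finset.setX A L) G i = \sum_(x in A) \sum_(l in L) G (x, l).
Proof.
rewrite pair_big /=; apply: eq_big => [[x l]|[x l] _] //=.
by rewrite finset.in_setX.
Qed.

Definition energy A L : R := \sum_(x in A) \sum_(l in L) \sum_(y in A) \sum_(k in L)
  (k.1 * x + k.2 == l.1 * y + l.2)%:R.

Lemma edges_energy A L : (edges (@line_adj _) (finset.setX A L) (finset.setX A L))%:R = energy A L.
Proof.
rewrite /edges card_pairs_fst natr_sum sumr_setX; apply: eq_bigr => x _; apply: eq_bigr => l _.
rewrite -sum1_card natr_sum (eq_bigl (fun j => (j \in finset.setX A L) && line_adj (x, l) j)); last first.
  by move=> j; rewrite !inE.
rewrite big_mkcondr /= sumr_setX; apply: eq_bigr => y _; apply: eq_bigr => k _.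
by rewrite /line_adj /=; case: eqP.
Qed.

Lemma sqrt_between n : (0 < n)%N -> exists e, [/\ (0 < e)%N, (n <= e ^ 2)%N & (e ^ 2 <= 4 * n)%N].
Proof.
move=> n0; have ex : exists e, (n <= e ^ 2)%N by exists n; rewrite expnS expn1 leq_pmulr.
case: (ex_minnP ex) => e he hmin; exists e; split => //; first by case: e he {hmin} => //; rewrite exp0n // leqNgt n0.
case: e he hmin => [|e] he hmin; first by rewrite exp0n.
have : ~~ (n <= e ^ 2)%N by apply/negP => /hmin; rewrite ltnn.
rewrite -ltnNge; case: e {he hmin} => [|e]; first by rewrite exp1n; lia.
nia.
Qed.

End Incidences.

(** Here E0^2 lies between N La and 4 N La. Thus 6 E0 <= p follows from 144 N La <= p^2, and 2 * 64
    * E0 is at most 256 times the root. *)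
Lemma incidence_real (R : realType) (p : nat) (A : {set 'F_p}) (L : {set 'F_p * 'F_p}) (La k n : nat) :
  prime p -> #|A| = n -> (4 <= n)%N -> (0 < #|L|)%N -> (0 < La)%N ->
  (n * #|L| <= n ^ 6)%N -> (36 * n ^ 18 <= 2 ^ La)%N -> (144 * (n * #|L| * La) <= p ^ 2)%N ->
  (n <= k)%N -> collinear_le L k ->
  energy R A L <= (n * #|L|)%:R * (256 * Num.sqrt (n * #|L| * La)%:R + 4 * k%:R).
Proof.
move=> pp An n4 L0 La0 N6 h36 hp nk hL; set N := (n * #|L|)%N in N6 hp *.
have N4 : (4 <= N)%N by rewrite /N; nia.
have [E0 [E0p hE hE']] := @sqrt_between (N * La)%N ltac:(by rewrite muln_gt0; lia).
have := @incidence_Fp p A L E0 La k pp E0p; rewrite An -/N => h.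
have E6 : (6 * E0 <= p)%N.
  rewrite -(@leq_exp2r _ _ 2) // expnMn; apply: leq_trans hp; lia.
have E2 : (N * (3 * E0) <= 2 ^ La)%N.
  rewrite -(@leq_exp2r _ _ 2) // !expnMn.
  apply: (@leq_trans (N ^ 3 * 36 * La)); first by rewrite expnSr; nia.
  apply: (@leq_trans (36 * n ^ 18 * 2 ^ La)); last by rewrite -[X in (_ <= X)%N]mulnn leq_mul2r h36 orbT.
  rewrite mulnC [X in (_ <= X)%N]mulnC leq_mul ?(ltnW (ltn_expl _ _)) // mulnC leq_mul2l /=.
  by rewrite (_ : 18 = 6 * 3)%N // expnM leq_exp2r.
have {}h := h E6 N4 hE E2 nk hL.
rewrite -edges_energy; apply: le_trans (_ : ((2 * (64 * E0 + 2 * k) * N)%N%:R <= _)); first by rewrite ler_nat.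
rewrite natrM mulrC ler_wpM2l ?ler0n //.
have -> : (2 * (64 * E0 + 2 * k))%N%:R = 2 * (64 * E0%:R + 2 * k%:R) :> R by rewrite natrM natrD !natrM.
have sE : E0%:R <= 2 * Num.sqrt (N * La)%:R :> R.
  rewrite -(@ler_pXn2r _ 2) ?nnegrE ?mulr_ge0 ?sqrtr_ge0 ?ler0n // exprMn sqr_sqrtr ?ler0n //.
  by rewrite -natrX -natrX -natrM ler_nat.
lra.
Qed.

(** * Rich lines and level sets of the multiplicative energy *)

Section RichLines.
Variables (R : realType) (F : finFieldType).
Local Notation p := #|{: F}|.
Implicit Types (A : {set F}) (L : {set F * F}) (l : F * F).

Definition online A l := #|[set x in A | l.1 * x + l.2 \in A]|.
Definition rich A k : {set F * F} := [set l | (k <= online A l)%N].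

Lemma onlineE A l : online A l = (\sum_(x in A) ((l.1 * x + l.2)%R \in A))%N.
Proof.
rewrite /online -sum1_card (eq_bigl (fun x => (x \in A) && (l.1 * x + l.2 \in A))).
  by rewrite big_mkcondr /=; apply: eq_bigr => x _; case: ifP.
by move=> x; rewrite inE.
Qed.

Lemma sum_fst_snd (T1 T2 : finType) (G : T1 * T2 -> nat) :
  (\sum_l G l = \sum_m \sum_c G (m, c))%N.
Proof. by rewrite pair_big; apply: eq_bigr => -[m c] _. Qed.

Lemma sum_mem (A : {set F}) (z : F) : (\sum_(c : F) ((z + c)%R \in A) = #|A|)%N.
Proof.
rewrite (reindex_inj (addrI (- z))) /= -sum1_card [RHS]big_mkcond /=.
by apply: eq_bigr => c _; rewrite addNKr; case: ifP.
Qed.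

Lemma online_sum A : (\sum_l online A l = p * #|A| ^ 2)%N.
Proof.
under eq_bigr do rewrite onlineE.
rewrite exchange_big /= (eq_bigr (fun _ => (p * #|A|)%N)) => [|x _].
  by rewrite sum_nat_const -mulnn mulnCA mulnA.
rewrite sum_fst_snd (eq_bigr (fun _ => #|A|)) => [|m _]; last by rewrite /= sum_mem.
by rewrite sum_nat_const cardT -cardE.
Qed.

Lemma online_sum_sqr A : (\sum_l online A l ^ 2 <= #|A| ^ 2 * p + #|A| ^ 4)%N.
Proof.
have -> : (\sum_l online A l ^ 2 = \sum_(x in A) \sum_(y in A) \sum_l
    ((l.1 * x + l.2)%R \in A) * ((l.1 * y + l.2)%R \in A))%N.
  under eq_bigr do rewrite onlineE -mulnn big_distrlr /=.
  rewrite exchange_big /=; apply: eq_bigr => x _; exact: exchange_big.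
have eqx (x : F) : (\sum_l ((l.1 * x + l.2)%R \in A) * ((l.1 * x + l.2)%R \in A) = p * #|A|)%N.
  rewrite sum_fst_snd (eq_bigr (fun _ => #|A|)) => [|m _].
    by rewrite sum_nat_const cardT -cardE.
  by rewrite -(sum_mem A (m * x)); apply: eq_bigr => c _ /=; rewrite mulnn; case: (_ \in A).
have nex (x y : F) : x != y -> (\sum_l ((l.1 * x + l.2)%R \in A) * ((l.1 * y + l.2)%R \in A) <= #|A| ^ 2)%N.
  move=> ne; pose g (l : F * F) := (l.1 * x + l.2, l.1 * y + l.2).
  have gi : injective g.
    move=> [m c] [m' c'] ee; have e1 := congr1 fst ee; have e2 := congr1 snd ee; rewrite /= in e1 e2; have : (m - m') * (x - y) = 0.
      transitivity ((m * x + c) - (m * y + c) - ((m' * x + c') - (m' * y + c'))); first by ring.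
      by rewrite e1 e2 subrr.
    move/eqP; rewrite mulf_eq0 !subr_eq0 (negPf ne) orbF => /eqP em; subst.
    by move: e1 => /addrI ->.
  rewrite -mulnn -cardsX -sum1_card.
  apply: (@leq_trans (\sum_l (g l \in finset.setX A A))).
    by apply: leq_sum => l _; rewrite finset.in_setX; do 2!case: (_ \in A).
  rewrite -big_mkcond /= sum1_card sum1_card.
  apply: (@leq_trans #|g @: [set l | g l \in finset.setX A A]|); first by rewrite card_imset // cardsE.
  by apply/subset_leq_card/fintype.subsetP => _ /imsetP[l + ->]; rewrite inE.
apply: (@leq_trans (\sum_(x in A) (p * #|A| + #|A| ^ 3))).
  apply: leq_sum => x xA; rewrite (bigD1 x) //= eqx leq_add2l.
  apply: (@leq_trans (\sum_(y in A | y != x) #|A| ^ 2)).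
    by apply: leq_sum => y /andP[_ ne]; apply: nex; rewrite eq_sym.
  rewrite sum_nat_const (expnS #|A| 2) leq_mul2r; apply/orP; right.
  by apply/subset_leq_card/fintype.subsetP => y /andP[].
by rewrite sum_nat_const; lia.
Qed.

(** In the sum of online^2 - online the terms p n^2 cancel and n^4 remains, while every rich line
    contributes at least k^2 - k >= 1. *)
Lemma rich_le4 A k : (2 <= k)%N -> (#|rich A k| <= #|A| ^ 4)%N.
Proof.
move=> k2; have h1 := online_sum_sqr A; have h2 := online_sum A.
have : (\sum_l online A l + #|rich A k| <= \sum_l online A l ^ 2)%N.
  rewrite -sum1_card [X in (_ + X)%N]big_mkcond -big_split /=; apply: leq_sum => l _.
  by rewrite inE; case: ifP => h; nia.
nia.
Qed.

(** Chebyshev: over the p^2 lines [online] has mean n^2 / p and total squared deviation at most p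
    n^2, and k is at least twice the mean. *)
Lemma rich_second_moment A k : (2 * #|A| ^ 2 <= p * k)%N ->
  (#|rich A k| * k ^ 2 <= 4 * p * #|A| ^ 2)%N.
Proof.
have p0 : (0 < p)%N by apply/card_gt0P; exists 0.
move=> hk; set n := #|A| in hk *; rewrite -(@ler_nat R).
have h1 : \sum_l (online A l)%:R ^+ 2 <= n%:R ^+ 2 * p%:R + n%:R ^+ 4 :> R.
  under eq_bigr do rewrite -natrX.
  by rewrite -natr_sum -!natrX -natrM -natrD ler_nat online_sum_sqr.
have h2 : \sum_l (online A l)%:R = p%:R * n%:R ^+ 2 :> R.
  by rewrite -natr_sum online_sum natrM natrX.
have pR : 0 < p%:R :> R by rewrite ltr0n.
pose a : R := n%:R ^+ 2 / p%:R.
have pa : p%:R * a = n%:R ^+ 2 by rewrite /a mulrCA divff ?mulr1 // gt_eqF.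
have : \sum_l ((online A l)%:R - a) ^+ 2 <= n%:R ^+ 2 * p%:R.
  have -> : \sum_l ((online A l)%:R - a) ^+ 2 = \sum_l (online A l)%:R ^+ 2 - 2 * a * \sum_l (online A l)%:R + p%:R ^+ 2 * a ^+ 2.
    have -> : p%:R ^+ 2 * a ^+ 2 = \sum_(l : F * F) a ^+ 2.
      by rewrite sumr_const -[RHS]mulr_natl -natrX -mulnn -card_prod.
    rewrite mulr_sumr -sumrB -big_split /=; apply: eq_bigr => l _; ring.
  rewrite h2 -exprMn pa; have -> : 2 * a * (p%:R * n%:R ^+ 2) = 2 * (p%:R * a) * n%:R ^+ 2 by ring.
  by rewrite pa; apply: le_trans (lerD (lerB h1 (lexx _)) (lexx _)) _; rewrite le_eqVlt; apply/orP; left; apply/eqP; ring.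
have low : (#|rich A k| * k ^ 2)%N%:R / 4 <= \sum_l ((online A l)%:R - a) ^+ 2.
  apply: (@le_trans _ _ (\sum_(l in rich A k) (k%:R / 2) ^+ 2)).
    by rewrite sumr_const -mulr_natl natrM natrX le_eqVlt; apply/orP; left; apply/eqP; field.
  rewrite big_mkcond /=; apply: ler_sum => l _; rewrite inE; case: ifP => [h | _]; last exact: sqr_ge0.
  have a0 : 2 * a <= k%:R.
    rewrite -(ler_pM2l pR) mulrCA pa -natrX -!natrM ler_nat; exact: hk.
  have kl : k%:R <= (online A l)%:R :> R by rewrite ler_nat.
  have k0 := ler0n R k; by rewrite ler_pXn2r ?nnegrE //; lra.
move=> hi; have := le_trans low hi; rewrite ler_pdivrMr // => h; apply: le_trans h _.
by rewrite !natrM le_eqVlt; apply/orP; left; apply/eqP; ring.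
Qed.

(** Dually collinear lines are concurrent or parallel, so outside the abscissa of the common point
    they cover disjoint parts of A x A, each of at least k - 1 points. *)
Lemma rich_collinear A L k : L \subset rich A k -> (2 <= k)%N -> collinear_le L (#|A| ^ 2 %/ k.-1).
Proof.
move=> hL k2 l0 l1 l0L l1L ne; rewrite leq_divRL; last by lia.
(* [x0] is the abscissa of the common point. For parallel lines the division by 0 makes it 0, and
   discarding that abscissa does no harm. *)
set T := [set l in L | _]; pose x0 := - (l1.2 - l0.2) / (l1.1 - l0.1).
pose P (u : (F * F) * F) := [&& u.1 \in T, u.2 \in A, u.1.1 * u.2 + u.1.2 \in A & u.2 != x0].
apply: (@leq_trans #|[set u | P u]|).
  rewrite -[X in (_ <= X)%N]sum1_card (eq_bigl (fun u : (F * F) * F => (u.1 \in T) &&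
     [&& u.2 \in A, u.1.1 * u.2 + u.1.2 \in A & u.2 != x0])); last by move=> u; rewrite inE.
  rewrite -(pair_big_dep (mem T) (fun l x => [&& x \in A, l.1 * x + l.2 \in A & x != x0]) (fun _ _ => 1%N)) /=.
  rewrite -sum_nat_const; apply: leq_sum => l; rewrite inE => /andP[/(fintype.subsetP hL)].
  rewrite inE /online => h _; rewrite sum1_card.
  apply: (@leq_trans (#|[set x in A | l.1 * x + l.2 \in A] :\ x0|)).
    rewrite (cardsD1 x0) in h; have := leq_b1 (x0 \in [set x in A | l.1 * x + l.2 \in A]).
    by move: h; move: (nat_of_bool _) #|_ :\ x0| => b1 b2; lia.
  by apply/subset_leq_card/fintype.subsetP => x; rewrite !inE => /andP[h1 /andP[h2 h3]]; apply/and3P.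
pose g (u : (F * F) * F) := (u.2, u.1.1 * u.2 + u.1.2).
have gi : {in [set u | P u] &, injective g}.
  move=> [[m c] x] [[m' c'] x']; rewrite !inE /P /= !inE => /andP[/andP[_ /eqP e1] /and3P[_ _ nx]].
  move=> /andP[/andP[_ /eqP e2] _] [ex ey]; subst x'.
  move: e1 e2 nx; rewrite /x0 /=; set d1 := l1.1 - l0.1; set d2 := l1.2 - l0.2 => e1 e2 nx.
  have e3 : (m - m') * d2 = (c - c') * d1.
    transitivity ((m - l0.1) * d2 - (m' - l0.1) * d2); first by ring.
    by rewrite e1 e2; ring.
  have e4 : (m - m') * x + (c - c') = 0.
    transitivity ((m * x + c) - (m' * x + c')); first by ring.
    by rewrite ey subrr.
  have em : m - m' = 0.
    case: (eqVneq d1 0) => [d10 | d1n].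
      have d2n : d2 != 0.
        move: ne; apply: contraNneq => d20; apply/eqP; case: (l0) (l1) @d1 @d2 d10 d20 {e1 e2 e3 nx} => [a b] [a' b'] /=.
        by move=> /eqP + /eqP; rewrite !subr_eq0 => /eqP -> /eqP ->.
      by move/eqP: e3; rewrite d10 mulr0 mulf_eq0 (negPf d2n) orbF => /eqP.
    have : (m - m') * (x - - d2 / d1) = 0.
      have -> : (m - m') * (x - - d2 / d1) = (m - m') * x + ((m - m') * d2) / d1 by ring.
      by rewrite e3 mulfK // e4.
    by move/eqP; rewrite mulf_eq0 [X in _ || X]subr_eq0 (negPf nx) orbF => /eqP.
  move: e4; rewrite em mul0r add0r => /eqP; rewrite subr_eq0 => /eqP ->.
  by move/eqP: em; rewrite subr_eq0 => /eqP ->.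
rewrite -(card_in_imset gi) -mulnn -cardsX; apply/subset_leq_card/fintype.subsetP => _ /imsetP[u hu ->].
by move: hu; rewrite inE /P => /and4P[_ uA vA _]; rewrite /g finset.in_setX uA.
Qed.

Lemma sum_delta (x y : F) : \sum_(z : F) (x == z)%:R * (y == z)%:R = (x == y)%:R :> R.
Proof.
rewrite (bigD1 x) //= eqxx mul1r big1 ?addr0 ?[y == x]eq_sym // => z ne.
by rewrite eq_sym (negPf ne) mul0r.
Qed.

Lemma energyE A L : energy R A L =
  \sum_(z : F) (\sum_(x in A) \sum_(k in L) (k.1 * x + k.2 == z)%:R) ^+ 2.
Proof.
transitivity (\sum_(z : F) \sum_(x in A) \sum_(k in L) \sum_(y in A) \sum_(l in L)
   (k.1 * x + k.2 == z)%:R * (l.1 * y + l.2 == z)%:R : R).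
  rewrite exchange_big /energy; apply: eq_bigr => x _; rewrite exchange_big /=.
  rewrite (eq_bigr _ (fun y _ => exchange_big _ _ _ _ _ _)) /= exchange_big /= [RHS]exchange_big.
  apply: eq_bigr => k _; rewrite [RHS]exchange_big; apply: eq_bigr => y _.
  by rewrite [RHS]exchange_big; apply: eq_bigr => l _; rewrite sum_delta.
apply: eq_bigr => z _; rewrite expr2 mulr_suml; apply: eq_bigr => x _; rewrite mulr_suml.
apply: eq_bigr => k _; rewrite mulr_sumr; apply: eq_bigr => y _; rewrite mulr_sumr.
by apply: eq_bigr => l _.
Qed.

(** Cauchy-Schwarz over the values z in [A]; the energy is the second moment of the number of
    representations of z as l (x). *)
Lemma incidences_energy A L :
  (\sum_(l in L) online A l)%:R ^+ 2 <= #|A|%:R * energy R A L.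
Proof.
pose J (z : F) : R := \sum_(x in A) \sum_(k in L) (k.1 * x + k.2 == z)%:R.
have -> : (\sum_(l in L) online A l)%:R = \sum_z (z \in A)%:R * J z.
  rewrite natr_sum (eq_bigr _ (fun l _ => congr1 (fun m => m%:R) (onlineE A l))).
  under eq_bigr do rewrite natr_sum.
  rewrite exchange_big /= /J; under [RHS]eq_bigr do rewrite mulr_sumr.
  rewrite [RHS]exchange_big; apply: eq_bigr => x _; under [RHS]eq_bigr do rewrite mulr_sumr.
  rewrite [RHS]exchange_big; apply: eq_bigr => l _ /=.
  rewrite (bigD1 (l.1 * x + l.2)) //= eqxx mulr1 big1 ?addr0 // => z ne.
  by rewrite eq_sym (negPf ne) mulr0.
apply: le_trans (cauchy_schwarz _ _) _; rewrite energyE ler_wpM2r ?sumr_ge0 // => [z _|]; first exact: sqr_ge0.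
rewrite le_eqVlt; apply/orP; left; apply/eqP; rewrite -sum1_card natr_sum [RHS]big_mkcond /=.
by apply: eq_bigr => z _; case: (z \in A); rewrite ?expr1n ?expr0n.
Qed.
End RichLines.

(** [La] stands for a multiple of log n. [incidence_bound] wants 3 N E0 <= 2^La; the square of the
    left side is at most 36 N^3 La, and N <= n^6, La <= 2^La. *)
Definition log_dominates n La : bool := (36 * n ^ 18 <= 2 ^ La)%N.

Lemma ler_sqr_mono (R : realType) (x y : R) : 0 <= x -> x <= y -> x ^+ 2 <= y ^+ 2.
Proof. by move=> x0 xy; rewrite !expr2 ler_pM. Qed.

Section RichLineBound.
Variables (R : realType) (p : nat) (A : {set 'F_p}) (n La k : nat).
Hypotheses (pp : prime p) (An : #|A| = n) (n4 : (4 <= n)%N) (La0 : (0 < La)%N)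
  (hLa : log_dominates n La) (k2 : (2 <= k)%N).

(** Counting incidences gives k^2 |L| <= n^2 (256 s + 4 ka), with s^2 = n |L| La and ka about n^2 /
    k. If the root dominates, squaring gives the claim with 512^2 = 2^18; otherwise k^3 |L| <= 16
    n^4, which is enough because k <= n. *)
Lemma rich_subset_bound (L : {set 'F_p * 'F_p}) : L \subset rich A k -> (0 < #|L|)%N ->
  (144 * (n * #|L| * La) <= p ^ 2)%N -> #|L|%:R * k%:R ^+ 4 <= 2 ^+ 18 * n%:R ^+ 5 * La%:R :> R.
Proof.
move=> hL L0 hp; have [l0 l0L] : exists l, l \in L by apply/finset.set0Pn; rewrite -card_gt0.
have kn : (k <= n)%N.
  have := fintype.subsetP hL _ l0L; rewrite inE => h; apply: leq_trans h _; rewrite -An.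
  by apply/subset_leq_card/fintype.subsetP => x; rewrite inE => /andP[].
set ka := (n ^ 2 %/ k.-1)%N.
have hk : (ka * k.-1 <= n ^ 2)%N by apply: leq_trunc_div.
have nka : (n <= ka)%N by rewrite /ka leq_divRL; [rewrite -mulnn leq_mul2l | ]; clear - k2 kn; lia.
have hcol : collinear_le L ka by rewrite /ka -An; apply: rich_collinear.
have Ln : (n * #|L| <= n ^ 6)%N.
  have : (#|L| <= n ^ 4)%N by rewrite -An; apply: leq_trans (subset_leq_card hL) _; apply: rich_le4.
  by move=> h; rewrite (expnS n 5) leq_mul2l; apply/orP; right; apply: leq_trans h _; rewrite leq_exp2l; lia.
have := incidence_real R pp An n4 L0 La0 Ln hLa hp nka hcol.
have := incidences_energy R A L.
have : ((k * #|L|)%:R : R) <= (\sum_(l in L) online A l)%:R.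
  by rewrite ler_nat mulnC -sum_nat_const; apply: leq_sum => l /(fintype.subsetP hL); rewrite inE.
rewrite An; move: (energy R A L) => E; set I : R := (\sum_(l in L) _)%:R; set s := Num.sqrt _ => h1 h2 h3.
have s0 : 0 <= s by apply: sqrtr_ge0.
have s2 : s ^+ 2 = n%:R * #|L|%:R * La%:R by rewrite sqr_sqrtr ?ler0n // !natrM.
have N0 : 0 < n%:R :> R by rewrite ltr0n (leq_trans _ n4).
have l0' : 0 < #|L|%:R :> R by rewrite ltr0n.
have K0 : 0 < k%:R :> R by rewrite ltr0n (leq_trans _ k2).
have kaR : ka%:R * k%:R <= 2 * n%:R ^+ 2 :> R.
  have e : (ka * k <= 2 * n ^ 2)%N.
    apply: (@leq_trans (2 * (ka * k.-1))); last by rewrite leq_mul2l hk.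
    by rewrite mulnCA leq_mul2l; apply/orP; right; clear - k2; lia.
  by move: e; rewrite -(ler_nat R) (natrM _ ka) (natrM _ 2) natrX.
have knR : k%:R <= n%:R :> R by rewrite ler_nat.
have La1 : 1 <= La%:R :> R by rewrite ler1n.
rewrite natrM in h1; rewrite natrM in h3.
have main : k%:R ^+ 2 * #|L|%:R <= n%:R ^+ 2 * (256 * s + 4 * ka%:R).
  rewrite -(ler_pM2r l0'); apply: (@le_trans _ _ (I ^+ 2)).
    have -> : k%:R ^+ 2 * #|L|%:R * #|L|%:R = (k%:R * #|L|%:R) ^+ 2 :> R by ring.
    by apply: ler_sqr_mono h1; rewrite mulr_ge0 ?ler0n.
  apply: le_trans h2 _; apply: le_trans (ler_wpM2l (ltW N0) h3) _.
  by rewrite le_eqVlt; apply/orP; left; apply/eqP; ring.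
case: (lerP (4 * ka%:R) (256 * s)) => c.
  have h4 : k%:R ^+ 2 * #|L|%:R <= 512 * (n%:R ^+ 2 * s).
    by apply: le_trans main _; have : 0 <= n%:R ^+ 2 :> R by []; nra.
  have : (k%:R ^+ 2 * #|L|%:R) ^+ 2 <= (512 * (n%:R ^+ 2 * s)) ^+ 2.
    by apply: ler_sqr_mono h4; rewrite mulr_ge0 ?exprn_ge0 ?ler0n.
  rewrite !exprMn s2 => h5; rewrite -(ler_pM2r l0').
  have -> : #|L|%:R * k%:R ^+ 4 * #|L|%:R = (k%:R ^+ 2) ^+ 2 * #|L|%:R ^+ 2 :> R by ring.
  by apply: le_trans h5 _; rewrite le_eqVlt; apply/orP; left; apply/eqP; ring.
have h4 : k%:R ^+ 2 * #|L|%:R <= 8 * n%:R ^+ 2 * ka%:R :> R.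
  by apply: le_trans main _; have : 0 <= n%:R ^+ 2 :> R by []; nra.
have h5 : k%:R ^+ 3 * #|L|%:R <= 16 * n%:R ^+ 4 :> R.
  have -> : k%:R ^+ 3 * #|L|%:R = k%:R * (k%:R ^+ 2 * #|L|%:R) :> R by ring.
  apply: le_trans (ler_wpM2l (ltW K0) h4) _.
  have -> : k%:R * (8 * n%:R ^+ 2 * ka%:R) = 8 * n%:R ^+ 2 * (ka%:R * k%:R) :> R by ring.
  apply: le_trans (ler_wpM2l _ kaR) _; first by rewrite mulr_ge0 ?exprn_ge0 ?ler0n.
  by rewrite le_eqVlt; apply/orP; left; apply/eqP; ring.
have -> : #|L|%:R * k%:R ^+ 4 = k%:R * (k%:R ^+ 3 * #|L|%:R) :> R by ring.
apply: le_trans (ler_wpM2l (ltW K0) h5) _.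
apply: (@le_trans _ _ (n%:R * (16 * n%:R ^+ 4))); first by rewrite ler_wpM2r // mulr_ge0 ?exprn_ge0 ?ler0n.
have -> : n%:R * (16 * n%:R ^+ 4) = (16 * n%:R ^+ 5) * 1 :> R by ring.
apply: ler_pM => //; rewrite ler_wpM2r ?exprn_ge0 ?ler0n //.
have -> : 16 = 2 ^+ 4 :> R by rewrite -natrX.
by rewrite ler_eXn2l // ltr1n.
Qed.

Lemma exists_subset_card (T : finType) (S : {set T}) h : (h <= #|S|)%N -> exists2 S' : {set T}, S' \subset S & #|S'| = h.
Proof.
move=> hS; exists [set x in take h (enum S)].
  by apply/fintype.subsetP => x; rewrite inE => /mem_take; rewrite mem_enum.
rewrite cardsE (card_uniqP _) ?take_uniq ?enum_uniq // size_take -cardE.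
by case: ltnP => // h'; apply/eqP; rewrite eqn_leq hS h'.
Qed.

(** If there are too many rich lines for p, apply the bound to only about p^2 / (144 n La) of them:
    this gives p k^2 <= 2^14 n^3 La, and the second moment bound, multiplied by k^2, concludes for
    the whole set. *)
Lemma rich_bound : (144 * (n * La) <= p ^ 2)%N -> (2 * n ^ 2 <= p * k)%N ->
  #|rich A k|%:R * k%:R ^+ 4 <= 2 ^+ 18 * n%:R ^+ 5 * La%:R :> R.
Proof.
move=> hp hk; set l := #|rich A k|.
have rhs0 : 0 <= 2 ^+ 18 * n%:R ^+ 5 * La%:R :> R by rewrite !mulr_ge0 ?exprn_ge0 ?ler0n.
case: (posnP l) => [-> | l0]; first by rewrite mul0r.
case: (leqP (144 * (n * l * La)) (p ^ 2)) => c; first exact: rich_subset_bound.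
pose h := (p ^ 2 %/ (144 * (n * La)))%N.
have d0 : (0 < 144 * (n * La))%N by rewrite !muln_gt0 La0; lia.
have h1 : (0 < h)%N by rewrite divn_gt0.
have h2 : (h * (144 * (n * La)) <= p ^ 2)%N by apply: leq_trunc_div.
have h3 : (p ^ 2 < h.+1 * (144 * (n * La)))%N by apply: ltn_ceil.
have hl : (h <= #|rich A k|)%N.
  rewrite leqNgt; apply/negP => lt; move: c; rewrite ltnNge => /negP; apply.
  apply: leq_trans h2; rewrite -/l in lt; have := ltnW lt => lh.
  have -> : (144 * (n * l * La) = l * (144 * (n * La)))%N by ring.
  by rewrite leq_mul2r lh orbT.
have [L LS Lh] := exists_subset_card hl.
have := rich_subset_bound LS; rewrite Lh => /(_ h1) H.
have {}H : h%:R * k%:R ^+ 4 <= 2 ^+ 18 * n%:R ^+ 5 * La%:R :> R.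
  by apply: H; apply: leq_trans h2; rewrite leq_eqVlt; apply/orP; left; apply/eqP; ring.
have p2 : p%:R ^+ 2 <= 288 * h%:R * (n%:R * La%:R) :> R.
  have e : (p ^ 2 <= 288 * h * (n * La))%N.
    by apply: leq_trans (ltnW h3) _; move: (n * La)%N h1 => w; nia.
  by move: e; rewrite -(ler_nat R) natrX !natrM.
have N0 : 0 <= n%:R :> R by [].
have La1 : 0 <= La%:R :> R by [].
have pk : p%:R * k%:R ^+ 2 <= 2 ^+ 14 * n%:R ^+ 3 * La%:R :> R.
  rewrite -(@ler_pXn2r _ 2) ?nnegrE ?mulr_ge0 ?exprn_ge0 ?ler0n //.
  have -> : (p%:R * k%:R ^+ 2) ^+ 2 = p%:R ^+ 2 * k%:R ^+ 4 :> R by ring.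
  apply: le_trans (ler_wpM2r _ p2) _; first by rewrite exprn_ge0.
  have -> : 288 * h%:R * (n%:R * La%:R) * k%:R ^+ 4 = 288 * (n%:R * La%:R) * (h%:R * k%:R ^+ 4) :> R by ring.
  apply: le_trans (ler_wpM2l (mulr_ge0 (ler0n R 288) (mulr_ge0 N0 La1)) H) _.
  have -> : 288 * (n%:R * La%:R) * (2 ^+ 18 * n%:R ^+ 5 * La%:R) = (288 * 2 ^+ 18) * (n%:R ^+ 6 * La%:R ^+ 2) :> R by ring.
  have -> : (2 ^+ 14 * n%:R ^+ 3 * La%:R) ^+ 2 = (2 ^+ 10 * 2 ^+ 18) * (n%:R ^+ 6 * La%:R ^+ 2) :> R by ring.
  rewrite ler_wpM2r ?mulr_ge0 ?exprn_ge0 // ler_wpM2r ?exprn_ge0 //.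
  by rewrite -natrX ler_nat.
have cF : #|{: 'F_p}| = p by rewrite card_Fp.
have := @rich_second_moment R _ A k; rewrite cF An => /(_ hk).
rewrite -(ler_nat R) !natrM -!expr2 -/l => sm.
apply: (@le_trans _ _ (4 * n%:R ^+ 2 * (p%:R * k%:R ^+ 2))).
  have -> : l%:R * k%:R ^+ 4 = l%:R * k%:R ^+ 2 * k%:R ^+ 2 :> R by ring.
  apply: le_trans (ler_wpM2r _ sm) _; first by rewrite exprn_ge0.
  by rewrite le_eqVlt; apply/orP; left; apply/eqP; ring.
apply: le_trans (ler_wpM2l _ pk) _; first by rewrite mulr_ge0 ?exprn_ge0.
have -> : 4 * n%:R ^+ 2 * (2 ^+ 14 * n%:R ^+ 3 * La%:R) = 2 ^+ 16 * (n%:R ^+ 5 * La%:R) :> R by ring.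
rewrite -mulrA ler_wpM2r ?mulr_ge0 ?exprn_ge0 //.
by rewrite ler_eXn2l // ltr1n.
Qed.
End RichLineBound.

Section Dyadic.
Variables (R : realType) (T : finType).

Lemma dyadic_sum (h w : T -> R) a J (m C : R) : 0 < m -> (forall t, 0 <= w t) ->
  (forall t, h t < m * 2 ^+ J) ->
  (forall j, (j < J)%N -> (m * 2 ^+ j) ^+ a * \sum_(t | m * 2 ^+ j <= h t) w t <= C) ->
  \sum_(t | m <= h t) w t * h t ^+ a <= 2 ^+ a * J%:R * C.
Proof.
move=> m0 w0 hJ hC.
apply: (@le_trans _ _ (\sum_t \sum_(j < J) (m * 2 ^+ j <= h t)%R%:R * ((2 * (m * 2 ^+ j)) ^+ a * w t))).
  rewrite big_mkcond /=; apply: ler_sum => t _.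
  have pos (j : 'I_J) : 0 <= (m * 2 ^+ j <= h t)%R%:R * ((2 * (m * 2 ^+ j)) ^+ a * w t).
    by rewrite mulr_ge0 ?ler0n // mulr_ge0 // exprn_ge0 // mulr_ge0 // mulr_ge0 ?exprn_ge0 // ltW.
  case: ifP => [ht | _]; last by apply: sumr_ge0.
  have ex : exists j, h t < m * 2 ^+ j by exists J.
  case: (ex_minnP ex) => -[|j] hj jmin; first by move: hj; rewrite expr0 mulr1 ltNge ht.
  have jJ : (j < J)%N by apply: jmin.
  have lj : m * 2 ^+ j <= h t by rewrite leNgt; apply/negP => /jmin; rewrite ltnn.
  rewrite (bigD1 (Ordinal jJ)) //= lj mul1r mulrC -[X in X <= _]addr0 lerD ?sumr_ge0 //.
  have ht0 : 0 <= h t by apply: le_trans ht; apply: ltW.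
  have le2 : h t <= 2 * (m * 2 ^+ j) by apply: ltW; apply: lt_le_trans hj _; rewrite exprS mulrCA.
  by rewrite ler_wpM2r // lerXn2r // nnegrE // (le_trans ht0 le2).
rewrite exchange_big /= -mulrA mulr_natl mulrnAr -[J in X in _ <= X]card_ord -sumr_const /=.
apply: ler_sum => j _; apply: (@le_trans _ _ (2 ^+ a * ((m * 2 ^+ j) ^+ a * \sum_(t | m * 2 ^+ j <= h t) w t))).
  rewrite [X in _ <= X]mulrA -exprMn mulr_sumr [X in _ <= X]big_mkcond /=; apply: ler_sum => t _.
  by case: ifP => _; rewrite ?mul1r ?mul0r.
by rewrite ler_wpM2l ?exprn_ge0 // hC.
Qed.
End Dyadic.

Section Differences.
Variables (R : realType) (F : finFieldType) (A : {set F}).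

Definition rep s : R := \sum_(a in A) ((a - s)%R \in A)%:R.
(** The difference 0 would add n^2 to every value of e, hence at least p n^4 to D. Its removal also
    lets sums be dilated by s without a case s = 0. *)
Definition rep0 s : R := if s == 0 then 0 else rep s.
Definition mulen (r : F -> R) x := \sum_s r s * r (x * s).

Lemma rep_ge0 s : 0 <= rep s.
Proof. by apply: sumr_ge0. Qed.
Lemma rep0_ge0 s : 0 <= rep0 s.
Proof. by rewrite /rep0; case: ifP => // _; apply: rep_ge0. Qed.
Lemma rep0_le s : rep0 s <= rep s.
Proof. by rewrite /rep0; case: ifP => // _; apply: rep_ge0. Qed.

Lemma sum_in (h : F -> R) : \sum_(a in A) h a = \sum_a (a \in A)%:R * h a.
Proof. by rewrite big_mkcond; apply: eq_bigr => a _; case: (a \in A); rewrite ?mul1r ?mul0r. Qed.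

(** For a, a', b, b' in A, b - b' = x (a - a') means that (a, b) and (a', b') lie on a common line
    of slope x. *)
Lemma mulen_rep x : mulen rep x = \sum_c (online A (x, c))%:R ^+ 2.
Proof.
pose al (a : F) : R := (a \in A)%:R.
have onE c : (online A (x, c))%:R = \sum_a al a * al (x * a + c).
  by rewrite onlineE natr_sum sum_in.
have reE s : rep s = \sum_a al a * al (a - s) by rewrite /rep sum_in.
transitivity (\sum_a \sum_s \sum_c (al a * al (x * a + c)) * (al (a - s) * al (x * (a - s) + c))); last first.
  transitivity (\sum_a \sum_b \sum_c (al a * al (x * a + c)) * (al b * al (x * b + c))).
    apply: eq_bigr => a _; rewrite [RHS](reindex_inj (inv_inj (_ : involutive (fun s => a - s)))) //=.
    by move=> s; rewrite opprB addrC subrK.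
  rewrite (eq_bigr _ (fun a _ => exchange_big _ _ _ _ _ _)) /= exchange_big /=.
  apply: eq_bigr => c _; rewrite onE expr2 big_distrlr /=.
  by apply: eq_bigr => a _; apply: eq_bigr.
rewrite exchange_big; apply: eq_bigr => s _; rewrite !reE big_distrlr /=; apply: eq_bigr => a _.
rewrite [RHS](reindex_inj (addrI (- (x * a)))) /=; apply: eq_bigr => y _.
have -> : x * a + (- (x * a) + y) = y by ring.
have -> : x * (a - s) + (- (x * a) + y) = y - x * s by ring.
by rewrite mulrACA.
Qed.

Lemma mulen_le (r r' : F -> R) x : (forall s, 0 <= r s) -> (forall s, r s <= r' s) -> mulen r x <= mulen r' x.
Proof. by move=> h0 h; apply: ler_sum => s _; apply: ler_pM. Qed.

Lemma sum_rep : \sum_s rep s = #|A|%:R ^+ 2.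
Proof.
rewrite /rep exchange_big /= (eq_bigr (fun _ => #|A|%:R)) => [|a _].
  by rewrite sumr_const -[LHS]mulr_natl expr2.
rewrite (reindex_inj (inv_inj (_ : involutive (fun s => a - s)))) /=; last first.
  by move=> s; rewrite opprB addrC subrK.
rewrite -sum1_card natr_sum [RHS]big_mkcond /=; apply: eq_bigr => s _.
by rewrite opprB addrC subrK; case: (s \in A).
Qed.

Lemma mulen_ge0 x : 0 <= mulen rep0 x.
Proof. by apply: sumr_ge0 => s _; rewrite mulr_ge0 ?rep0_ge0. Qed.

Lemma sum_mulen : \sum_x mulen rep0 x <= #|A|%:R ^+ 4.
Proof.
rewrite /mulen exchange_big /=.
have -> : #|A|%:R ^+ 4 = #|A|%:R ^+ 2 * #|A|%:R ^+ 2 :> R by ring.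
apply: (@le_trans _ _ (\sum_s rep0 s * #|A|%:R ^+ 2)).
  apply: ler_sum => s _; rewrite -mulr_sumr; case: (eqVneq s 0) => [-> | s0].
    by rewrite /rep0 eqxx !mul0r.
  rewrite ler_wpM2l ?rep0_ge0 // -sum_rep [X in _ <= X](reindex_inj (mulIf s0)) /=.
  by apply: ler_sum => x _; apply: rep0_le.
rewrite -mulr_suml ler_wpM2r ?exprn_ge0 // -sum_rep; apply: ler_sum => s _; exact: rep0_le.
Qed.

Lemma rep_le s : rep s <= #|A|%:R.
Proof.
rewrite /rep -sum1_card natr_sum; apply: ler_sum => a _; by case: (_ \in _).
Qed.

Lemma mulen_le3 x : mulen rep0 x <= #|A|%:R ^+ 3.
Proof.
have -> : #|A|%:R ^+ 3 = #|A|%:R ^+ 2 * #|A|%:R :> R by ring.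
rewrite -sum_rep mulr_suml; apply: ler_sum => s _; apply: ler_pM; rewrite ?rep0_ge0 ?rep0_le //.
by apply: le_trans (rep0_le _) (rep_le _).
Qed.
End Differences.

Lemma sum_set_pred (R : realType) (T : finType) (P : pred T) :
  \sum_(t | P t) 1 = #|[set t | P t]|%:R :> R.
Proof. by rewrite -sum1_card natr_sum; apply: eq_bigl => t; rewrite inE. Qed.

(** For fixed x the lines of slope x have n^2 incidences in all, so those with fewer than k0, about
    eta / (2 n^2), contribute at most eta / 2 to e (x). The rest is a dyadic sum over rich lines;
    the two lower bounds on eta ensure k0 >= 2 and 2 n^2 <= p k0. *)
Lemma level_bound (R : realType) (p : nat) (A : {set 'F_p}) (n La : nat) (eta : R) :
  prime p -> #|A| = n -> (4 <= n)%N -> (0 < La)%N -> log_dominates n La ->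
  (144 * (n * La) <= p ^ 2)%N -> 4 * n%:R ^+ 2 <= eta -> 8 * n%:R ^+ 4 <= p%:R * eta ->
  #|[set x | eta <= mulen (rep0 R A) x]|%:R * eta ^+ 3 <= 2 ^+ 25 * n%:R ^+ 9 * La%:R ^+ 2.
Proof.
move=> pp An n4 La0 hLa hp e1 e2; set X := [set x | _].
have N0 : 0 < n%:R :> R by rewrite ltr0n (leq_trans _ n4).
have N2 : 0 < n%:R ^+ 2 :> R by rewrite exprn_gt0.
have eta0 : 0 < eta by apply: lt_le_trans e1; rewrite mulr_gt0.
pose y := eta / (2 * n%:R ^+ 2); pose k0 := Num.truncn y.
have yE : y * (2 * n%:R ^+ 2) = eta by rewrite /y divfK // mulf_neq0 // gt_eqF.
have y0 : 0 <= y by rewrite divr_ge0 ?ltW // mulr_gt0.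
have /andP[k0y yk0] := truncn_itv y0; rewrite -/k0 in k0y yk0.
have y2 : 2 <= y by rewrite -(ler_pM2r (_ : 0 < 2 * n%:R ^+ 2)) ?yE ?mulr_gt0 //; lra.
have k02 : (2 <= k0)%N by rewrite -ltnS -(ltr_nat R); apply: le_lt_trans yk0.
have k0R : 2 <= k0%:R :> R by rewrite ler_nat.
have k0eta : eta <= 4 * n%:R ^+ 2 * k0%:R.
  by rewrite -yE; move: yk0; rewrite -natr1 => yk0; nra.
have k0eta' : 2 * n%:R ^+ 2 * k0%:R <= eta by rewrite -yE mulrC ler_pM2r ?mulr_gt0.
have pk : (2 * n ^ 2 <= p * k0)%N.
  rewrite -(ler_nat R) (natrM _ p) (natrM _ 2) natrX -(ler_pM2r (_ : 0 < 4 * n%:R ^+ 2)) ?mulr_gt0 //.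
  apply: (@le_trans _ _ (8 * n%:R ^+ 4)); first by rewrite le_eqVlt; apply/orP; left; apply/eqP; ring.
  apply: le_trans e2 _; apply: le_trans (ler_wpM2l (ler0n R p) k0eta) _.
  by rewrite le_eqVlt; apply/orP; left; apply/eqP; ring.
have perx x : x \in X -> eta / 2 <= \sum_(c | (k0 <= online A (x, c))%N) (online A (x, c))%:R ^+ 2.
  rewrite inE => hx; have : eta <= \sum_c (online A (x, c))%:R ^+ 2.
    rewrite -mulen_rep; apply: le_trans hx _; apply: mulen_le; [exact: rep0_ge0 | exact: rep0_le].
  rewrite (bigID (fun c => (k0 <= online A (x, c))%N)) /=.
  have : \sum_(c | ~~ (k0 <= online A (x, c))%N) (online A (x, c))%:R ^+ 2 <= k0%:R * n%:R ^+ 2 :> R.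
    apply: (@le_trans _ _ (\sum_c k0%:R * (online A (x, c))%:R)).
      rewrite big_mkcond /=; apply: ler_sum => c _; case: ifP => h; last by rewrite mulr_ge0.
      by rewrite expr2 ler_wpM2r // ler_nat ltnW // ltnNge.
    rewrite -mulr_sumr ler_wpM2l //; under eq_bigr do rewrite onlineE natr_sum.
    rewrite exchange_big /= (eq_bigr (fun _ => n%:R)) => [|a _].
      by rewrite sumr_const An -[X in X <= _]mulr_natl expr2.
    by rewrite -natr_sum sum_mem An.
  by lra.
have tot : #|X|%:R * (eta / 2) <= \sum_(l | k0%:R <= (online A l)%:R :> R) 1 * (online A l)%:R ^+ 2.
  rewrite mulr_natl -sumr_const.
  apply: le_trans (ler_sum _ (fun x hx => perx x hx)) _.
  apply: (@le_trans _ _ (\sum_x \sum_(c | (k0 <= online A (x, c))%N) (online A (x, c))%:R ^+ 2)).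
    rewrite [X in X <= _]big_mkcond /=; apply: ler_sum => x _; case: ifP => // _.
    by apply: sumr_ge0 => c _; apply: exprn_ge0.
  rewrite pair_big_dep /= le_eqVlt; apply/orP; left; apply/eqP.
  apply: eq_big => [[x c]|[x c] _] /=; [by rewrite ler_nat | by rewrite mul1r].
have K0 : 0 < k0%:R :> R by apply: lt_le_trans k0R.
have dy : \sum_(l | k0%:R <= (online A l)%:R :> R) 1 * (online A l)%:R ^+ 2
    <= 2 ^+ 2 * La%:R * (2 ^+ 18 * n%:R ^+ 5 * La%:R / k0%:R ^+ 2) :> R.
  apply: (@dyadic_sum R _ (fun l : 'F_p * 'F_p => (online A l)%:R) (fun _ => 1) 2 La k0%:R _ K0 (fun _ => ler01)) => [l | j jJ].
    have on : (online A l <= n)%N.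
      by rewrite -An; apply/subset_leq_card/fintype.subsetP => x; rewrite inE => /andP[].
    rewrite -natrX -natrM ltr_nat; apply: leq_ltn_trans on _.
    have nL : (n < 2 ^ La)%N.
      apply: leq_trans hLa; have : (n <= n ^ 18)%N by rewrite -[X in (X <= _)%N]expn1 leq_pexp2l // (leq_trans _ n4).
      by move: (n ^ 18)%N => w; clear - n4; lia.
    by apply: leq_trans nL _; rewrite leq_pmull // (leq_trans _ k02).
  pose k := (k0 * 2 ^ j)%N.
  have kE : k%:R = k0%:R * 2 ^+ j :> R by rewrite natrM natrX.
  have kk0 : (k0 <= k)%N by rewrite leq_pmulr // expn_gt0.
  rewrite sum_set_pred -kE.
  have -> : [set l | k%:R <= (online A l)%:R :> R] = rich A k by apply/finset.setP => l; rewrite !inE ler_nat.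
  have := @rich_bound R p A n La k pp An n4 La0 hLa (leq_trans k02 kk0) hp.
  have pk' : (2 * n ^ 2 <= p * k)%N by apply: leq_trans pk _; rewrite leq_mul2l kk0 orbT.
  move=> /(_ pk') h; rewrite ler_pdivlMr ?exprn_gt0 //.
  apply: le_trans h; have -> : k%:R ^+ 2 * #|rich A k|%:R * k0%:R ^+ 2 = #|rich A k|%:R * (k%:R ^+ 2 * k0%:R ^+ 2) :> R by ring.
  have -> : k%:R ^+ 4 = k%:R ^+ 2 * k%:R ^+ 2 :> R by ring.
  by rewrite ler_wpM2l // ler_wpM2l ?exprn_ge0 // lerXn2r ?nnegrE // ler_nat.
have {}tot := le_trans tot dy.
have ke2 : eta ^+ 2 <= 16 * n%:R ^+ 4 * k0%:R ^+ 2.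
  by apply: le_trans (ler_sqr_mono (ltW eta0) k0eta) _; rewrite le_eqVlt; apply/orP; left; apply/eqP; ring.
have -> : #|X|%:R * eta ^+ 3 = 2 * (#|X|%:R * (eta / 2)) * eta ^+ 2 :> R by field.
apply: (@le_trans _ _ (2 * (2 ^+ 2 * La%:R * (2 ^+ 18 * n%:R ^+ 5 * La%:R / k0%:R ^+ 2)) * (16 * n%:R ^+ 4 * k0%:R ^+ 2))).
  apply: ler_pM => //; first by rewrite mulr_ge0 // mulr_ge0 // ltW // divr_gt0.
    by rewrite exprn_ge0 // ltW.
  by rewrite ler_wpM2l.
rewrite le_eqVlt; apply/orP; left; apply/eqP; field.
by rewrite gt_eqF.
Qed.

(** * Triangles of popular ratios *)

Section Trace.
Variables (R : realType) (F : finFieldType) (r : F -> R).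
Hypotheses (r_ge0 : forall s, 0 <= r s) (r00 : r 0 = 0).
Local Notation e := (mulen r).

Lemma weighted_cs (T : finType) (w f : T -> R) : (forall i, 0 <= w i) ->
  (\sum_i w i * f i) ^+ 2 <= (\sum_i w i) * (\sum_i w i * f i ^+ 2).
Proof.
move=> w0; have := cauchy_schwarz (fun i => Num.sqrt (w i)) (fun i => Num.sqrt (w i) * f i).
have -> : \sum_i Num.sqrt (w i) * (Num.sqrt (w i) * f i) = \sum_i w i * f i.
  by apply: eq_bigr => i _; rewrite mulrA -expr2 sqr_sqrtr.
have -> : \sum_i Num.sqrt (w i) ^+ 2 = \sum_i w i by apply: eq_bigr => i _; rewrite sqr_sqrtr.
by under [X in _ * X]eq_bigr do rewrite exprMn sqr_sqrtr //.
Qed.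

Lemma e_ge0 x : 0 <= e x.
Proof. by apply: sumr_ge0 => s _; rewrite mulr_ge0. Qed.

Lemma mulen0 : e 0 = 0.
Proof. by rewrite /mulen big1 // => s _; rewrite mul0r r00 mulr0. Qed.

Lemma corr u t : u != 0 -> \sum_v r (v * u) * r (v * t) = e (t / u).
Proof.
move=> u0; rewrite /mulen [RHS](reindex_inj (mulIf u0)) /=; apply: eq_bigr => v _.
by rewrite mulrCA divfK // [t * v]mulrC.
Qed.

Lemma mulenV x : e x^-1 = e x.
Proof.
case: (eqVneq x 0) => [-> | x0]; first by rewrite invr0.
by rewrite -[x^-1]mul1r -corr // /mulen; apply: eq_bigr => s _; rewrite mulr1 mulrC [s * x]mulrC.
Qed.

Lemma mulen_ratio x y : x != 0 -> e (x / y) = \sum_w r (w / x) * r (w / y).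
Proof.
move=> x0; rewrite /mulen (reindex_inj (mulIf (_ : x^-1 != 0))) ?invr_eq0 //=.
by apply: eq_bigr => w _; rewrite mulrAC mulrCA mulfV // mulr1.
Qed.

Lemma sum_dilate (G : F -> F -> R) :
  \sum_s r s * (\sum_u G s u) = \sum_s r s * (\sum_x G s (x * s)).
Proof.
apply: eq_bigr => s _; case: (eqVneq s 0) => [-> | s0]; first by rewrite r00 !mul0r.
by rewrite [in LHS](reindex_inj (mulIf s0)).
Qed.

Variables (chi : pred F) (ep : R).
Hypothesis chiV : forall x, chi x^-1 = chi x.
Let ec x := if chi x then e x else 0.
Let eb x := if ep <= e x then e x else 0.
Let W := \sum_s r s.
Let D := \sum_x e x ^+ 2.
Hypotheses (ep0 : 0 <= ep) (hep : 8 * W ^+ 2 * ep <= D) (W0 : 0 < W) (D0 : 0 < D)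
  (hD : D <= 2 * \sum_(x | chi x) e x ^+ 2).

Let ec_ge0 x : 0 <= ec x.
Proof. by rewrite /ec; case: ifP => // _; apply: e_ge0. Qed.
Let ec_le x : ec x <= e x.
Proof. by rewrite /ec; case: ifP => // _; apply: e_ge0. Qed.
Let ecV u s : ec (u / s) = ec (s / u).
Proof. by rewrite /ec -[u / s]invrK invfM invrK mulrC chiV mulenV. Qed.

(** The weighted degree of s in the graph joining s and u when u / s satisfies [chi]. [M2] then
    weighs the paths of two edges, and [Tr] below the triangles over them. *)
Let g s := \sum_u r u * ec (u / s).
Let g_ge0 s : 0 <= g s.
Proof. by apply: sumr_ge0 => u _; rewrite mulr_ge0. Qed.
Let M2 := \sum_s r s * g s ^+ 2.

Let sum_g : \sum_s r s * g s = \sum_(x | chi x) e x ^+ 2.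
Proof.
rewrite /g (sum_dilate (fun s u => r u * ec (u / s))).
transitivity (\sum_s \sum_x r s * r (x * s) * ec x).
  apply: eq_bigr => s _; rewrite mulr_sumr; apply: eq_bigr => x _.
  by case: (eqVneq s 0) => [-> | s0]; rewrite ?r00 ?mul0r // mulfK // mulrA.
rewrite exchange_big [RHS]big_mkcond /=; apply: eq_bigr => x _.
by rewrite -mulr_suml -/(e x) /ec; case: ifP => _; rewrite ?mulr0 ?expr2.
Qed.

Let M2_ge : D ^+ 2 <= 4 * W * M2.
Proof.
have h := weighted_cs g r_ge0; rewrite sum_g -/W -/M2 in h.
have h2 : D ^+ 2 <= (2 * \sum_(x | chi x) e x ^+ 2) ^+ 2 by apply: ler_sqr_mono hD; apply: ltW.
by apply: le_trans h2 _; rewrite exprMn -natrX /= -mulrA ler_wpM2l.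
Qed.

Let h s v := \sum_u r u * ec (u / s) * r (v * u).
Let Tr := \sum_v \sum_s r s * h s v ^+ 2.

(** In [M2] enlarge one [ec] to e and open it as the correlation e (t / u) = sum_v r (v u) r (v t).
    Cauchy-Schwarz over v costs D, and over s with weights r it costs W. *)
Let trace_lower : M2 ^+ 2 <= D * (W * Tr).
Proof.
pose H v := \sum_u r u * g u * r (v * u).
have H1 : M2 <= \sum_v H v * e v.
  have -> : \sum_v H v * e v = \sum_u r u * (g u * \sum_t r t * e (t / u)).
    transitivity (\sum_v \sum_u \sum_t (r u * g u * r t) * (r (v * u) * r (v * t))).
      apply: eq_bigr => v _; rewrite /H mulr_suml; apply: eq_bigr => u _; rewrite /mulen mulr_sumr.
      by apply: eq_bigr => t _; ring.
    rewrite exchange_big; apply: eq_bigr => u _; rewrite exchange_big mulrA mulr_sumr; apply: eq_bigr => t _.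
    case: (eqVneq u 0) => [-> | u0]; last by rewrite -mulr_sumr corr // mulrA.
    by rewrite r00 !mul0r big1 // => v _; rewrite !mul0r.
  apply: ler_sum => u _; rewrite expr2 ler_wpM2l // ler_wpM2l //; apply: ler_sum => t _.
  by rewrite ler_wpM2l.
have M20 : 0 <= M2 by apply: sumr_ge0 => s _; rewrite mulr_ge0 ?exprn_ge0.
apply: le_trans (ler_sqr_mono M20 H1) _; apply: le_trans (cauchy_schwarz _ _) _.
rewrite mulrC ler_wpM2l ?(ltW D0) // /Tr mulr_sumr; apply: ler_sum => v _.
have -> : H v = \sum_s r s * h s v.
  rewrite /H /h; under [RHS]eq_bigr do rewrite mulr_sumr.
  rewrite exchange_big; apply: eq_bigr => u _; rewrite /g mulr_sumr mulr_suml; apply: eq_bigr => s _.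
  by rewrite ecV; ring.
exact: weighted_cs.
Qed.

Let C x y := \sum_s r s * (r (x * s) * r (y * s)).

(** Opening the square brings back e (t / u) as third edge. Edges below [ep] cost at most ep M2; the
    others are grouped by the ratios x = u / s and y = t / s. *)
Let trace_upper : Tr <= ep * M2 + \sum_x \sum_y C x y * (ec x * ec y * eb (y / x)).
Proof.
have TrE : Tr = \sum_s r s * (\sum_u \sum_t (r u * r t) * (ec (u / s) * ec (t / s)) * e (t / u)).
  rewrite /Tr exchange_big; apply: eq_bigr => s _; rewrite -mulr_sumr; congr (_ * _).
  transitivity (\sum_v \sum_u \sum_t (r u * r t * (ec (u / s) * ec (t / s))) * (r (v * u) * r (v * t))).
    apply: eq_bigr => v _; rewrite expr2 /h big_distrlr /=; apply: eq_bigr => u _; apply: eq_bigr => t _; ring.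
  rewrite exchange_big; apply: eq_bigr => u _; rewrite exchange_big; apply: eq_bigr => t _.
  case: (eqVneq u 0) => [-> | u0]; last by rewrite -mulr_sumr corr.
  by rewrite r00 !mul0r big1 // => v _; rewrite !mul0r.
have -> : ep * M2 = \sum_s r s * (\sum_u \sum_t (r u * r t) * (ec (u / s) * ec (t / s)) * ep).
  rewrite /M2 mulr_sumr; apply: eq_bigr => s _; rewrite mulrCA; congr (_ * _).
  rewrite expr2 /g big_distrlr mulr_sumr /=; apply: eq_bigr => u _; rewrite mulr_sumr; apply: eq_bigr => t _; ring.
have -> : \sum_x \sum_y C x y * (ec x * ec y * eb (y / x)) =
    \sum_s r s * (\sum_u \sum_t (r u * r t) * (ec (u / s) * ec (t / s)) * eb (t / u)).
  rewrite sum_dilate.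
  have -> : \sum_s r s * (\sum_x \sum_t (r (x * s) * r t) * (ec (x * s / s) * ec (t / s)) * eb (t / (x * s)))
     = \sum_s r s * (\sum_t \sum_x (r (x * s) * r t) * (ec (x * s / s) * ec (t / s)) * eb (t / (x * s))).
    by apply: eq_bigr => s _; rewrite exchange_big.
  rewrite sum_dilate /C.
  transitivity (\sum_s \sum_x \sum_y r s * (r (x * s) * r (y * s)) * (ec x * ec y * eb (y / x))).
    rewrite [RHS]exchange_big; apply: eq_bigr => x _; rewrite [RHS]exchange_big; apply: eq_bigr => y _.
    by rewrite mulr_suml.
  apply: eq_bigr => s _; rewrite mulr_sumr exchange_big; apply: eq_bigr => y _; rewrite mulr_sumr; apply: eq_bigr => x _.
  case: (eqVneq s 0) => [-> | s0]; first by rewrite r00 !mul0r.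
  have -> : y * s / (x * s) = y / x by rewrite invfM mulrACA mulfV // mulr1.
  by rewrite !mulfK //; ring.
rewrite TrE -big_split /=; apply: ler_sum => s _; rewrite -mulrDr ler_wpM2l // -big_split /=.
apply: ler_sum => u _; rewrite -big_split /=; apply: ler_sum => t _.
rewrite -mulrDr ler_wpM2l ?mulr_ge0 // /eb; case: (lerP ep (e (t / u))) => hh; first by rewrite ler_wpDl.
by rewrite addr0 ltW.
Qed.

(** Once the square is expanded over s and t, the sums over x and y separate, each giving e (t /
    s). *)
Let sum_C2 : \sum_x \sum_y C x y ^+ 2 = \sum_z e z ^+ 3.
Proof.
transitivity (\sum_s r s * \sum_t r t * e (t / s) ^+ 2).
  transitivity (\sum_s \sum_t r s * r t * ((\sum_x r (x * s) * r (x * t)) * (\sum_y r (y * s) * r (y * t)))).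
    transitivity (\sum_x \sum_y \sum_s \sum_t r s * r t * ((r (x * s) * r (x * t)) * (r (y * s) * r (y * t)))).
      apply: eq_bigr => x _; apply: eq_bigr => y _; rewrite expr2 /C big_distrlr /=.
      by apply: eq_bigr => s _; apply: eq_bigr => t _; ring.
    under eq_bigr do rewrite exchange_big.
    rewrite exchange_big; apply: eq_bigr => s _.
    under eq_bigr do rewrite exchange_big.
    rewrite exchange_big; apply: eq_bigr => t _; rewrite big_distrlr /= mulr_sumr.
    by apply: eq_bigr => x _; rewrite mulr_sumr.
  apply: eq_bigr => s _; rewrite mulr_sumr; apply: eq_bigr => t _.
  case: (eqVneq s 0) => [-> | s0]; first by rewrite r00 !mul0r.
  by rewrite corr // -expr2 mulrA.
rewrite (sum_dilate (fun s t => r t * e (t / s) ^+ 2)).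
transitivity (\sum_s \sum_z r s * r (z * s) * e z ^+ 2).
  apply: eq_bigr => s _; rewrite mulr_sumr; apply: eq_bigr => z _.
  by case: (eqVneq s 0) => [-> | s0]; rewrite ?r00 ?mul0r // mulfK // mulrA.
by rewrite exchange_big; apply: eq_bigr => z _; rewrite -mulr_suml -/(e z) exprS.
Qed.

(* The kernel e (s / s') is positive semidefinite: this bounds from below the number of triangles having two
   edges in chi, and by [hep] those whose third edge has e < ep are at most half of them. *)
Lemma triangle_bound : D ^+ 6 <= 32 ^+ 2 * W ^+ 6 * (\sum_z e z ^+ 3) *
  (\sum_x \sum_y (ec x ^+ 2 * ec y ^+ 2 * eb (y / x) ^+ 2)).
Proof.
set T1 := \sum_x \sum_y C x y * (ec x * ec y * eb (y / x)).
have cs : T1 ^+ 2 <= (\sum_z e z ^+ 3) * (\sum_x \sum_y (ec x ^+ 2 * ec y ^+ 2 * eb (y / x) ^+ 2)).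
  rewrite -sum_C2 /T1 !pair_big /=.
  have := cauchy_schwarz (fun z : F * F => C z.1 z.2) (fun z => ec z.1 * ec z.2 * eb (z.2 / z.1)).
  move/le_trans; apply; rewrite le_eqVlt; apply/orP; left; apply/eqP; congr (_ * _).
  by apply: eq_bigr => z _; ring.
have M20 : 0 < M2.
  have : 0 < 4 * W * M2 by apply: lt_le_trans M2_ge; rewrite exprn_gt0.
  by rewrite pmulr_rgt0 // mulr_gt0.
have up : M2 ^+ 2 <= D * (W * (ep * M2 + T1)).
  apply: le_trans trace_lower _; rewrite ler_wpM2l ?(ltW D0) // ler_wpM2l ?(ltW W0) //; exact: trace_upper.
have epb : 2 * (D * W * ep) <= M2.
  rewrite -(ler_pM2l (_ : 0 < 4 * W)) ?mulr_gt0 //; apply: le_trans M2_ge.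
  have -> : 4 * W * (2 * (D * W * ep)) = D * (8 * W ^+ 2 * ep) by ring.
  by rewrite expr2 ler_wpM2l // ltW.
have t1 : M2 <= 2 * (D * W * T1) / M2.
  rewrite ler_pdivlMr // -expr2.
  have := ler_wpM2r (ltW M20) epb; lra.
have t2 : M2 ^+ 2 <= 2 * D * W * T1 by move: t1; rewrite ler_pdivlMr // -expr2 => t; lra.
have t3 : D ^+ 3 <= 32 * W ^+ 3 * T1.
  rewrite -(ler_pM2l D0) -exprS.
  have s := ler_sqr_mono (exprn_ge0 2 (ltW D0)) M2_ge.
  have -> : D ^+ 4 = (D ^+ 2) ^+ 2 by ring.
  apply: le_trans s _; have -> : (4 * W * M2) ^+ 2 = 16 * W ^+ 2 * M2 ^+ 2 by ring.
  apply: le_trans (ler_wpM2l _ t2) _; first by rewrite mulr_ge0 ?exprn_ge0 ?(ltW W0).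
  by rewrite le_eqVlt; apply/orP; left; apply/eqP; ring.
have -> : D ^+ 6 = (D ^+ 3) ^+ 2 by ring.
apply: le_trans (ler_sqr_mono (exprn_ge0 3 (ltW D0)) t3) _.
have -> : (32 * W ^+ 3 * T1) ^+ 2 = 32 ^+ 2 * W ^+ 6 * T1 ^+ 2 by ring.
rewrite -[X in _ <= X]mulrA; apply: ler_wpM2l cs.
by apply: mulr_ge0; apply: exprn_ge0; [apply: ler0n | apply: ltW].
Qed.
End Trace.

(** The sum is that of the squares over z of sum_x r (z / x), and r (z / x) counts the pairs in A
    with x (t - a) = z: this is the energy of A with the n |X| lines t |-> x (t - a). *)
Lemma ratio_energy (R : realType) (p : nat) (A X : {set 'F_p}) (n La : nat) :
  prime p -> #|A| = n -> (4 <= n)%N -> (0 < La)%N -> log_dominates n La ->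
  0 \notin X -> (#|X| <= n ^ 2)%N -> (144 * (n * (n * #|X|) * La) <= p ^ 2)%N ->
  (\sum_(x in X) \sum_(y in X) mulen (rep0 R A) (x / y)) ^+ 2 <= 260 ^+ 2 * n%:R ^+ 6 * #|X|%:R ^+ 3 * La%:R.
Proof.
move=> pp An n4 La0 hLa X0 mn hp; set m := #|X| in mn hp *.
case: (posnP m) => [m0 | mp].
  have -> : X = finset.set0 by apply/eqP; rewrite -cards_eq0 -/m m0.
  by rewrite big_set0 m0 mulr0n [0 ^+ 3]exprS expr2 !mul0r mulr0 mul0r lexx.
have xX x : x \in X -> x != 0 by apply: contraTneq => ->.
pose f (u : 'F_p * 'F_p) := (u.1, - (u.1 * u.2)).
have fi : {in finset.setX X A &, injective f}.
  move=> [x c] [y b]; rewrite !finset.in_setX => /andP[xX' _] _ ee.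
  have e1 := congr1 fst ee; have e2 := congr1 snd ee; move: e1 e2; rewrite /f /fst /snd => e1; subst.
  by move/oppr_inj/(mulfI (xX _ xX')) => ->.
pose L := f @: finset.setX X A.
have Lc : #|L| = (n * m)%N by rewrite card_in_imset // cardsX An mulnC.
have sL (G : 'F_p * 'F_p -> R) : \sum_(l in L) G l = \sum_(x in X) \sum_(c in A) G (x, - (x * c)).
  rewrite big_imset //= pair_big /=; apply: eq_big => [[x c]|[x c] _] //=.
  by rewrite finset.in_setX.
have en : \sum_(x in X) \sum_(y in X) mulen (rep0 R A) (x / y) <= energy R A L.
  rewrite energyE; apply: (@le_trans _ _ (\sum_z (\sum_(x in X) rep0 R A (z / x)) ^+ 2)).
    rewrite le_eqVlt; apply/orP; left; apply/eqP.
    transitivity (\sum_(x in X) \sum_(y in X) \sum_z rep0 R A (z / x) * rep0 R A (z / y)).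
      by apply: eq_bigr => x hx; apply: eq_bigr => y hy; rewrite mulen_ratio // xX.
    under eq_bigr do rewrite exchange_big.
    by rewrite exchange_big; apply: eq_bigr => z _; rewrite expr2 big_distrlr.
  apply: ler_sum => z _; apply: ler_sqr_mono.
    by apply: sumr_ge0 => x _; apply: rep0_ge0.
  apply: (@le_trans _ _ (\sum_(x in X) rep R A (z / x))).
    by apply: ler_sum => x _; apply: rep0_le.
  rewrite [X in _ <= X]exchange_big /= sL /=; apply: ler_sum => x hx.
  rewrite [X in _ <= X]exchange_big /= /rep; apply: ler_sum => a aA.
  case: (boolP (_ \in A)) => h; last by apply: sumr_ge0.
  rewrite (bigD1 (a - z / x)) //= (_ : _ == _); last first.
    by apply/eqP; rewrite -mulrBr opprB addrC subrK mulrC divfK // xX.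
  by rewrite lerDl; apply: sumr_ge0.
(* A dual line contains either lines of a single slope x, at most n of them, or at most one for each
   x. As m <= n^2, k is at most the root [S], so 256 + 4 = 260. *)
pose k := maxn n m.
have hcol : collinear_le L k.
  move=> l0 l1 /imsetP[[x0 c0] + ->] /imsetP[[x1 c1] + ->]; rewrite !finset.in_setX.
  move=> /andP[x0X c0A] /andP[x1X c1A] ne; set T := [set l in L | _].
  case: (eqVneq x0 x1) => [ex | nx].
    apply: (@leq_trans n); last exact: leq_maxl.
    rewrite -An -(card_in_imset (f := fun c => f (x0, c)) (D := mem A)); last first.
      by move=> c c' _ _ ee; have := congr1 snd ee; rewrite /f /snd => /oppr_inj/(mulfI (xX _ x0X)).
    apply/subset_leq_card/fintype.subsetP => l; rewrite inE => /andP[/imsetP[[x c] + ->]].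
    rewrite finset.in_setX => /andP[hx cA]; move: ne; rewrite /f /fst /snd -ex => ne.
    rewrite subrr mulr0 mulf_eq0 => /orP[|]; last first.
      by rewrite subr_eq0 => /eqP ec; move: ne; rewrite -ec eqxx.
    by rewrite subr_eq0 => /eqP ->; apply/imsetP; exists c.
  apply: (@leq_trans m); last exact: leq_maxr.
  rewrite -(card_in_imset (f := fst) (D := mem T)).
    apply/subset_leq_card/fintype.subsetP => _ /imsetP[l + ->]; rewrite inE => /andP[/imsetP[[x c] + ->] _].
    by rewrite finset.in_setX => /andP[].
  move=> [a b] [a' b']; rewrite !inE => /andP[_ /eqP e1] /andP[_ /eqP e2]; rewrite /fst => ea; subst.
  move: e1; rewrite {}e2 /f /fst /snd => /(mulIf _) e1; congr pair.
  by have := e1 _; rewrite subr_eq0 eq_sym => /(_ nx)/addIr.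
have Ln : (n * #|L| <= n ^ 6)%N.
  rewrite Lc mulnA mulnn; apply: (@leq_trans (n ^ 2 * n ^ 2)); first by rewrite leq_mul2l mn orbT.
  by rewrite -expnD leq_pexp2l // (leq_trans _ n4).
have L0 : (0 < #|L|)%N by rewrite Lc muln_gt0 mp (leq_trans _ n4).
have := incidence_real R pp An n4 L0 La0 Ln hLa _ (leq_maxl n m) hcol; rewrite Lc => /(_ hp).
set S := Num.sqrt _ => inc.
have S2 : S ^+ 2 = n%:R ^+ 2 * m%:R * La%:R.
  by rewrite sqr_sqrtr ?ler0n // !natrM expr2 mulrA.
have m1 : 1 <= m%:R :> R by rewrite ler1n.
have La1 : 1 <= La%:R :> R by rewrite ler1n.
have n0 : 0 <= n%:R :> R by [].
have mn' : m%:R <= n%:R ^+ 2 :> R by rewrite -natrX ler_nat.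
have kS : k%:R <= S.
  rewrite -[k%:R]ger0_norm // -sqrtr_sqr; apply: ler_wsqrtr; rewrite !natrM.
  have N2 : 0 <= n%:R ^+ 2 :> R by rewrite exprn_ge0.
  have : n%:R ^+ 2 * m%:R <= n%:R * (n%:R * m%:R) * La%:R :> R.
    by rewrite mulrA -expr2 ler_peMr // mulr_ge0.
  apply: le_trans; rewrite /k /maxn; case: ifP => _; last by rewrite ler_peMr.
  by rewrite expr2 ler_wpM2r.
have S0 : 0 <= S by apply: sqrtr_ge0.
have fin : \sum_(x in X) \sum_(y in X) mulen (rep0 R A) (x / y) <= (n * (n * m))%:R * (260 * S).
  apply: le_trans en _; apply: le_trans inc _; rewrite ler_wpM2l //; lra.
apply: le_trans (ler_sqr_mono _ fin) _.
  by apply: sumr_ge0 => x _; apply: sumr_ge0 => y _; apply: mulen_ge0.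
rewrite !exprMn S2 !natrM le_eqVlt; apply/orP; left; apply/eqP; ring.
Qed.

(** * The power saving for the sum of squared energies *)

Section MainInequality.
Variables (R : realType) (p : nat) (A : {set 'F_p}) (n La : nat).
Hypotheses (An : #|A| = n) (n16 : (16 <= n)%N) (La0 : (0 < La)%N)
  (hLa : log_dominates n La).
Local Notation e := (mulen (rep0 R A)).
Local Notation N := (n%:R : R).
Local Notation L := (La%:R : R).
Let D : R := \sum_x e x ^+ 2.
Hypotheses (p2 : 64 * N ^+ 3 <= p%:R ^+ 2)
  (d1 : 32 * N ^+ 6 <= D) (d2 : 64 * N ^+ 8 <= p%:R * D) (d3 : 1152 * N ^+ 10 * L <= p%:R ^+ 2 * D).
Variables c1 c2 : R.
Hypotheses (c1ge : 1 <= c1) (c2ge : 1 <= c2).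
Hypothesis level : forall eta, 4 * N ^+ 2 <= eta -> 8 * N ^+ 4 <= p%:R * eta ->
  #|[set x | eta <= e x]|%:R * eta ^+ 3 <= c1 * N ^+ 9 * L ^+ 2.
Hypothesis ratio : forall X : {set 'F_p}, 0 \notin X -> (#|X| <= n ^ 2)%N ->
  (144 * (n * (n * #|X|) * La) <= p ^ 2)%N ->
  (\sum_(x in X) \sum_(y in X) e (x / y)) ^+ 2 <= c2 * N ^+ 6 * #|X|%:R ^+ 3 * L.

Let n4 : (4 <= n)%N. Proof. exact: leq_trans n16. Qed.
Let N16 : 16 <= N. Proof. by rewrite ler_nat. Qed.
Let N0 : 0 < N. Proof. by apply: lt_le_trans N16. Qed.
Let L1 : 1 <= L. Proof. by rewrite ler1n. Qed.
Let L0 : 0 < L. Proof. by rewrite ltr0n. Qed.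
Let c10 : 0 < c1. Proof. exact: lt_le_trans c1ge. Qed.
Let c20 : 0 < c2. Proof. exact: lt_le_trans c2ge. Qed.
Let NX k : 0 < N ^+ k. Proof. by rewrite exprn_gt0. Qed.
Let D0 : 0 < D. Proof. by apply: lt_le_trans d1; rewrite mulr_gt0. Qed.
Let ege0 x : 0 <= e x. Proof. exact: mulen_ge0. Qed.

(** The threshold permitted by the condition 8 W^2 ep <= D of [triangle_bound], since W <= N^2. *)
Let ep := D / (8 * N ^+ 4).
Let epE : ep * (8 * N ^+ 4) = D. Proof. by rewrite /ep divfK // mulf_neq0 // gt_eqF. Qed.
Let ep0 : 0 < ep. Proof. by rewrite divr_gt0 // mulr_gt0. Qed.
Let ep1 : 4 * N ^+ 2 <= ep.
Proof.
rewrite -(ler_pM2r (_ : 0 < 8 * N ^+ 4)) ?mulr_gt0 // epE.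
by apply: le_trans d1; rewrite le_eqVlt; apply/orP; left; apply/eqP; ring.
Qed.
Let ep2 : 8 * N ^+ 4 <= p%:R * ep.
Proof.
rewrite -(ler_pM2r (_ : 0 < 8 * N ^+ 4)) ?mulr_gt0 // -[X in _ <= X]mulrA epE.
by apply: le_trans d2; rewrite le_eqVlt; apply/orP; left; apply/eqP; ring.
Qed.

Let level_ep eta : ep <= eta -> #|[set x | eta <= e x]|%:R * eta ^+ 3 <= c1 * N ^+ 9 * L ^+ 2.
Proof.
by move=> h; apply: level; [apply: le_trans ep1 h | apply: le_trans ep2 _; rewrite ler_wpM2l].
Qed.

Let e_lt m : 1 <= m -> forall x, e x < m * 2 ^+ La.
Proof.
move=> m1 x; apply: (@le_lt_trans _ _ (N ^+ 3)); first by rewrite -An mulen_le3.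
apply: (@lt_le_trans _ _ (2 ^+ La)); last by rewrite ler_peMl ?exprn_ge0.
rewrite -!natrX ltr_nat; apply: leq_trans hLa.
have : (n ^ 3 <= n ^ 18)%N by rewrite leq_pexp2l // (leq_trans _ n16).
have : (0 < n ^ 18)%N by rewrite expn_gt0 (leq_trans _ n16).
by move: (n ^ 3)%N (n ^ 18)%N; clear; lia.
Qed.

Let N2_1 : 1 <= N ^+ 2. Proof. by apply: exprn_ege1; apply: le_trans N16; rewrite ler1n. Qed.

Lemma large_level_sum a m : (a <= 3)%N -> 4 * N ^+ 2 <= m -> 8 * N ^+ 4 <= p%:R * m ->
  (\sum_(x | m <= e x) e x ^+ a) * m ^+ (3 - a) <= 2 ^+ a * L * (c1 * N ^+ 9 * L ^+ 2).
Proof.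
move=> a3 m1 m2; have m0 : 0 < m by apply: lt_le_trans m1; rewrite mulr_gt0.
have mge1 : 1 <= m by apply: le_trans m1; have := N2_1; lra.
rewrite -ler_pdivlMr ?exprn_gt0 // -[X in _ <= X]mulrA.
have -> : \sum_(x | m <= e x) e x ^+ a = \sum_(x | m <= e x) 1 * e x ^+ a.
  by apply: eq_bigr => x _; rewrite mul1r.
apply: dyadic_sum => //; first exact: e_lt.
move=> j _; rewrite sum_set_pred ler_pdivlMr ?exprn_gt0 //; set eta := m * 2 ^+ j.
have me : m <= eta by rewrite /eta ler_peMr ?(ltW m0) // exprn_ege1 // ler1n.
apply: le_trans (level (le_trans m1 me) (le_trans m2 _)); last by rewrite ler_wpM2l.
have -> : eta ^+ 3 = eta ^+ a * eta ^+ (3 - a) by rewrite -exprD subnKC.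
rewrite [eta ^+ a * #|_|%:R]mulrC -mulrA ler_wpM2l // ler_wpM2l ?exprn_ge0 ?(le_trans (ltW m0) me) //.
by rewrite lerXn2r // nnegrE ?(ltW m0) // (le_trans (ltW m0) me).
Qed.

(** Cut at n^(5/2): below it, e^3 is at most n^5 e and e sums to at most n^4; above it, the level
    bound gives n^9 at every dyadic scale. *)
Let cubes : \sum_x e x ^+ 3 <= 9 * c1 * N ^+ 9 * L ^+ 3.
Proof.
pose m := Num.sqrt (N ^+ 5).
have m2 : m ^+ 2 = N ^+ 5 by rewrite sqr_sqrtr // ltW.
have m0 : 0 <= m by apply: sqrtr_ge0.
have ma : 4 * N ^+ 2 <= m.
  rewrite -[4 * N ^+ 2]ger0_norm ?mulr_ge0 ?(ltW (NX _)) // -sqrtr_sqr; apply: ler_wsqrtr.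
  have -> : (4 * N ^+ 2) ^+ 2 = 16 * N ^+ 4 by ring.
  by rewrite [N ^+ 5]exprS ler_wpM2r // ltW.
have mb : 8 * N ^+ 4 <= p%:R * m.
  rewrite -[8 * N ^+ 4]ger0_norm ?mulr_ge0 ?(ltW (NX _)) // -[p%:R * m]ger0_norm ?mulr_ge0 //.
  rewrite -!sqrtr_sqr; apply: ler_wsqrtr.
  have -> : (p%:R * m) ^+ 2 = p%:R ^+ 2 * N ^+ 5 by rewrite exprMn m2.
  have -> : (8 * N ^+ 4) ^+ 2 = 64 * N ^+ 3 * N ^+ 5 by ring.
  by rewrite ler_wpM2r // ltW.
rewrite (bigID (fun x => m <= e x)) /=.
have := large_level_sum (leqnn 3) ma mb; rewrite subnn expr0 mulr1 => h1.
have h2 : \sum_(x | ~~ (m <= e x)) e x ^+ 3 <= N ^+ 9.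
  apply: (@le_trans _ _ (\sum_x m ^+ 2 * e x)).
    rewrite big_mkcond /=; apply: ler_sum => x _; case: ifP => h; last by rewrite mulr_ge0 ?exprn_ge0.
    rewrite exprSr ler_wpM2r //; apply: ler_sqr_mono => //; by rewrite ltW // ltNge.
  rewrite -mulr_sumr m2; have -> : N ^+ 9 = N ^+ 5 * N ^+ 4 by ring.
  by rewrite ler_wpM2l ?(ltW (NX _)) // -An sum_mulen.
have h3 : N ^+ 9 <= c1 * N ^+ 9 * L ^+ 3.
  have -> : c1 * N ^+ 9 * L ^+ 3 = (c1 * L ^+ 3) * N ^+ 9 by ring.
  by rewrite ler_peMl ?(ltW (NX _)) // mulr_ege1 // exprn_ege1.
have -> : 9 * c1 * N ^+ 9 * L ^+ 3 = 2 ^+ 3 * L * (c1 * N ^+ 9 * L ^+ 2) + c1 * N ^+ 9 * L ^+ 3 by ring.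
by apply: lerD => //; apply: le_trans h3.
Qed.

Let small_sum m : 0 <= m -> \sum_(x | e x < m) e x ^+ 2 <= m * N ^+ 4.
Proof.
move=> m0; apply: (@le_trans _ _ (\sum_x m * e x)); last by rewrite -mulr_sumr ler_wpM2l // -An sum_mulen.
rewrite big_mkcond /=; apply: ler_sum => x _; case: ifP => h; last by rewrite mulr_ge0.
by rewrite expr2 ler_wpM2r // ltW.
Qed.

(** By the level bound the values e >= tau contribute at most 4 c1 N^9 L^3 / tau = D / 4. *)
Let tau := 16 * c1 * N ^+ 9 * L ^+ 3 / D.
Let tauD : tau * D = 16 * c1 * N ^+ 9 * L ^+ 3. Proof. by rewrite /tau divfK // gt_eqF. Qed.
Let tau0 : 0 < tau. Proof. by rewrite divr_gt0 // !mulr_gt0 ?exprn_gt0. Qed.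

Let ep_tau : ep <= tau.
Proof.
have s1 : \sum_(x | e x < 2 * ep) e x ^+ 2 <= D / 4.
  apply: le_trans (small_sum _) _; first by rewrite mulr_ge0 // ltW.
  by rewrite -[in D / 4]epE le_eqVlt; apply/orP; left; apply/eqP; field.
have e2 : ep <= 2 * ep by have := ep0; lra.
have := @large_level_sum 2 (2 * ep) isT (le_trans ep1 e2); rewrite subSnn expr1 => h.
have {}h := h (le_trans ep2 (ler_wpM2l (ler0n R p) e2)).
have dd : D <= D / 4 + \sum_(x | 2 * ep <= e x) e x ^+ 2.
  rewrite {1}/D (bigID (fun x => e x < 2 * ep)) /=; apply: lerD => //.
  by rewrite le_eqVlt; apply/orP; left; apply/eqP; apply: eq_bigl => x; rewrite -leNgt.
rewrite -(ler_pM2r D0) tauD.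
have h' : (D - D / 4) * (2 * ep) <= 2 ^+ 2 * L * (c1 * N ^+ 9 * L ^+ 2).
  apply: le_trans h; apply: ler_wpM2r; first by rewrite mulr_ge0 // ltW.
  by rewrite lerBlDr addrC.
have c0 : 0 <= c1 * N ^+ 9 * L ^+ 3 by rewrite !mulr_ge0 // ?ltW // exprn_gt0.
have -> : ep * D = 2 / 3 * ((D - D / 4) * (2 * ep)) by field.
apply: (@le_trans _ _ (2 / 3 * (2 ^+ 2 * L * (c1 * N ^+ 9 * L ^+ 2)))); first by rewrite ler_wpM2l.
have -> : 2 / 3 * (2 ^+ 2 * L * (c1 * N ^+ 9 * L ^+ 2)) = 8 / 3 * (c1 * N ^+ 9 * L ^+ 3) by field.
have -> : 16 * c1 * N ^+ 9 * L ^+ 3 = 16 * (c1 * N ^+ 9 * L ^+ 3) by ring.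
by move: c0; lra.
Qed.

(** The values below 2 ep contribute at most 2 ep N^4 = D / 4, and those from tau on at most D / 4,
    so half of D remains. *)
Let chi : pred 'F_p := fun x => (2 * ep <= e x) && (e x < tau).
Let chiV x : chi x^-1 = chi x.
Proof. by rewrite /chi mulenV. Qed.

Let medium : D <= 2 * \sum_(x | chi x) e x ^+ 2.
Proof.
have s1 : \sum_(x | e x < 2 * ep) e x ^+ 2 <= D / 4.
  apply: le_trans (small_sum _) _; first by rewrite mulr_ge0 // ltW.
  by rewrite -[in D / 4]epE le_eqVlt; apply/orP; left; apply/eqP; field.
have s2 : \sum_(x | tau <= e x) e x ^+ 2 <= D / 4.
  have := @large_level_sum 2 tau isT (le_trans ep1 ep_tau) (le_trans ep2 (ler_wpM2l (ler0n R p) ep_tau)).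
  rewrite subSnn expr1 => h; rewrite -(ler_pM2r tau0); apply: le_trans h _.
  have -> : D / 4 * tau = (tau * D) / 4 by field.
  by rewrite tauD le_eqVlt; apply/orP; left; apply/eqP; field.
have : D <= \sum_(x | e x < 2 * ep) e x ^+ 2 + \sum_(x | tau <= e x) e x ^+ 2 + \sum_(x | chi x) e x ^+ 2.
  rewrite {1}/D [\sum_(x | e x < _) _]big_mkcond [\sum_(x | tau <= _) _]big_mkcond [\sum_(x | chi x) _]big_mkcond -!big_split /=; apply: ler_sum => x _.
  have e20 : 0 <= e x ^+ 2 by apply: exprn_ge0.
  rewrite /chi; case: (ltP (e x) (2 * ep)) => h1 /=; last case: (leP tau (e x)) => h2 /=;
    do ?[case: (leP tau (e x)) => h3 /=]; lra.
by lra.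
Qed.

Let X := [set x | chi x].

Let card_level eta (Z : {set 'F_p}) : (forall z, z \in Z -> eta <= e z) -> eta * #|Z|%:R <= N ^+ 4.
Proof.
move=> h; apply: (@le_trans _ _ (\sum_x e x)); last by rewrite -An sum_mulen.
rewrite -[eta * _]mulrC mulr_natl -sumr_const big_mkcond /=; apply: ler_sum => x _.
by case: ifP => // /h.
Qed.

Let ratio_level (Z : {set 'F_p}) : (forall z, z \in Z -> ep <= e z) ->
  (\sum_(x in Z) \sum_(y in Z) e (x / y)) ^+ 2 <= c2 * N ^+ 6 * #|Z|%:R ^+ 3 * L.
Proof.
move=> h; have hc := card_level h.
have hc' : D * #|Z|%:R <= 8 * N ^+ 8.
  have -> : D * #|Z|%:R = 8 * N ^+ 4 * (ep * #|Z|%:R) by rewrite -epE; ring.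
  apply: le_trans (ler_wpM2l _ hc) _; first by rewrite mulr_ge0 // ltW.
  by rewrite le_eqVlt; apply/orP; left; apply/eqP; ring.
apply: ratio.
- apply/negP => /h; rewrite mulen0 ?/rep0 ?eqxx // => h0.
  by have := lt_le_trans ep0 h0; rewrite ltxx.
- rewrite -(ler_nat R) natrX -(ler_pM2l D0); apply: le_trans hc' _.
  apply: (@le_trans _ _ (32 * N ^+ 6 * N ^+ 2)); last by rewrite ler_wpM2r // ltW.
  have -> : 32 * N ^+ 6 * N ^+ 2 = 32 * N ^+ 8 by ring.
  by rewrite ler_wpM2r ?(ltW (NX _)) // ler_nat.
- rewrite -(ler_nat R) natrX -(ler_pM2r D0) !natrM.
  apply: (@le_trans _ _ (144 * N ^+ 2 * L * (D * #|Z|%:R))); first by rewrite le_eqVlt; apply/orP; left; apply/eqP; ring.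
  apply: le_trans (ler_wpM2l _ hc') _; first by rewrite !mulr_ge0 // ltW.
  by apply: le_trans d3; rewrite le_eqVlt; apply/orP; left; apply/eqP; ring.
Qed.

(** By Cauchy-Schwarz for the Gram kernel e (x / z), the mixed sum reduces to the sums over X x X
    and Z x Z. *)
Let ratio_pair (Z : {set 'F_p}) : (forall z, z \in Z -> ep <= e z) ->
  (\sum_(z in Z) \sum_(x in X) e (x / z)) ^+ 4 <= c2 ^+ 2 * N ^+ 12 * #|X|%:R ^+ 3 * #|Z|%:R ^+ 3 * L ^+ 2.
Proof.
move=> hZ; have hX z : z \in X -> ep <= e z.
  by rewrite inE => /andP[h _]; apply: le_trans h; have := ep0; lra.
have nz (S : {set 'F_p}) : (forall z, z \in S -> ep <= e z) -> forall z, z \in S -> z != 0.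
  move=> hS z zS; apply: contraTneq (hS z zS) => ->.
  by rewrite mulen0 ?/rep0 ?eqxx // -ltNge.
have G (S T : {set 'F_p}) : (forall z, z \in S -> ep <= e z) ->
    \sum_(z in T) \sum_(x in S) e (x / z) = \sum_w (\sum_(x in S) rep0 R A (w / x)) * (\sum_(z in T) rep0 R A (w / z)).
  move=> hS; rewrite exchange_big /=.
  transitivity (\sum_(x in S) \sum_(z in T) \sum_w rep0 R A (w / x) * rep0 R A (w / z)).
    by apply: eq_bigr => x xS; apply: eq_bigr => z _; rewrite mulen_ratio // (nz S).
  rewrite [LHS](eq_bigr _ (fun x _ => exchange_big _ _ _ _ _ _)) [LHS]exchange_big /=.
  by apply: eq_bigr => w _; rewrite big_distrlr.
have cs := cauchy_schwarz (fun w => \sum_(x in X) rep0 R A (w / x)) (fun w => \sum_(z in Z) rep0 R A (w / z)).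
rewrite -(G X Z hX) in cs.
have sq (S : {set 'F_p}) : (forall z, z \in S -> ep <= e z) ->
    \sum_w (\sum_(x in S) rep0 R A (w / x)) ^+ 2 = \sum_(x in S) \sum_(y in S) e (x / y).
  by move=> hS; rewrite [RHS]exchange_big (G S S hS); apply: eq_bigr => w _; rewrite expr2.
rewrite (sq X hX) (sq Z hZ) in cs.
have -> (t : R) : t ^+ 4 = (t ^+ 2) ^+ 2 by rewrite -exprM.
apply: le_trans (ler_sqr_mono (sqr_ge0 _) cs) _; rewrite exprMn.
have -> : c2 ^+ 2 * N ^+ 12 * #|X|%:R ^+ 3 * #|Z|%:R ^+ 3 * L ^+ 2 =
  (c2 * N ^+ 6 * #|X|%:R ^+ 3 * L) * (c2 * N ^+ 6 * #|Z|%:R ^+ 3 * L) by ring.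
by apply: ler_pM; rewrite ?sqr_ge0 // ratio_level.
Qed.

Let q := Num.sqrt (Num.sqrt (512 * c2 ^+ 2 * c1 ^+ 3 * N ^+ 67 * L ^+ 8)).
Let q4 : q ^+ 4 = 512 * c2 ^+ 2 * c1 ^+ 3 * N ^+ 67 * L ^+ 8.
Proof.
have pos : 0 <= 512 * c2 ^+ 2 * c1 ^+ 3 * N ^+ 67 * L ^+ 8.
  apply: mulr_ge0 (exprn_ge0 _ (ltW L0)); apply: mulr_ge0 (exprn_ge0 _ (ltW N0)).
  by apply: mulr_ge0 (exprn_ge0 _ (ltW c10)); apply: mulr_ge0 (ler0n R 512) (exprn_ge0 _ (ltW c20)).
have -> (t : R) : t ^+ 4 = (t ^+ 2) ^+ 2 by rewrite -exprM.
by rewrite (sqr_sqrtr (sqrtr_ge0 _)) (sqr_sqrtr pos).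
Qed.
Let q0 : 0 <= q. Proof. exact: sqrtr_ge0. Qed.

Let w z := \sum_(x in X) e (x / z).

(** In fourth powers, |Z|^3 is at most of order eta^(-9) by the level bound and |X|^3 at most N^12
    (2 ep)^(-3). Of the nine factors eta, eight form (eta^2)^4 and the ninth is lowered to ep, which
    completes D^4 = (8 N^4 ep)^4. The product of the constants is q^4. *)
Let level_mass eta : ep <= eta -> eta ^+ 2 * \sum_(z | eta <= e z) w z <= q / D.
Proof.
move=> he; have eta0 : 0 < eta by apply: lt_le_trans he.
pose Z := [set z | eta <= e z].
have -> : \sum_(z | eta <= e z) w z = \sum_(z in Z) w z by apply: eq_bigl => z; rewrite inE.
have hZ z : z \in Z -> ep <= e z by rewrite inE; apply: le_trans.
have := ratio_pair hZ; rewrite -/(w _); set G := \sum_(z in Z) _ => hG.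
have G0 : 0 <= G by apply: sumr_ge0 => z _; apply: sumr_ge0.
rewrite ler_pdivlMr // -(@ler_pXn2r _ 4) ?nnegrE // ?mulr_ge0 ?exprn_ge0 ?(ltW eta0) ?(ltW D0) //.
rewrite q4 -epE.
have hz : #|Z|%:R ^+ 3 * eta ^+ 9 <= c1 ^+ 3 * N ^+ 27 * L ^+ 6.
  have := level_ep he; rewrite -/Z => h.
  have -> : #|Z|%:R ^+ 3 * eta ^+ 9 = (#|Z|%:R * eta ^+ 3) ^+ 3 by ring.
  have -> : c1 ^+ 3 * N ^+ 27 * L ^+ 6 = (c1 * N ^+ 9 * L ^+ 2) ^+ 3 by ring.
  by rewrite lerXn2r // nnegrE ?(le_trans _ h) // mulr_ge0 ?exprn_ge0 // ltW.
have hx : #|X|%:R ^+ 3 * (2 * ep) ^+ 3 <= N ^+ 12.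
  have -> : N ^+ 12 = (N ^+ 4) ^+ 3 by ring.
  have h : 2 * ep * #|X|%:R <= N ^+ 4 by apply: card_level => z; rewrite inE => /andP[].
  have h0 : 0 <= 2 * ep * #|X|%:R by rewrite mulr_ge0 // mulr_ge0 // ltW.
  by rewrite -exprMn mulrC lerXn2r // nnegrE (le_trans h0).
have e1 : ep * (2 * ep) ^+ 3 * eta ^+ 8 * G ^+ 4 <= c2 ^+ 2 * c1 ^+ 3 * N ^+ 51 * L ^+ 8.
  apply: (@le_trans _ _ (eta * (2 * ep) ^+ 3 * eta ^+ 8 * (c2 ^+ 2 * N ^+ 12 * #|X|%:R ^+ 3 * #|Z|%:R ^+ 3 * L ^+ 2))).
    have ep2' : 0 <= (2 * ep) ^+ 3 by rewrite exprn_ge0 // mulr_ge0 // ltW.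
    have eta8 : 0 <= eta ^+ 8 by rewrite exprn_ge0 // ltW.
    apply: ler_pM hG; last by rewrite ler_wpM2r // ler_wpM2r.
      by rewrite mulr_ge0 // mulr_ge0 // ltW.
    by rewrite exprn_ge0.
  have -> : eta * (2 * ep) ^+ 3 * eta ^+ 8 * (c2 ^+ 2 * N ^+ 12 * #|X|%:R ^+ 3 * #|Z|%:R ^+ 3 * L ^+ 2)
    = (c2 ^+ 2 * N ^+ 12 * L ^+ 2) * ((#|X|%:R ^+ 3 * (2 * ep) ^+ 3) * (#|Z|%:R ^+ 3 * eta ^+ 9)) by ring.
  have -> : c2 ^+ 2 * c1 ^+ 3 * N ^+ 51 * L ^+ 8 = (c2 ^+ 2 * N ^+ 12 * L ^+ 2) * (N ^+ 12 * (c1 ^+ 3 * N ^+ 27 * L ^+ 6)) by ring.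
  rewrite ler_wpM2l ?mulr_ge0 ?exprn_ge0 ?(ltW c20) ?(ltW N0) ?(ltW L0) //.
  apply: ler_pM hx hz; apply: mulr_ge0; rewrite exprn_ge0 // ?(ltW eta0) //.
  by rewrite mulr_ge0 // ltW.
have -> : (eta ^+ 2 * G * (ep * (8 * N ^+ 4))) ^+ 4 = 512 * N ^+ 16 * (ep * (2 * ep) ^+ 3 * eta ^+ 8 * G ^+ 4) by ring.
apply: le_trans (ler_wpM2l (mulr_ge0 (ler0n R 512) (ltW (NX 16))) e1) _.
by rewrite le_eqVlt; apply/orP; left; apply/eqP; ring.
Qed.

Let weighted_levels : \sum_(z | ep <= e z) w z * e z ^+ 2 <= 4 * L * (q / D).
Proof.
have -> : 4 = 2 ^+ 2 :> R by rewrite -natrX.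
apply: dyadic_sum => //; first by move=> t; apply: sumr_ge0.
  by apply: e_lt; apply: le_trans ep1; have := N2_1; lra.
by move=> j _; apply: level_mass; rewrite ler_peMr ?(ltW ep0) // exprn_ege1 // ler1n.
Qed.

Let ec x := if chi x then e x else 0.
Let eb x := if ep <= e x then e x else 0.

(** Three of the four factors [ec] are bounded by tau; the fourth stays as e (y), and y = x / z
    turns the sum over x in X into w (z). *)
Let middle : \sum_x \sum_y (ec x ^+ 2 * ec y ^+ 2 * eb (y / x) ^+ 2) <= tau ^+ 3 * (4 * L * (q / D)).
Proof.
have ect x : ec x <= tau by rewrite /ec /chi; case: ifP => [/andP[_ /ltW] // | _]; apply: ltW.
have ec0 x : 0 <= ec x by rewrite /ec; case: ifP.
have ece x : ec x <= e x by rewrite /ec; case: ifP.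
have ebV z : eb z^-1 = eb z by rewrite /eb mulenV.
apply: le_trans (ler_wpM2l _ weighted_levels); last by rewrite exprn_ge0 // ltW.
apply: (@le_trans _ _ (\sum_(x in X) \sum_y tau ^+ 3 * (e y * eb (y / x) ^+ 2))).
  rewrite [X in _ <= X]big_mkcond /=; apply: ler_sum => x _; rewrite inE.
  case: (boolP (chi x)) => hx; last first.
    by rewrite big1 // => y _; rewrite /ec (negPf hx) expr0n /= !mul0r.
  apply: ler_sum => y _.
  have -> : tau ^+ 3 * (e y * eb (y / x) ^+ 2) = tau ^+ 2 * (tau * e y) * eb (y / x) ^+ 2 by ring.
  rewrite ler_wpM2r ?sqr_ge0 //; apply: ler_pM; rewrite ?sqr_ge0 //; first exact: ler_sqr_mono.
  by rewrite expr2 ler_pM.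
rewrite [X in X <= _]big_mkcond /=.
have -> : \sum_x (if x \in X then \sum_y tau ^+ 3 * (e y * eb (y / x) ^+ 2) else 0) =
    \sum_(x in X) \sum_z tau ^+ 3 * (e (x / z) * eb z ^+ 2).
  rewrite [RHS]big_mkcond /=; apply: eq_bigr => x _; case: ifP => // xX.
  have x0 : x != 0.
    apply: contraTneq xX => ->; rewrite inE /chi mulen0 ?/rep0 ?eqxx //.
    by rewrite leNgt mulr_gt0.
  rewrite (reindex_inj (inj_comp (mulfI x0) (@invr_inj _))) /=; apply: eq_bigr => z _.
  by rewrite [x / z]mulrC mulfK // ebV mulrC.
rewrite le_eqVlt; apply/orP; left; apply/eqP; rewrite [LHS]exchange_big [RHS]mulr_sumr [RHS]big_mkcond /=.
apply: eq_bigr => z _; rewrite -mulr_sumr -mulr_suml -/(w z) /eb.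
by case: ifP => // _; rewrite expr0n /= !mulr0.
Qed.

(** Multiplied by D^4, [triangle_bound] loses its denominators: tau D is of order N^9 L^3, so D^10
    is at most of order N^(12 + 9 + 27) L^13 q. As q^4 is of order N^67 L^8, the fourth power has
    exponents 4 * 48 + 67 = 259 and 4 * 13 + 8 = 60. *)
Lemma main_inequality : D ^+ 40 <=
  (32 ^+ 2 * 9 * 4 * 16 ^+ 3 * c1 ^+ 4) ^+ 4 * (512 * c2 ^+ 2 * c1 ^+ 3) * N ^+ 259 * L ^+ 60.
Proof.
have W0 : 0 < \sum_s rep0 R A s.
  rewrite lt_neqAle sumr_ge0 ?andbT => [|s _]; last exact: rep0_ge0.
  apply/eqP => /esym/eqP; rewrite psumr_eq0 => [/allP h | s _]; last exact: rep0_ge0.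
  have z s : rep0 R A s = 0 by have := h s; rewrite mem_index_enum => /(_ isT)/eqP.
  move: D0; rewrite /D big1 ?ltxx // => x _; rewrite /mulen big1 ?expr0n // => s _; by rewrite z mul0r.
have WN : \sum_s rep0 R A s <= N ^+ 2 by rewrite -An -sum_rep; apply: ler_sum => s _; apply: rep0_le.
have hep : 8 * (\sum_s rep0 R A s) ^+ 2 * ep <= D.
  apply: (@le_trans _ _ (8 * N ^+ 4 * ep)); last by rewrite mulrC epE.
  rewrite ler_wpM2r ?(ltW ep0) // ler_wpM2l //.
  by have := ler_sqr_mono (ltW W0) WN; rewrite -exprM.
have r00 : rep0 R A 0 = 0 by rewrite /rep0 eqxx.
have := @triangle_bound R _ (rep0 R A) (rep0_ge0 R A) r00 chi ep chiV (ltW ep0) hep W0 D0 medium.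
rewrite -/D -/(ec _) -/(eb _) => T.
have {}T : D ^+ 6 <= 32 ^+ 2 * N ^+ 12 * (9 * c1 * N ^+ 9 * L ^+ 3) * (tau ^+ 3 * (4 * L * (q / D))).
  have Cp : 0 <= \sum_x e x ^+ 3 by apply: sumr_ge0 => x _; apply: exprn_ge0.
  have t0 : 0 <= (32 ^+ 2 : R) by exact: sqr_ge0.
  have Wp : 0 <= 32 ^+ 2 * (\sum_s rep0 R A s) ^+ 6 by apply: mulr_ge0 => //; rewrite exprn_ge0 // ltW.
  apply: le_trans T _; apply: ler_pM middle; first exact: mulr_ge0.
    by apply: sumr_ge0 => x _; apply: sumr_ge0 => y _; apply: mulr_ge0; [apply: mulr_ge0 | ]; exact: sqr_ge0.
  apply: ler_pM cubes => //; apply: ler_wpM2l => //.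
  have -> : N ^+ 12 = (N ^+ 2) ^+ 6 by rewrite -exprM.
  by rewrite lerXn2r // nnegrE ?(ltW W0) // ltW.
have T2 : D ^+ 10 <= (32 ^+ 2 * 9 * 4 * 16 ^+ 3 * c1 ^+ 4) * N ^+ 48 * L ^+ 13 * q.
  have -> : D ^+ 10 = D ^+ 6 * D ^+ 4 by rewrite -exprD.
  apply: le_trans (ler_wpM2r _ T) _; first by rewrite exprn_ge0 // ltW.
  have -> : 32 ^+ 2 * N ^+ 12 * (9 * c1 * N ^+ 9 * L ^+ 3) * (tau ^+ 3 * (4 * L * (q / D))) * D ^+ 4
     = 32 ^+ 2 * N ^+ 12 * (9 * c1 * N ^+ 9 * L ^+ 3) * ((tau * D) ^+ 3 * (4 * L * q)).
    by field; rewrite gt_eqF.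
  by rewrite tauD le_eqVlt; apply/orP; left; apply/eqP; ring.
have T4 : (D ^+ 10) ^+ 4 <= ((32 ^+ 2 * 9 * 4 * 16 ^+ 3 * c1 ^+ 4) * N ^+ 48 * L ^+ 13 * q) ^+ 4.
  have d10 : 0 <= D ^+ 10 by rewrite exprn_ge0 // ltW.
  by rewrite lerXn2r // nnegrE (le_trans d10).
rewrite -exprM in T4; apply: le_trans T4 _.
move: (32 ^+ 2 * 9 * 4 * 16 ^+ 3 * c1 ^+ 4) => K; rewrite exprMn q4.
have -> : (K * N ^+ 48 * L ^+ 13) ^+ 4 = K ^+ 4 * (N ^+ 48) ^+ 4 * (L ^+ 13) ^+ 4 by rewrite !exprMn.
rewrite -!exprM; have -> : N ^+ 259 = N ^+ (48 * 4) * N ^+ 67 by rewrite -exprD.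
have -> : L ^+ 60 = L ^+ (13 * 4) * L ^+ 8 by rewrite -exprD.
move: (N ^+ (48 * 4)) (N ^+ 67) (L ^+ (13 * 4)) (L ^+ 8) (512 * c2 ^+ 2 * c1 ^+ 3) => a1 a2 a3 a4 a5.
by rewrite le_eqVlt; apply/orP; left; apply/eqP; ring.
Qed.
End MainInequality.

(** * From products of differences to the multiplicative energy *)

Section DifferenceProducts.
Variables (R : realType) (p : nat) (A : {set 'F_p}).
Local Notation F := 'F_p.
Local Notation N := (#|A|%:R : R).
Local Notation r := (rep R A).
Local Notation r0 := (rep0 R A).

Definition prod_rep (l : F) : R := \sum_(s : F) \sum_(t : F) r s * r t * (s * t == l)%:R.

Lemma sum_differences (g : F -> R) :
  \sum_(a in A) \sum_(b in A) g (a - b) = \sum_s r s * g s.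
Proof.
transitivity (\sum_(a in A) \sum_s ((a - s)%R \in A)%:R * g s).
  apply: eq_bigr => a _; rewrite sum_in (reindex_inj (inv_inj (_ : involutive (fun s => a - s)))) /=.
    by apply: eq_bigr => s _; rewrite subKr.
  by move=> s; rewrite subKr.
by rewrite exchange_big; apply: eq_bigr => s _; rewrite -mulr_suml.
Qed.

Lemma prod_repE l : prod_rep l =
  \sum_(a1 in A) \sum_(a2 in A) \sum_(a3 in A) \sum_(a4 in A) ((a1 - a2) * (a3 - a4) == l)%R%:R.
Proof.
rewrite (sum_differences (fun s => \sum_(a3 in A) \sum_(a4 in A) (s * (a3 - a4) == l)%R%:R)).
apply: eq_bigr => s _; rewrite (sum_differences (fun t => (s * t == l)%R%:R)) mulr_sumr.
by apply: eq_bigr => t _; rewrite mulrA.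
Qed.

Lemma Dtimes_prod_rep : (Dtimes A)%:R = \sum_l prod_rep l ^+ 2.
Proof.
pose B : pred (F * F * F * F) := fun u => [&& u.1.1.1 \in A, u.1.1.2 \in A, u.1.2 \in A & u.2 \in A].
pose P (u : F * F * F * F) := (u.1.1.1 - u.1.1.2) * (u.1.2 - u.2).
have prE l : prod_rep l = \sum_(u | B u) (P u == l)%:R.
  rewrite prod_repE !pair_big /=; apply: eq_big => [[[[a b] c] d]|[[[a b] c] d] _] //=.
  by rewrite /B /= !andbA.
transitivity (\sum_(u | B u) \sum_(v | B v) (P u == P v)%:R : R).
  rewrite pair_big /= /Dtimes -sum1_card natr_sum big_mkcond [RHS]big_mkcond /=.
  apply: eq_bigr => -[[[[a b] c] d] [[[a' b'] c'] d']] _; rewrite inE /B /P /= -!andbA.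
  by do 8![case: (_ \in A) => //=]; case: (_ == _).
under [RHS]eq_bigr do rewrite prE expr2 big_distrlr /=.
rewrite [RHS]exchange_big; apply: eq_bigr => u _; rewrite [RHS]exchange_big; apply: eq_bigr => v _.
by rewrite /= sum_delta.
Qed.

Lemma prod_rep_ge0 l : 0 <= prod_rep l.
Proof.
by apply: sumr_ge0 => s _; apply: sumr_ge0 => t _; rewrite mulr_ge0 ?ler0n // mulr_ge0 ?rep_ge0.
Qed.

Lemma sum_prod_rep : \sum_l prod_rep l = N ^+ 4.
Proof.
rewrite /prod_rep exchange_big /=.
have -> : N ^+ 4 = (\sum_s r s) * \sum_s r s by rewrite sum_rep; ring.
rewrite mulr_suml; apply: eq_bigr => s _; rewrite exchange_big mulr_sumr; apply: eq_bigr => t _ /=.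
by rewrite -mulr_sumr (bigD1 (s * t)) //= eqxx big1 ?addr0 ?mulr1 // => z /negPf; rewrite eq_sym => ->.
Qed.

Lemma Dtimes_le8 : (Dtimes A)%:R <= N ^+ 8.
Proof.
rewrite Dtimes_prod_rep; have -> : N ^+ 8 = N ^+ 4 * N ^+ 4 by ring.
rewrite -[X in X * _]sum_prod_rep mulr_suml; apply: ler_sum => l _.
rewrite expr2 ler_wpM2l ?prod_rep_ge0 // -sum_prod_rep (bigD1 l) //= lerDl.
by apply: sumr_ge0 => k _; apply: prod_rep_ge0.
Qed.

Lemma prod_rep0 : prod_rep 0 <= 2 * N ^+ 3.
Proof.
apply: (@le_trans _ _ (\sum_s \sum_t (r s * r t * (s == 0)%:R + r s * r t * (t == 0)%:R))).
  apply: ler_sum => s _; apply: ler_sum => t _; rewrite -mulrDr ler_wpM2l ?mulr_ge0 ?rep_ge0 // mulf_eq0.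
  by case: (s == 0); case: (t == 0); rewrite ?addr0 ?add0r // lerDl.
have one (G : F -> R) : \sum_s G s * (s == 0)%:R = G 0.
  by rewrite (bigD1 0) // eqxx mulr1 big1 => [|s /negPf ->] /=; rewrite ?addr0 ?mulr0.
rewrite (eq_bigr (fun s => \sum_t r s * r t * (s == 0)%:R + r s * r 0)); last first.
  by move=> s _; rewrite big_split one.
rewrite big_split /= -mulr_suml sum_rep.
have -> : \sum_s \sum_t r s * r t * (s == 0)%:R = r 0 * N ^+ 2.
  by rewrite exchange_big; under eq_bigr do rewrite one; rewrite -mulr_sumr sum_rep.
rewrite [r 0 * _]mulrC -mulrDr; have -> : 2 * N ^+ 3 = N ^+ 2 * (N + N) by ring.
by rewrite ler_wpM2l ?exprn_ge0 // lerD ?rep_le.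
Qed.

(** The product 0 accounts for (2 N^3)^2. For nonzero differences, s t = u v is the same as u / s =
    t / v, so counting by the common ratio replaces the squares of product counts by the squares of
    e. *)
Lemma Dtimes_le : (Dtimes A)%:R <= 4 * N ^+ 6 + \sum_x mulen r0 x ^+ 2.
Proof.
rewrite Dtimes_prod_rep (bigD1 0) //= lerD //.
  have -> : 4 * N ^+ 6 = (2 * N ^+ 3) ^+ 2 by ring.
  exact: ler_sqr_mono (prod_rep_ge0 0) prod_rep0.
have r00 : r0 0 = 0 by rewrite /rep0 eqxx.
pose M l := \sum_s r0 s * r0 (l / s).
have ME l : l != 0 -> prod_rep l = M l.
  move=> l0; apply: eq_bigr => s _; case: (eqVneq s 0) => [-> | s0].
    by rewrite r00 mul0r big1 // => t _; rewrite mul0r eq_sym (negPf l0) mulr0.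
  rewrite (bigD1 (l / s)) //= big1 => [|t nt].
    by rewrite mulrC [s * _]mulrC divfK // eqxx addr0 mul1r /rep0 (negPf s0) mulf_eq0 invr_eq0 (negPf l0) (negPf s0).
  by case: eqP => [e|_]; rewrite ?mulr0 //; case/eqP: nt; rewrite -e mulrC mulKf.
apply: (@le_trans _ _ (\sum_l M l ^+ 2)).
  rewrite big_mkcond /=; apply: ler_sum => l _; case: ifP => [h | _]; last exact: sqr_ge0.
  by rewrite ME.
rewrite le_eqVlt; apply/orP; left; apply/eqP.
transitivity (\sum_s r0 s * \sum_u \sum_l r0 u * (r0 (l / s) * r0 (l / u))).
  transitivity (\sum_l \sum_s \sum_u r0 s * (r0 u * (r0 (l / s) * r0 (l / u)))).
    by apply: eq_bigr => l _; rewrite expr2 /M big_distrlr /=; apply: eq_bigr => s _; apply: eq_bigr => u _; ring.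
  rewrite exchange_big; apply: eq_bigr => s _; rewrite exchange_big mulr_sumr; apply: eq_bigr => u _.
  by rewrite mulr_sumr.
rewrite (sum_dilate r00 (fun s u => \sum_l r0 u * (r0 (l / s) * r0 (l / u)))).
transitivity (\sum_s \sum_x (r0 s * r0 (x * s)) * \sum_v r0 v * r0 (x * v)).
  apply: eq_bigr => s _; rewrite mulr_sumr; apply: eq_bigr => x _; rewrite -mulr_sumr mulrA.
  case: (eqVneq s 0) => [-> | s0]; first by rewrite r00 !mul0r.
  case: (eqVneq x 0) => [-> | x0]; first by rewrite mul0r r00 mulr0 !mul0r.
  congr (_ * _); rewrite (reindex_inj (mulIf (mulf_neq0 x0 s0))) /=; apply: eq_bigr => v _.
  rewrite mulfK ?mulf_neq0 // mulrC; congr (_ * _); congr (r0 _).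
  by rewrite mulrA mulfK // mulrC.
by rewrite exchange_big; apply: eq_bigr => x _; rewrite -mulr_suml expr2.
Qed.
End DifferenceProducts.

(** * Absorbing logarithms and constants into powers of n *)

Section Asymptotics.
Variable R : realType.

Lemma log_parameter : exists2 c : R, 1 <= c & forall n : nat, (2 <= n)%N ->
  exists La : nat, [/\ (0 < La)%N, log_dominates n La & La%:R <= c * n%:R `^ (1 / 1000)].
Proof.
have l2 : 0 < ln 2 :> R by rewrite ln_gt0 // ltr1n.
exists (24 * (1 + 1000 / ln 2)); first by have := divr_ge0 (ler0n R 1000) (ltW l2); lra.
move=> n n2; have n0 : (0 < n)%N by apply: leq_trans n2.
(* 24 = 6 + 18: 2^6 absorbs the factor 36, and 2^(18 (t + 1)) the power n^18. *)
pose t := trunc_log 2 n; exists (24 * t.+1)%N; split => //.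
  rewrite /log_dominates; have nt : (n <= 2 ^ t.+1)%N by apply/ltnW/trunc_log_ltn.
  have -> : (24 * t.+1 = 6 * t.+1 + t.+1 * 18)%N by lia.
  rewrite expnD leq_mul //; last by rewrite expnM leq_exp2r.
  by apply: (@leq_trans (2 ^ 6)) => //; rewrite leq_pexp2l // leq_pmulr.
have N1 : 1 <= n%:R :> R by rewrite ler1n.
have N0 : 0 < n%:R :> R by rewrite ltr0n.
have tl : t%:R * ln 2 <= ln n%:R :> R.
  rewrite -[t%:R * _]mulrC mulr_natr -lnXn // ler_ln ?posrE ?exprn_gt0 // -natrX ler_nat.
  exact: trunc_logP.
have ln1000 : ln n%:R <= 1000 * n%:R `^ (1 / 1000) :> R.
  rewrite /powR gt_eqF //; have := expR_ge1Dx (1 / 1000 * ln n%:R : R); lra.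
have y1 : 1 <= n%:R `^ (1 / 1000) :> R.
  by rewrite -[leLHS](powRr0 (n%:R : R)); apply: (ler_powR N1); lra.
have t1 : t%:R <= 1000 * n%:R `^ (1 / 1000) / ln 2 :> R.
  by rewrite ler_pdivlMr //; apply: le_trans tl ln1000.
rewrite natrM -(natr1 t); move: t1 y1; rewrite [1000 * _ / _]mulrAC.
move: (1000 / ln 2) (n%:R `^ (1 / 1000)) (t%:R : R) => u y v h1 h2.
by rewrite -mulrA; apply: ler_wpM2l; [exact: ler0n | rewrite mulrDl mul1r addrC lerD].
Qed.

Lemma energy_power_bound : exists2 K : R, 0 <= K &
  forall (p : nat) (A : {set 'F_p}) (n La : nat), let D := \sum_x mulen (rep0 R A) x ^+ 2 in
  prime p -> #|A| = n -> (16 <= n)%N -> (0 < La)%N -> log_dominates n La ->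
  (144 * (n * La) <= p ^ 2)%N -> 64 * n%:R ^+ 3 <= p%:R ^+ 2 :> R -> 32 * n%:R ^+ 6 <= D ->
  64 * n%:R ^+ 8 <= p%:R * D -> 1152 * n%:R ^+ 10 * La%:R <= p%:R ^+ 2 * D ->
  D ^+ 40 <= K * n%:R ^+ 259 * La%:R ^+ 60.
Proof.
have [c1 c1E] : exists c1 : R, c1 = 2 ^+ 25 by exists (2 ^+ 25).
have [c2 c2E] : exists c2 : R, c2 = 260 ^+ 2 by exists (260 ^+ 2).
have c1ge : 1 <= c1 by rewrite c1E exprn_ege1 // ler1n.
have c2ge : 1 <= c2 by rewrite c2E exprn_ege1 // ler1n.
exists ((32 ^+ 2 * 9 * 4 * 16 ^+ 3 * c1 ^+ 4) ^+ 4 * (512 * c2 ^+ 2 * c1 ^+ 3)).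
  have e (x : R) m (x0 : 0 <= x) : 0 <= x ^+ m := exprn_ge0 m x0.
  have M (x y : R) (x0 : 0 <= x) (y0 : 0 <= y) : 0 <= x * y := mulr_ge0 x0 y0.
  have c10 := le_trans ler01 c1ge; have c20 := le_trans ler01 c2ge.
  have k1 : 0 <= 32 ^+ 2 * 9 * 4 * 16 ^+ 3 :> R by rewrite -!natrX -!natrM ler0n.
  exact: (M _ _ (e _ 4%N (M _ _ k1 (e _ 4%N c10))) (M _ _ (M _ _ (ler0n R 512) (e _ 2%N c20)) (e _ 3%N c10))).
move=> p A n La D pp An n16 La0 hLa h1 h2 h3 h4 h5.
have n4 := leq_trans (isT : 4 <= 16)%N n16.
apply: (main_inequality An n16 La0 hLa h2 h3 h4 h5 c1ge c2ge).
  by rewrite c1E => eta e1 e2; apply: level_bound.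
by rewrite c2E => X X0 X1 X2; apply: ratio_energy.
Qed.

(** The side conditions of [energy_power_bound] are largely lower bounds for D. So assume D exceeds
    (1 + K1) n^th: the conditions hold, and their conclusion contradicts the assumption. *)
Lemma difference_products_bound : exists2 C : R, 0 < C &
  forall (p : nat) (A : {set 'F_p}), prime p -> #|A|%:R <= p%:R `^ (2846 / 4991) :> R ->
    (Dtimes A)%:R <= C * #|A|%:R `^ (13 / 2 - 1 / 192).
Proof.
have [K K0 main] := energy_power_bound; have [cL cL1 logs] := log_parameter.
have [B BE] : exists B, B = 1152 * cL by exists (1152 * cL).
have B1 : 1152 <= B by clear - cL1 BE; lra.
have B0 : 0 <= B by clear - B1; lra.
have B64 : 64 <= B by clear - B1; lra.
have cL0 : 0 <= cL by clear - cL1; lra.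
have [K1 K1E] : exists K1, K1 = K * cL ^+ 60 by exists (K * cL ^+ 60).
have K10 : 0 <= K1 by rewrite K1E; exact: mulr_ge0 K0 (exprn_ge0 _ cL0).
have [M ME] : exists M, M = B `^ 2000 by exists (B `^ 2000).
have M0 : 0 <= M by rewrite ME powR_ge0.
have [th thE] : exists th : R, th = 13 / 2 - 1 / 192 by exists (13 / 2 - 1 / 192).
have C0 : 0 < 5 + K1 + M by clear - K10 M0; lra.
exists (5 + K1 + M) => // p A pp; set n := #|A| => hn; rewrite -thE.
case: (posnP n) => [n0 | n0].
  have := Dtimes_le8 R A; rewrite -/n n0 expr0n /= => h; apply: le_trans h _.
  exact: mulr_ge0 (ltW C0) (powR_ge0 _ _).
have N0 : 0 < n%:R :> R by rewrite ltr0n.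
have N1 : 1 <= n%:R :> R by rewrite ler1n.
have Nn0 := lt0r_neq0 N0.
have [P PE] : exists P : R -> R, forall x, P x = n%:R `^ x by exists (fun x => n%:R `^ x).
have P0 x : 0 <= P x by rewrite PE powR_ge0.
have PD x y : P (x + y) = P x * P y by rewrite !PE powRD // Nn0 implybT.
have PX k : (n%:R : R) ^+ k = P k%:R by rewrite PE powR_mulrn // ltW.
have PXm x k : P (x * k%:R) = P x ^+ k by rewrite !PE powRrM -powR_mulrn // powR_ge0.
have Pm x y : x <= y -> P x <= P y by move=> h; rewrite !PE ler_powR.
have Pn : P 1 = n%:R by rewrite -(PX 1) expr1.
(* Once y = n^(1/1000) reaches B, it absorbs the constants. Otherwise n^2 = y^2000 is at most M, and
   the trivial bound n^8 suffices. *)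
rewrite -PE; pose y := P (1 / 1000); have y0 : 0 <= y := P0 _.
have th2 : 8 <= th + 2 by clear - thE; lra.
have th6 : 6 <= th by clear - thE; lra.
case: (leP B y) => hy; last first.
  apply: le_trans (Dtimes_le8 R A) _; rewrite -/n PX; apply: (@le_trans _ _ (P (th + 2))); first exact: Pm.
  rewrite PD mulrC; apply: (ler_wpM2r (P0 th)); apply: (@le_trans _ _ M).
    have -> : P 2 = y `^ 2000 by rewrite /y !PE -powRrM; congr (_ `^ _); clear; field.
    by rewrite ME; apply: (ge0_ler_powR (ler0n R 2000)); rewrite ?nnegrE ?(ltW hy).
  by clear - K10; lra.
have B16 : 16 <= B by clear - B1; lra.
have n16 : (16 <= n)%N.
  rewrite -(ler_nat R); apply: (le_trans B16); apply: (le_trans hy); rewrite -Pn; apply: Pm; clear; lra.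
have [La [La0 hLa LaB]] := logs _ (leq_trans (isT : 2 <= 16)%N n16).
rewrite -PE -/y in LaB.
have [D DE] : exists D, D = \sum_x mulen (rep0 R A) x ^+ 2 by exists (\sum_x mulen (rep0 R A) x ^+ 2).
have DD : (Dtimes A)%:R <= 4 * n%:R ^+ 6 + D by rewrite DE; exact: Dtimes_le.
have N6 : (n%:R : R) ^+ 6 <= P th by rewrite PX; exact: Pm.
have K1P : 0 <= K1 * P th := mulr_ge0 K10 (P0 th).
have MP : 0 <= M * P th := mulr_ge0 M0 (P0 th).
case: (leP D ((1 + K1) * P th)) => hD.
  apply: (le_trans DD); move: hD; rewrite !mulrDl mul1r; move: MP N6.
  move: (n%:R ^+ 6) (P th) (K1 * _) (M * _) => a b c d; clear; lra.
have D1 : P th <= D.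
  apply: ltW; apply: le_lt_trans hD; rewrite mulrDl mul1r; move: K1P; move: (P th) (K1 * _) => a b; clear; lra.
have D0 : 0 <= D := le_trans (P0 _) D1.
have pn : P (4991 / 2846) <= p%:R.
  have e : (2846 / 4991 * (4991 / 2846) : R) = 1 by clear; field.
  have p0 : 0 <= p%:R :> R by apply: ler0n.
  have e0 : 0 <= 4991 / 2846 :> R by clear; lra.
  rewrite [leRHS](_ : _ = (p%:R `^ (2846 / 4991)) `^ (4991 / 2846)); last by rewrite -powRrM e powRr1.
  by rewrite PE; apply: (ge0_ler_powR e0 _ _ hn); rewrite nnegrE ?powR_ge0 ?ler0n.
(* 242/69 is just below 2 * 4991/2846. The tight condition is 1152 n^10 La <= p^2 D: it needs 242/69
   + 13/2 - 1/192 >= 10 + 2/1000, one 1/1000 being for the constant and one for [La], and this holds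
   by less than 1/10000. *)
have p2 : P (242 / 69) <= p%:R ^+ 2.
  apply: le_trans (ler_sqr_mono (P0 _) pn).
  by rewrite expr2 -PD; apply: Pm; clear; lra.
have p1 : P (17 / 10) <= p%:R by apply: le_trans pn; apply: Pm; clear; lra.
have step a b : a + 1 / 1000 <= b -> B * P a <= P b.
  by move=> h; apply: le_trans (Pm _ _ h); rewrite PD mulrC; apply: ler_wpM2l.
have step64 k b : k%:R + 1 / 1000 <= b -> 64 * n%:R ^+ k <= P b.
  by move=> h; apply: le_trans (step _ _ h); rewrite PX; apply: ler_wpM2r.
have stepL k b : k%:R + 1 / 1000 + 1 / 1000 <= b -> 1152 * n%:R ^+ k * La%:R <= P b.
  move=> h; apply: le_trans (step _ _ h); rewrite PD -/y -PX BE.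
  have -> : 1152 * cL * ((n%:R : R) ^+ k * y) = 1152 * n%:R ^+ k * (cL * y) by clear; ring.
  by apply: (ler_wpM2l (mulr_ge0 (ler0n R 1152) (exprn_ge0 _ (ler0n R _)))); exact: LaB.
have DX : D ^+ 40 <= K * n%:R ^+ 259 * La%:R ^+ 60.
  rewrite DE; apply: (main p A n La pp (erefl _) n16 La0 hLa); rewrite -?DE.
  - rewrite -(ler_nat R) natrX !natrM; apply: le_trans p2; apply: le_trans (stepL 1%N _ _); last by clear; lra.
    by rewrite mulrA expr1 -!mulrA; apply: ler_wpM2r; rewrite ?ler_nat // mulr_ge0 ?ler0n.
  - by apply: le_trans p2; apply: step64; clear; lra.
  - apply: le_trans D1; apply: le_trans (step64 6%N _ _); last by clear - thE; lra.
    by apply: ler_wpM2r; rewrite ?exprn_ge0 ?ler0n ?ler_nat.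
  - apply: (@le_trans _ _ (P (17 / 10) * P th)); last exact: ler_pM.
    by rewrite -PD; apply: step64; clear - thE; lra.
  - apply: (@le_trans _ _ (P (242 / 69) * P th)); last exact: ler_pM.
    by rewrite -PD; apply: stepL; clear - thE; lra.
suff : D <= (1 + K1) * P th by rewrite leNgt hD.
have K11 : 1 <= 1 + K1 by clear - K10; lra.
have K1n : 0 <= 1 + K1 := le_trans ler01 K11.
have LaX : La%:R ^+ 60 <= (cL * y) ^+ 60 :> R.
  by rewrite lerXn2r ?nnegrE ?ler0n // mulr_ge0.
have i40 := @ler_pXn2r R 40 isT; rewrite -i40 ?nnegrE ?mulr_ge0 //.
apply: (le_trans DX); rewrite exprMn -PXm.
(* 40 th = 260 - 5/24 exceeds 259 + 60/1000. *)
have e : (n%:R : R) ^+ 259 * y ^+ 60 <= P (th * 40%:R).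
  by rewrite /y -PXm PX -PD; apply: Pm; clear - thE; lra.
apply: (@le_trans _ _ (K1 * P (th * 40%:R))).
  apply: (@le_trans _ _ (K1 * ((n%:R : R) ^+ 259 * y ^+ 60))); last exact: ler_wpM2l.
  have -> : K1 * ((n%:R : R) ^+ 259 * y ^+ 60) = K * n%:R ^+ 259 * (cL * y) ^+ 60.
    by rewrite K1E exprMn; move: (cL ^+ _) (n%:R ^+ _) (y ^+ _) => u v w; clear; ring.
  by apply: (ler_wpM2l (mulr_ge0 K0 (exprn_ge0 _ (ler0n R n)))); exact: LaX.
apply: ler_wpM2r => //; apply: (@le_trans _ _ (1 + K1)); first by clear; lra.
by apply: ler_eXnr.
Qed.
End Asymptotics.

Theorem theorem37 (R : realType) :
  (forall c : R, c < 1 / 434 ->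
     exists2 C : R, 0 < C &
       forall (p : nat) (A : {set 'F_p}), prime p -> odd p ->
         #|A|%:R <= p%:R `^ (2846 / 4991) :> R ->
         (Dtimes A)%:R <= C * #|A|%:R `^ (13 / 2 - c))
  /\
  (forall c1 : R, c1 < 1 / 192 ->
     exists2 C : R, 0 < C &
       forall (p : nat) (A : {set 'F_p}), prime p -> odd p ->
         #|A|%:R <= p%:R `^ (48 / 97) :> R ->
         (Dtimes A)%:R <= C * #|A|%:R `^ (13 / 2 - c1)).
Proof.
(* One bound serves both claims, as 1/434 < 1/192 and 48/97 < 2846/4991. *)
have [C C0 bound] := difference_products_bound R.
have weaken p (A : {set 'F_p}) (c : R) : c <= 1 / 192 -> prime p ->
    #|A|%:R <= p%:R `^ (2846 / 4991) :> R -> (Dtimes A)%:R <= C * #|A|%:R `^ (13 / 2 - c).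
  move=> hc pp hA; case: (posnP #|A|) => [A0 | A0].
    apply: le_trans (Dtimes_le8 R A) _.
    by rewrite A0 expr0n /= mulr_ge0 ?powR_ge0 // ltW.
  apply: le_trans (bound _ _ pp hA) _; rewrite ler_wpM2l ?(ltW C0) // ler_powR ?ler1n //.
  by rewrite lerD2l lerN2.
split=> c hc; exists C => // p A pp _ hA; apply: weaken => //; first by lra.
  by lra.
by apply: le_trans hA _; rewrite ler_powR ?ler1n ?prime_gt0 //; lra.
Qed.
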